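(* For every integer $n\ge 2$, let $A_{0,n+3}$ be the arrangement of hyperplanes in $\mathbb P^n$ defined by the vanishing of \[ \left(\prod_{i=0}^n x_i\right)\left(\prod_{i=1}^n (x_i-x_0)\right)\left(\prod_{1\le i<j\le n}(x_i-x_j)\right), \] and let $\mathcal W(A_{0,n+3})$ be its resonance web. Then \[ \operatorname{rank}\bigl(\mathcal W(A_{0,n+3})\bigr)=3\binom{n+3}{4}-\binom{n+2}{3}-\binom{n+1}{2}-n . \]
   Context: **Webs and rank.** A germ of codimension one $k$-web $\mathcal W=\mathcal F_1\boxtimes\cdots\boxtimes\mathcal F_k$ on $(\mathbb C^n,0)$ is a collection of $k$ germs of smooth codimension one holomorphic foliations such that any two distinct ones have distinct tangent spaces at $0$. If $\mathcal F_i$ is defined by the integrable $1$-form $\omega_i$, the space of abelian relations of $\mathcal W$ is the complex vector space \[ \mathcal A(\mathcal W)=\Bigl\{(\eta_i)_{i=1}^k\in\Omega^1(\mathbb C^n,0)^k \;\Big|\; d\eta_i=0,\ \eta_i\wedge\omega_i=0\ \forall i,\ \sum_{i=1}^k\eta_i=0\Bigr\}, \] and $\operatorname{rank}(\mathcal W)=\dim_{\mathbb C}\mathcal A(\mathcal W)$. For a global web given by finitely many pairwise distinct foliations on a complex manifold, the rank is the rank of its germ at a generic point (it does not depend on the generic point). **Resonance web.** For a hyperplane arrangement $A$ in $\mathbb P^n$ with complement $M$, identify $H^1(M)=H^1(M,\mathbb C)$ with the space of logarithmic $1$-forms spanned by $d\log h_i-d\log h_j$, where the $h_i$ are linear equations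 of the hyperplanes. The irreducible components $\Sigma$ of the first resonance variety $R^1(A)\subset H^1(M)$ are the maximal isotropic subspaces of dimension at least two for the product $\wedge:H^1(M)\otimes H^1(M)\to H^2(M)$. Each component $\Sigma$ of dimension $d$ determines a rational map $f_\Sigma:\mathbb P^n\dashrightarrow\mathbb P^1$ with irreducible generic fiber, unique up to automorphisms of $\mathbb P^1$, restricting to a morphism $M\to C_\Sigma$, where $C_\Sigma$ is $\mathbb P^1$ minus $d+1$ points, with $f_\Sigma^*H^1(C_\Sigma)=\Sigma$. The foliation $\mathcal F_\Sigma$ is given by the level sets of $f_\Sigma$. The resonance web $\mathcal W(A)$ is the superposition of the foliations $\mathcal F_\Sigma$, with $\Sigma$ ranging over all irreducible components of $R^1(A)$. **The case of $A_{0,n+3}$.** The complement of $A_{0,n+3}$ is the moduli space $\mathfrak M_{0,n+3}$ of $n+3$ distinct ordered points of $\mathbb P^1$: the point $(1:x_1:\cdots:x_n)$ corresponds to the class of the $(n+3)$-tuple $(x_1,\dots,x_n,0,1,\infty)$. It is known (Cohen–Suciu) that $R^1(A_{0,n+3})$ has exactly $\binom{n+3}{4}$ irreducible components, all of dimension two, and that the associated maps are the forgetful maps $\mathfrak M_{0,n+3}\to\mathfrak M_{0,4}\simeq\mathbb C\setminus\{0,1\}$ that keep the points with index in a given $4$-element subset of $\{1,\dots,n+3\}$ (that is, the cross-ratios of these four points). Hence $\mathcal W(A_{0,n+3})$ is the $\binom{n+3}{4}$-web on $\mathfrak M_{0,n+3}$ defined by these maps. *)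

(* Defs.v *)
From HB Require Import structures.
From mathcomp Require Import all_boot all_order all_algebra.
From mathcomp Require Export multinomials.mpoly.
From mathcomp Require Export reals complex.

Set Implicit Arguments.
Unset Strict Implicit.
Unset Printing Implicit Defensive.

Import GRing.Theory Num.Theory.
Local Open Scope ring_scope.

(** * Germs of holomorphic functions and 1-forms on (C^n, 0)

   The ring of germs is C{z_1, ..., z_n}: a germ is given by the family of its
   Taylor coefficients, subject to [ps_convergent].  Two germs are equal when
   all their coefficients are. *)

Definition pseries (K : Type) (n : nat) : Type := 'X_{1..n} -> K.

Definition ps_convergent (K : numFieldType) (n : nat) (c : pseries K n) : Prop :=
  exists M rho : K, [/\ 0 <= M, 0 <= rho &
    forall m : 'X_{1..n}, `|c m| <= M * rho ^+ mdeg m].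

(* Cauchy product; same formula as [mcoeffM] for polynomials. *)
Definition ps_mul (K : nzRingType) (n : nat) (c d : pseries K n) : pseries K n :=
  fun m => \sum_(k : 'X_{1..n < (mdeg m).+1, (mdeg m).+1}
                  | m == (k.1 + k.2)%MM) c k.1 * d k.2.

Definition ps_deriv (K : nzRingType) (n : nat) (i : 'I_n) (c : pseries K n) :
  pseries K n := fun m => c (m + U_(i))%MM *+ (m i).+1.

(* [w i] is the coefficient of dz_i. *)
Definition form_germ (K : Type) (n : nat) : Type := 'I_n -> pseries K n.

Definition form_holo (K : numFieldType) (n : nat) (w : form_germ K n) : Prop :=
  forall i, ps_convergent (w i).

Definition form_closed (K : nzRingType) (n : nat) (w : form_germ K n) : Prop :=
  forall (i j : 'I_n) (m : 'X_{1..n}), ps_deriv i (w j) m = ps_deriv j (w i) m.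

(* v /\ w = 0 *)
Definition form_wedge0 (K : nzRingType) (n : nat) (v w : form_germ K n) : Prop :=
  forall (i j : 'I_n) (m : 'X_{1..n}),
    ps_mul (v i) (w j) m = ps_mul (v j) (w i) m.

(* w /\ dw = 0 *)
Definition form_integrable (K : nzRingType) (n : nat) (w : form_germ K n) : Prop :=
  forall (i j k : 'I_n) (m : 'X_{1..n}),
    let dw (a b : 'I_n) : pseries K n :=
      fun m' => ps_deriv a (w b) m' - ps_deriv b (w a) m' in
    ps_mul (w i) (dw j k) m + ps_mul (w j) (dw k i) m + ps_mul (w k) (dw i j) m
      = 0.

Definition form_at0 (K : Type) (n : nat) (w : form_germ K n) : 'I_n -> K :=
  fun i => w i 0%MM.

(* Vanishing of the exterior product of two covectors. *)
Definition covec_wedge0 (K : nzRingType) (n : nat) (u v : 'I_n -> K) : Prop :=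
  forall i j : 'I_n, u i * v j = u j * v i.

(** * Germs of webs, abelian relations, rank *)

(* For covectors, u /\ v <> 0 says that both are nonzero and that their kernels
   differ; nonvanishing is stated separately for the case of a 1-web. *)
Definition web_germ (K : numFieldType) (n k : nat) (w : 'I_k -> form_germ K n) :
  Prop :=
  [/\ forall a, form_holo (w a) /\ form_integrable (w a),
      forall a, exists i, form_at0 (w a) i != 0 &
      forall a b, a != b -> ~ covec_wedge0 (form_at0 (w a)) (form_at0 (w b))].

Definition abelian_relation (K : numFieldType) (n k : nat)
    (w : 'I_k -> form_germ K n) (eta : 'I_k -> form_germ K n) : Prop :=
  [/\ forall a, form_holo (eta a),
      forall a, form_closed (eta a),
      forall a, form_wedge0 (eta a) (w a) &
      forall (i : 'I_n) (m : 'X_{1..n}), \sum_(a < k) eta a i m = 0].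

(* The space of abelian relations has a basis with r elements. *)
Definition web_germ_rank (K : numFieldType) (n k : nat)
    (w : 'I_k -> form_germ K n) (r : nat) : Prop :=
  exists e : 'I_r -> 'I_k -> form_germ K n,
    [/\ forall s, abelian_relation w (e s),
        forall c : 'I_r -> K,
          (forall a i m, \sum_(s < r) c s * e s a i m = 0) ->
          forall s, c s = 0 &
        forall eta, abelian_relation w eta ->
          exists c : 'I_r -> K,
            forall a i m, eta a i m = \sum_(s < r) c s * e s a i m].

(** * Arrangements and logarithmic forms

   An arrangement in P^n is given by linear equations [h j], j in J, of its
   hyperplanes, in the homogeneous coordinates 'X_0, ..., 'X_n.  Forms and
   functions on its complement M are pulled back to the complement of the cone
   in C^(n+1); this pull-back is injective on forms. *)

Definition in_compl (K : nzRingType) (N : nat) (J : finType)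
    (h : J -> {mpoly K[N]}) (x : 'I_N -> K) : Prop :=
  forall j, (h j).@[x] != 0.

Definition dlog (K : fieldType) (N : nat) (p : {mpoly K[N]}) (x : 'I_N -> K) :
  'I_N -> K := fun i => (p^`M(i)).@[x] / p.@[x].

Definition log_form (K : fieldType) (N : nat) (J : finType)
    (h : J -> {mpoly K[N]}) (a : {ffun J -> K^o}) (x : 'I_N -> K) : 'I_N -> K :=
  fun i => \sum_j a j * dlog (h j) x i.

(* H^1(M), in coordinates: the vector a stands for the logarithmic form
   [log_form h a], and the generators below for dlog h_i - dlog h_j. *)
Definition H1 (K : fieldType) (J : finType) : {vspace {ffun J -> K^o}} :=
  <<[seq [ffun k => (k == i)%:R - (k == j)%:R : K^o] | i <- enum J, j <- enum J]>>%VS.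

(* The product of two classes is computed on logarithmic forms: by Brieskorn's
   theorem the algebra they generate is mapped isomorphically onto H^*(M), so
   the product vanishes in H^2(M) iff the 2-form does. *)
Definition isotropic (K : fieldType) (N : nat) (J : finType)
    (h : J -> {mpoly K[N]}) (S : {vspace {ffun J -> K^o}}) : Prop :=
  forall a b, a \in S -> b \in S -> forall x, in_compl h x ->
    covec_wedge0 (log_form h a x) (log_form h b x).

(* Irreducible components of the resonance variety R^1. *)
Definition resonance_component (K : fieldType) (N : nat) (J : finType)
    (h : J -> {mpoly K[N]}) (S : {vspace {ffun J -> K^o}}) : Prop :=
  [/\ (S <= H1 K J)%VS, isotropic h S, (2 <= \dim S)%N &
      forall S' : {vspace {ffun J -> K^o}},
        (S' <= H1 K J)%VS -> isotropic h S' -> (S <= S')%VS -> S' = S].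

(** * The rational maps attached to the components *)

Definition mconstant (K : nzRingType) (N : nat) (p : {mpoly K[N]}) : Prop :=
  exists c : K, p = c%:MP.

Definition mcoprime (K : nzRingType) (N : nat) (p q : {mpoly K[N]}) : Prop :=
  forall r s t : {mpoly K[N]}, p = r * s -> q = r * t -> mconstant r.

Definition mirreducible (K : nzRingType) (N : nat) (p : {mpoly K[N]}) : Prop :=
  ~ mconstant p /\
  forall r s : {mpoly K[N]}, p = r * s -> mconstant r \/ mconstant s.

(* f = (f.1 : f.2) is a rational map from P^n to P^1 in lowest terms. *)
Definition rational_map (K : nzRingType) (N : nat)
    (f : {mpoly K[N]} * {mpoly K[N]}) : Prop :=
  (exists d : nat, f.1 \is d.-homog /\ f.2 \is d.-homog) /\ mcoprime f.1 f.2.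

(* The fiber over (l : 1) is the hypersurface f.1 - l * f.2 = 0. *)
Definition irreducible_generic_fiber (K : nzRingType) (N : nat)
    (f : {mpoly K[N]} * {mpoly K[N]}) : Prop :=
  exists s : seq K, forall l, l \notin s -> mirreducible (f.1 - l *: f.2).

(* C_S is P^1 minus the points (u_k : v_k), k = 0, ..., dim S, which are pairwise
   distinct (and (u_k, v_k) != 0, as dim S >= 2).  [g k] is the pull-back of the
   equation of the k-th point, so [in_compl g] is the preimage of C_S, and
   H^1(C_S) is pulled back to the forms [log_form g b], b in [H1]. *)
Definition resonance_map (K : fieldType) (N : nat) (J : finType)
    (h : J -> {mpoly K[N]}) (S : {vspace {ffun J -> K^o}})
    (f : {mpoly K[N]} * {mpoly K[N]}) : Prop :=
  [/\ rational_map f, irreducible_generic_fiber f &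
      exists u v : 'I_(\dim S).+1 -> K,
        let g k := v k *: f.1 - u k *: f.2 in
        [/\ forall k l, k != l -> u k * v l != u l * v k,
            forall x, in_compl h x -> in_compl g x,
            forall b, b \in H1 K 'I_(\dim S).+1 -> exists2 a, a \in S &
              forall x, in_compl h x -> log_form g b x =1 log_form h a x &
            forall a, a \in S -> exists2 b, b \in H1 K 'I_(\dim S).+1 &
              forall x, in_compl h x -> log_form h a x =1 log_form g b x]].

(** * The resonance web and its rank *)

(* A polynomial P(X_0, ..., X_n) restricted to the chart X_0 = 1 and expanded at
   the point p: P(1, p_1 + z_1, ..., p_n + z_n). *)
Definition localize (K : nzRingType) (n : nat) (p : 'I_n -> K)
    (P : {mpoly K[n.+1]}) : {mpoly K[n]} :=
  P \mPo [tuple oapp (fun i : 'I_n => 'X_i + (p i)%:MP) 1 (unlift ord0 j)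
         | j < n.+1].

(* Germ at p of f.2 d(f.1) - f.1 d(f.2) = f.2^2 d(f.1 / f.2), which defines the
   foliation by level sets of f where it does not vanish. *)
Definition level_form (K : nzRingType) (n : nat)
    (f : {mpoly K[n.+1]} * {mpoly K[n.+1]}) (p : 'I_n -> K) : form_germ K n :=
  fun i m =>
    let P := localize p f.1 in let Q := localize p f.2 in
    (Q * P^`M(i) - P * Q^`M(i))@_m.

(* The maps f_1, ..., f_k attached to the components S_1, ..., S_k of R^1, listed
   without repetition; the resonance web is formed by their level sets. *)
Definition resonance_web (K : fieldType) (N : nat) (J : finType)
    (h : J -> {mpoly K[N]}) (k : nat)
    (f : 'I_k -> {mpoly K[N]} * {mpoly K[N]}) : Prop :=
  exists S : 'I_k -> {vspace {ffun J -> K^o}},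
    [/\ injective S,
        forall T, resonance_component h T <-> exists a, T = S a &
        forall a, resonance_map h (S a) (f a)].

(* Rank at a generic point of P^n, i.e. at all points of a nonempty Zariski open
   set, which may be taken inside the chart X_0 <> 0.  The foliations do not
   depend on the choice of f, which is unique up to automorphisms of P^1. *)
Definition resonance_web_rank (K : numFieldType) (n : nat) (J : finType)
    (h : J -> {mpoly K[n.+1]}) (r : nat) : Prop :=
  exists (k : nat) (f : 'I_k -> {mpoly K[n.+1]} * {mpoly K[n.+1]}),
    resonance_web h f /\
    exists2 G : {mpoly K[n]}, G != 0 &
      forall p : 'I_n -> K, G.@[p] != 0 ->
        web_germ (fun a => level_form (f a) p) /\
        web_germ_rank (fun a => level_form (f a) p) r.

(** * The arrangement A_{0,n+3} *)

Definition A0_index (n : nat) : finType :=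
  ('I_n.+1 + 'I_n + {ij : 'I_n * 'I_n | (ij.1 < ij.2)%N})%type.

(* [lift ord0 i] runs over the indices 1, ..., n. *)
Definition A0 (K : nzRingType) (n : nat) (j : A0_index n) : {mpoly K[n.+1]} :=
  match j with
  | inl (inl i) => 'X_i
  | inl (inr i) => 'X_(lift ord0 i) - 'X_ord0
  | inr ij => 'X_(lift ord0 (val ij).1) - 'X_(lift ord0 (val ij).2)
  end.

(* Main.v *)
From HB Require Import structures.
Require Import Defs.
From mathcomp Require Import all_boot all_order all_algebra.
From mathcomp Require Import boolp.
From mathcomp Require Import ring lra zify.

Set Implicit Arguments.
Unset Strict Implicit.
Unset Printing Implicit Defensive.

Import Order.TTheory GRing.Theory Num.Theory.
Local Open Scope ring_scope.

(* Let N = n + 3.  A logarithmic 1-form on the complement has a weight along the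
   divisor where two of the N marked points of P^1 collide; these weights form a
   symmetric N x N matrix with zero row sums.  If the product of two forms
   vanishes, residues show that their pairs of weights, seen as vectors of K^2,
   are parallel on disjoint pairs of points, and this forces the weights of two
   independent forms to be carried by four of the points: the components of the
   resonance variety are the pull-backs of H^1(M_{0,4}) by the cross-ratios.

   Upper bound on the rank.  For each marked point j there is a tangent vector
   E_j moving this point only, and the differential of the cross-ratio of a
   4-subset J is nonzero on E_j exactly when j is in J.  Consider a relation whose
   components all vanish to order m; the leading part of the J-th one is a
   multiple of the m-th power of the linear form dJ, times dJ.  Differentiating
   along E_b, E_c, E_d and contracting with E_a kills it unless J = {a, b, c, d}.
   Hence a relation vanishing to order 3 is zero, and in orders m = 0, 1, 2 the
   components that contain 3 - m fixed points are determined by the other ones.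

   Lower bound.  The logarithms of the cross-ratios of J and the five-term
   relations of the dilogarithm give as many independent relations. *)

(** * The ring of formal power series *)

(** The dimension is never computed directly: two counts are compared. Since C(n+m, m+1) of the
    4-subsets contain 3 - m given points, the jets of order m = 0, 1, 2 that determine a relation
    number C(n+3,4) - C(n+m, m+1). On the other side each J carries two independent logarithms.
    Killing the coefficient of every hyperplane but X_0 = 0, whose logarithm vanishes in the chart,
    leaves at least 2 C(n+3,4) - n - C(n+1,2) logarithmic relations, and there is one five-term
    relation for each J without infinity. The totals agree, so the matrix of jets of the explicit
    relations is square and injective, hence invertible, and these relations form a basis. The upper
    bound is valid for formal series; convergence is a matter for the explicit relations. What
    complicates the first half is infinity: it is a marked point like the others for the symmetric
    group on n + 3 letters, but no hyperplane involves it. Its weights have to be recovered from row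
    sums, and its logarithms are those of constants. *)

Definition series (K : Type) (n : nat) : Type := pseries K n.

Section SeriesRing.
Variables (K : comNzRingType) (n : nat).
Implicit Types (a b c : series K n) (p q : {mpoly K[n]}).

HB.instance Definition _ := gen_eqMixin (series K n).
HB.instance Definition _ := gen_choiceMixin (series K n).

Definition ser_zero : series K n := fun=> 0.
Definition ser_opp a : series K n := fun m => - a m.
Definition ser_add a b : series K n := fun m => a m + b m.

Fact ser_addA : associative ser_add.
Proof. by move=> a b c; apply: funext => m; rewrite /ser_add addrA. Qed.
Fact ser_addC : commutative ser_add.
Proof. by move=> a b; apply: funext => m; rewrite /ser_add addrC. Qed.
Fact ser_add0 : left_id ser_zero ser_add.
Proof. by move=> a; apply: funext => m; rewrite /ser_add add0r. Qed.
Fact ser_addN : left_inverse ser_zero ser_opp ser_add.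
Proof. by move=> a; apply: funext => m; rewrite /ser_add addNr. Qed.

HB.instance Definition _ :=
  GRing.isZmodule.Build (series K n) ser_addA ser_addC ser_add0 ser_addN.

Definition of_mpoly p : series K n := fun m => p@_m.

Definition trunc_ser (d : nat) a : {mpoly K[n]} :=
  \sum_(m : 'X_{1..n < d}) a m *: 'X_[m].

Lemma coef_trunc_ser d a m : (mdeg m < d)%N -> (trunc_ser d a)@_m = a m.
Proof. exact: mcoeff_mpoly. Qed.

(* The coefficients of degree less than d of a product are those of the product
   of two polynomials: this transfers the ring axioms from {mpoly K[n]}. *)
Lemma ps_mul_trunc d a b p q m : (mdeg m < d)%N ->
    (forall m', (mdeg m' < d)%N -> p@_m' = a m') ->
    (forall m', (mdeg m' < d)%N -> q@_m' = b m') ->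
  ps_mul a b m = (p * q)@_m.
Proof.
move=> md pa qb; rewrite mcoeffM; apply: eq_bigr => -[k1 k2] /= _.
by rewrite pa ?qb // (leq_trans _ md) // bmdeg.
Qed.

Fact ser_mulA : associative (@ps_mul K n : series K n -> series K n -> series K n).
Proof.
move=> a b c; apply: funext => m; have md := ltnSn (mdeg m).
set d := (mdeg m).+1 in md.
rewrite (@ps_mul_trunc d _ _ (trunc_ser d a) (trunc_ser d b * trunc_ser d c)) //.
- rewrite mulrA; apply/esym.
  apply: (@ps_mul_trunc d) => // m' md'; rewrite ?coef_trunc_ser //.
  by apply/esym/(@ps_mul_trunc d) => // m2 md2; rewrite coef_trunc_ser.
- by move=> m' md'; rewrite coef_trunc_ser.
- move=> m' md'.
  by apply/esym/(@ps_mul_trunc d) => // m2 md2; rewrite coef_trunc_ser.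
Qed.

Fact ser_mulC : commutative (@ps_mul K n : series K n -> series K n -> series K n).
Proof.
move=> a b; apply: funext => m; set d := (mdeg m).+1.
rewrite (@ps_mul_trunc d _ _ (trunc_ser d a) (trunc_ser d b)) ?ltnSn //;
  try by move=> ? ?; rewrite coef_trunc_ser.
rewrite mulrC; apply/esym/(@ps_mul_trunc d) => //;
  by move=> ? ?; rewrite coef_trunc_ser.
Qed.

Fact ser_mul1 :
  left_id (of_mpoly 1) (@ps_mul K n : series K n -> series K n -> series K n).
Proof.
move=> a; apply: funext => m; set d := (mdeg m).+1.
rewrite (@ps_mul_trunc d _ _ 1 (trunc_ser d a)) ?ltnSn //.
  by rewrite mul1r coef_trunc_ser.
by move=> ? ?; rewrite coef_trunc_ser.
Qed.

Fact ser_mulDl : left_distributive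
  (@ps_mul K n : series K n -> series K n -> series K n) +%R.
Proof.
move=> a b c; apply: funext => m.
change (ps_mul (ser_add a b) c m = ps_mul a c m + ps_mul b c m).
rewrite /ps_mul -big_split /=.
by apply: eq_bigr => k _; rewrite -mulrDl.
Qed.

Fact ser_one_neq0 : of_mpoly 1 != 0.
Proof.
apply/eqP => /(congr1 (fun a : series K n => a 0%MM)); rewrite /of_mpoly mcoeff1 eqxx.
by move/eqP; rewrite oner_eq0.
Qed.

HB.instance Definition _ := GRing.Zmodule_isComNzRing.Build (series K n)
  ser_mulA ser_mulC ser_mul1 ser_mulDl ser_one_neq0.

Lemma serP a b : (forall m, a m = b m) -> a = b.
Proof. exact: funext. Qed.

Lemma ser0E m : (0 : series K n) m = 0. Proof. by []. Qed.
Lemma serDE a b m : (a + b) m = a m + b m. Proof. by []. Qed.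
Lemma serNE a m : (- a) m = - a m. Proof. by []. Qed.
Lemma serBE a b m : (a - b) m = a m - b m. Proof. by []. Qed.
Lemma serME a b : a * b = ps_mul a b. Proof. by []. Qed.
Lemma ser1E : (1 : series K n) = of_mpoly 1. Proof. by []. Qed.

Lemma ser_sumE (I : Type) (r : seq I) (P : pred I) (F : I -> series K n) m :
  (\sum_(i <- r | P i) F i) m = \sum_(i <- r | P i) F i m.
Proof. exact: (big_morph (fun a : series K n => a m)). Qed.

Lemma of_mpolyD p q : of_mpoly (p + q) = of_mpoly p + of_mpoly q.
Proof. by apply: serP => m; rewrite /of_mpoly mcoeffD. Qed.
Lemma of_mpolyN p : of_mpoly (- p) = - of_mpoly p.
Proof. by apply: serP => m; rewrite /of_mpoly mcoeffN. Qed.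
Lemma of_mpolyB p q : of_mpoly (p - q) = of_mpoly p - of_mpoly q.
Proof. by rewrite of_mpolyD of_mpolyN. Qed.
Lemma of_mpolyM p q : of_mpoly (p * q) = of_mpoly p * of_mpoly q.
Proof. by apply: serP => m; rewrite /of_mpoly mcoeffM. Qed.
Lemma of_mpoly0 : of_mpoly 0 = 0.
Proof. by apply: serP => m; rewrite /of_mpoly mcoeff0. Qed.

Definition cst (x : K) : series K n := of_mpoly x%:MP.

Lemma cstME x a m : (cst x * a) m = x * a m.
Proof.
rewrite serME (@ps_mul_trunc (mdeg m).+1 _ _ x%:MP (trunc_ser (mdeg m).+1 a)) //.
  by rewrite mcoeffCM coef_trunc_ser.
by move=> ? ?; rewrite coef_trunc_ser.
Qed.

Lemma cstE x m : cst x m = x * (m == 0%MM)%:R.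
Proof. exact: mcoeffC. Qed.

Lemma cst0 : cst 0 = 0. Proof. by rewrite /cst mpolyC0 of_mpoly0. Qed.
Lemma cst1 : cst 1 = 1. Proof. by rewrite /cst mpolyC1. Qed.
Lemma cstM x y : cst (x * y) = cst x * cst y.
Proof. by rewrite /cst mpolyCM of_mpolyM. Qed.
Lemma cstD x y : cst (x + y) = cst x + cst y.
Proof. by rewrite /cst mpolyCD of_mpolyD. Qed.
Lemma cstN x : cst (- x) = - cst x.
Proof. by rewrite /cst mpolyCN of_mpolyN. Qed.

Lemma ser_mul0E a b : (a * b) 0%MM = a 0%MM * b 0%MM.
Proof.
rewrite serME (@ps_mul_trunc 1 _ _ (trunc_ser 1 a) (trunc_ser 1 b)) ?mdeg0 //;
  try by move=> ? ?; rewrite coef_trunc_ser.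
by rewrite mcoeff0_is_multiplicative !coef_trunc_ser ?mdeg0.
Qed.

Definition sderiv (i : 'I_n) a : series K n := ps_deriv i a.

Lemma sderivE i a m : sderiv i a m = a (m + U_(i))%MM *+ (m i).+1.
Proof. by []. Qed.

Lemma sderivD i a b : sderiv i (a + b) = sderiv i a + sderiv i b.
Proof. by apply: serP => m; rewrite serDE !sderivE serDE mulrnDl. Qed.
Lemma sderivN i a : sderiv i (- a) = - sderiv i a.
Proof. by apply: serP => m; rewrite serNE !sderivE serNE mulNrn. Qed.
Lemma sderivB i a b : sderiv i (a - b) = sderiv i a - sderiv i b.
Proof. by rewrite sderivD sderivN. Qed.
Lemma sderiv0 i : sderiv i 0 = 0.
Proof. by apply: serP => m; rewrite sderivE mul0rn. Qed.
Lemma sderiv_sum i (I : Type) (r : seq I) (P : pred I) (F : I -> series K n) :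
  sderiv i (\sum_(j <- r | P j) F j) = \sum_(j <- r | P j) sderiv i (F j).
Proof. by apply: big_morph; [exact: sderivD | exact: sderiv0]. Qed.

Lemma sderiv_mpoly i p : sderiv i (of_mpoly p) = of_mpoly p^`M(i).
Proof. by apply: serP => m; rewrite sderivE /of_mpoly mcoeff_deriv. Qed.

Lemma sderivM i a b : sderiv i (a * b) = sderiv i a * b + a * sderiv i b.
Proof.
(* One degree more than for products: differentiating a truncation at [d] is correct only in degrees
   below [d.-1]. *)
apply: serP => m; set d := (mdeg m).+2; have md : (mdeg (m + U_(i)) < d)%N.
  by rewrite mdegD mdeg1 addn1.
have md' : (mdeg m < d.-1)%N by [].
rewrite sderivE serME (@ps_mul_trunc d _ _ (trunc_ser d a) (trunc_ser d b)) //;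
  try by move=> ? ?; rewrite coef_trunc_ser.
rewrite -mcoeff_deriv mderivM mcoeffD serDE.
have E c m' : (mdeg m' < d.-1)%N -> (trunc_ser d c)^`M(i)@_m' = sderiv i c m'.
  by move=> lt; rewrite mcoeff_deriv coef_trunc_ser // mdegD mdeg1 addn1.
have T c m' : (mdeg m' < d.-1)%N -> (trunc_ser d c)@_m' = c m'.
  by move=> lt; rewrite coef_trunc_ser // (leq_trans lt).
by congr (_ + _); apply/esym/(ps_mul_trunc md') => m' mm'; rewrite ?E ?T.
Qed.

Lemma sderiv_cst i x : sderiv i (cst x) = 0.
Proof. by rewrite sderiv_mpoly mderivC of_mpoly0. Qed.

Lemma sderiv_cstM i x a : sderiv i (cst x * a) = cst x * sderiv i a.
Proof. by rewrite sderivM sderiv_cst mul0r add0r. Qed.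

Lemma sderivC i j a : sderiv i (sderiv j a) = sderiv j (sderiv i a).
Proof.
apply: serP => m; rewrite !sderivE -!mulrnA -!addmA (addmC U_(i)%MM).
congr (_ *+ _); rewrite !mnmDE !mnm1E (eq_sym i).
by case: eqP => [->|_] //=; rewrite !addn0 mulnC.
Qed.

End SeriesRing.

Arguments cst {K n} x.
Arguments of_mpoly {K n} p.

(** * Convergence, and logarithms of affine functions *)

Section Convergence.
Variables (K : numFieldType) (n : nat).
Implicit Types (a b : series K n) (p h : {mpoly K[n]}) (e : 'I_n -> K).

Lemma conv0 : ps_convergent (0 : series K n).
Proof. by exists 0, 0; split=> // m; rewrite ser0E normr0 mul0r. Qed.

Lemma conv_widen a M rho rho' : 0 <= M -> 0 <= rho -> rho <= rho' ->
  (forall m, `|a m| <= M * rho ^+ mdeg m) ->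
  forall m, `|a m| <= M * rho' ^+ mdeg m.
Proof.
move=> M0 r0 rr' H m; apply: le_trans (H m) _.
by apply: ler_wpM2l => //; apply: lerXn2r; rewrite ?nnegrE // (le_trans r0).
Qed.

Lemma convD a b : ps_convergent a -> ps_convergent b -> ps_convergent (a + b).
Proof.
move=> [M [r [M0 r0 Ha]]] [M' [r' [M0' r0' Hb]]].
exists (M + M'), (r + r'); split; rewrite ?addr_ge0 // => m.
rewrite serDE (le_trans (ler_normD _ _)) // mulrDl lerD //.
  by apply: conv_widen Ha _ => //; rewrite lerDl.
by apply: conv_widen Hb _ => //; rewrite lerDr.
Qed.

Lemma conv_sum (I : Type) (r : seq I) (P : pred I) (F : I -> series K n) :
  (forall i, P i -> ps_convergent (F i)) ->
  ps_convergent (\sum_(i <- r | P i) F i).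
Proof. by apply: big_ind; [exact: conv0 | exact: convD]. Qed.

(** The first summand determines the second and ranges over the box of exponents at most m, which
    has prod (m_i + 1) elements, and m_i + 1 is at most 2^(m_i). This bounds the number of terms of
    a Cauchy product. *)
Lemma card_mnm_pairs (m : 'X_{1..n}) :
  (#|[pred k : 'X_{1..n < (mdeg m).+1, (mdeg m).+1} | m == (k.1 + k.2)%MM]|
     <= 2 ^ mdeg m)%N.
Proof.
set A := [pred k | _].
pose D (i : 'I_n) := [pred j : 'I_(mdeg m).+1 | (j <= m i)%N].
pose f (k : 'X_{1..n < (mdeg m).+1, (mdeg m).+1}) : {ffun 'I_n -> 'I_(mdeg m).+1} :=
  [ffun i => inord (k.1 i)].
have lt_m i : (m i < (mdeg m).+1)%N.
  by rewrite ltnS mdegE (bigD1 i) //= leq_addr.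
have kA k i : k \in A -> (k.1 i <= m i)%N.
  by rewrite inE => /eqP/mnmP/(_ i) ->; rewrite mnmDE leq_addr.
have fv k i : k \in A -> f k i = k.1 i :> nat.
  by move=> kin; rewrite ffunE inordK // (leq_ltn_trans (kA _ i kin)).
have inj : {in A &, injective f}.
  move=> k k' kin kin' /ffunP eqf.
  have e1 : k.1 = k'.1 :> 'X_{1..n}.
    by apply/mnmP => i; rewrite -(fv k) // -(fv k') // eqf.
  have e2 : k.2 = k'.2 :> 'X_{1..n}.
    apply/mnmP => i; move: (kin) (kin'); rewrite !inE => /eqP/mnmP/(_ i) + /eqP.
    by move=> + /mnmP/(_ i); rewrite !mnmDE e1 => -> /addnI.
  case: k k' e1 e2 {eqf kin kin'} => [k1 k2] [k1' k2'] /= e1 e2.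
  by congr (_, _); apply: val_inj.
rewrite -(card_in_image inj); apply: (@leq_trans #|family D|).
  apply/subset_leq_card/subsetP => _ /imageP [k kin ->].
  by apply/familyP => i; rewrite inE fv // kA.
rewrite card_family foldrE big_map [X in (_ <= _ ^ X)%N]mdegE expn_sum big_enum /=.
apply: leq_prod => i _; rewrite -sum1_card.
rewrite (eq_bigl (fun j : 'I_(mdeg m).+1 => (j < (m i).+1)%N)); last first.
  by move=> j; rewrite ltnS.
rewrite (big_ord_narrow (lt_m i)) /= sum1_card card_ord.
by rewrite ltn_expl.
Qed.

Lemma convM a b : ps_convergent a -> ps_convergent b -> ps_convergent (a * b).
Proof.
move=> [M [r [M0 r0 Ha]]] [M' [r' [M0' r0' Hb]]].
(* [r + r'] dominates both radii, and the factor 2 absorbs the at most 2^|m| terms of the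
   product. *)
exists (M * M'), (2%:R * (r + r')).
have rr0 : 0 <= r + r' by rewrite addr_ge0.
split; rewrite ?mulr_ge0 ?ler0n // => m.
rewrite serME /ps_mul (le_trans (ler_norm_sum _ _ _)) //.
pose C := M * M' * (r + r') ^+ mdeg m.
have C0 : 0 <= C by rewrite mulr_ge0 ?exprn_ge0 ?mulr_ge0.
apply: (@le_trans _ _ (\sum_(k : 'X_{1..n < (mdeg m).+1, (mdeg m).+1} |
    m == (k.1 + k.2)%MM) C)).
  apply: ler_sum => k /eqP em.
  have dm : mdeg m = (mdeg k.1 + mdeg k.2)%N by rewrite -mdegD; congr mdeg.
  rewrite normrM /C [X in _ <= _ * _ ^+ X]dm exprD mulrACA.
  have Ha' := @conv_widen a M r (r + r') M0 r0 _ Ha.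
  have Hb' := @conv_widen b M' r' (r + r') M0' r0' _ Hb.
  by rewrite ler_pM ?Ha' ?Hb' ?lerDl ?lerDr.
rewrite big_const iter_addr_0 -[leLHS]mulr_natr exprMn mulrCA mulrC.
rewrite -natrX ler_wpM2r // ler_nat.
exact: card_mnm_pairs.
Qed.

Lemma conv_mpoly p : ps_convergent (of_mpoly p).
Proof.
have B0 : 0 <= \sum_(m <- msupp p) `|p@_m| by apply: sumr_ge0.
exists (\sum_(m <- msupp p) `|p@_m|), 1; split=> // m.
rewrite expr1n mulr1 /of_mpoly.
case: (boolP (m \in msupp p)) => [mp|/memN_msupp_eq0 ->]; last by rewrite normr0.
by rewrite (big_rem m) //= lerDl sumr_ge0.
Qed.

Lemma conv_cst x : ps_convergent (cst x : series K n).
Proof. exact: conv_mpoly. Qed.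

Lemma convN a : ps_convergent a -> ps_convergent (- a).
Proof.
by move=> ca; rewrite -mulN1r -cst1 -cstN; apply: convM => //; apply: conv_cst.
Qed.

Lemma convB a b : ps_convergent a -> ps_convergent b -> ps_convergent (a - b).
Proof. by move=> ca cb; apply: convD => //; apply: convN. Qed.

(* The coefficients of 1 / (1 - e_1 z_1 - ... - e_n z_n). *)
Definition geo e : series K n := fun m =>
  (mdeg m)`!%:R / (\prod_i (m i)`!)%:R * \prod_i e i ^+ m i.

(** With L = e_1 z_1 + ... + e_n z_n, the part of [geo e] of degree d is L^d; this is the derivative
    of L^(d+1) along z_i. *)
Lemma sderiv_geoE e i m :
  geo e (m + U_(i))%MM *+ (m i).+1 = e i * geo e m *+ (mdeg m).+1.
Proof.
rewrite /geo mdegD mdeg1 addn1 factS.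
have -> : (\prod_j ((m + U_(i))%MM j)`! = (m i).+1 * \prod_j (m j)`!)%N.
  rewrite (bigD1 i) //= [in RHS](bigD1 i) //= mnmDE mnm1E eqxx addn1 factS mulnA.
  congr (_ * _)%N; apply: eq_bigr => j ji.
  by rewrite mnmDE mnm1E eq_sym (negbTE ji) addn0.
have -> : \prod_j e j ^+ (m + U_(i))%MM j = e i * \prod_j e j ^+ m j.
  rewrite (bigD1 i) //= [in RHS](bigD1 i) //= mnmDE mnm1E eqxx addn1 exprS mulrA.
  congr (_ * _); apply: eq_bigr => j ji.
  by rewrite mnmDE mnm1E eq_sym (negbTE ji) addn0.
have nz : (\prod_j (m j)`!)%:R != 0 :> K.
  by rewrite pnatr_eq0 -lt0n prodn_gt0 // => j; rewrite fact_gt0.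
have nz2 : (m i).+1%:R != 0 :> K by rewrite pnatr_eq0.
rewrite !natrM -[LHS]mulr_natr -[RHS]mulr_natr.
by field; rewrite nz /= addrC natr1 nz2.
Qed.

Lemma geo0 e : geo e 0%MM = 1.
Proof.
rewrite /geo mdeg0 fact0 !big1 ?mulr1 ?divr1 // => i _; rewrite mnm0E //.
Qed.

(** Coefficients of geo = 1 + L geo away from degree 0. After multiplication by |m| the i-th term
    becomes m_i times the left side, and the m_i add up to |m|. *)
Lemma geo_rec e m : m != 0%MM ->
  geo e m = \sum_(i | (0 < m i)%N) e i * geo e (m - U_(i))%MM.
Proof.
move=> m0; have d0 : (mdeg m)%:R != 0 :> K by rewrite pnatr_eq0 mdeg_eq0.
apply: (mulIf d0); rewrite mulr_suml.
rewrite (eq_bigr (fun i => geo e m *+ m i)).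
  rewrite sumrMnr mulr_natr mdegE (bigID (fun i => (0 < m i)%N)) /=.
  rewrite [X in (_ + X)%N]big1 ?addn0 // => i; rewrite lt0n negbK.
  by move/eqP.
move=> i mi; have em : m = (m - U_(i) + U_(i))%MM.
  by rewrite submK //; apply/mnm_lepP => j; rewrite mnm1E; case: eqP => // <-.
rewrite mulr_natr {2 3}em mdegD mdeg1 addn1 -sderiv_geoE -em.
by rewrite mnmBE mnm1E eqxx subn1 prednK.
Qed.

Lemma conv_geo e : ps_convergent (geo e).
Proof.
pose B := \sum_i `|e i|; have B0 : 0 <= B by apply: sumr_ge0.
exists 1, B; split=> // m; rewrite mul1r.
have [d] := ubnP (mdeg m); elim: d => // d IH in m *; rewrite ltnS => le_md.
have [->|m0] := eqVneq m 0%MM; first by rewrite mdeg0 expr0 geo0 normr1.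
have d0 : (0 < mdeg m)%N by rewrite lt0n mdeg_eq0.
rewrite geo_rec // (le_trans (ler_norm_sum _ _ _)) //.
apply: (@le_trans _ _ (\sum_(i | (0 < m i)%N) `|e i| * B ^+ (mdeg m).-1)).
  apply: ler_sum => i mi; have em : m = (m - U_(i) + U_(i))%MM.
    by rewrite submK //; apply/mnm_lepP => j; rewrite mnm1E; case: eqP => // <-.
  rewrite normrM ler_wpM2l // {2}em mdegD mdeg1 addn1 /=; apply: IH.
  by move: le_md; rewrite {1}em mdegD mdeg1 addn1.
rewrite -mulr_suml -[in leRHS](prednK d0) exprS ler_wpM2r ?exprn_ge0 //.
by rewrite /B [leRHS](bigID (fun i => (0 < m i)%N)) /= lerDl sumr_ge0.
Qed.

(** The series of log(1 - e_1 z_1 - ... - e_n z_n), that is, minus the sum of the L^d / d. *)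
Definition loggeo e : series K n := fun m =>
  if m == 0%MM then 0 else - geo e m / (mdeg m)%:R.

Lemma conv_loggeo e : ps_convergent (loggeo e).
Proof.
have [M [r [M0 r0 H]]] := conv_geo e; exists M, r; split=> // m.
rewrite /loggeo; case: eqP => [_|/eqP m0].
  by rewrite normr0 mulr_ge0 ?exprn_ge0.
rewrite (le_trans _ (H m)) // normrM normrN normfV normr_nat.
rewrite ler_piMr // invf_le1 ?ltr0n ?lt0n ?mdeg_eq0 //.
by rewrite ler1n lt0n mdeg_eq0.
Qed.

Lemma sderiv_loggeo e i : sderiv i (loggeo e) = - (cst (e i) * geo e).
Proof.
apply: serP => m; rewrite serNE cstME sderivE /loggeo.
rewrite mnmD_eq0 mnm1_eq0 andbF mulNr mulNrn -mulrnAl sderiv_geoE mdegD mdeg1 addn1.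
by rewrite -[_ *+ _]mulr_natr mulfK ?pnatr_eq0.
Qed.

Lemma serXM i a m :
  (of_mpoly 'X_i * a) m = if (0 < m i)%N then a (m - U_(i))%MM else 0.
Proof.
case: ifP => mi.
  have em : m = (m - U_(i) + U_(i))%MM.
    by rewrite submK //; apply/mnm_lepP => j; rewrite mnm1E; case: eqP => // <-.
  rewrite serME (@ps_mul_trunc _ _ (mdeg m).+1 _ _ 'X_i (trunc_ser (mdeg m).+1 a)) //;
    last by move=> ? ?; rewrite coef_trunc_ser.
  rewrite mulrC; have := mcoeffMX (trunc_ser (mdeg m).+1 a) U_(i) (m - U_(i))%MM.
  rewrite addmC -em => ->; rewrite coef_trunc_ser //.
  by rewrite (leq_ltn_trans (mdegB _ _)).
rewrite serME /ps_mul big1 // => k /eqP em.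
rewrite /of_mpoly mcoeffX; case: eqP => [ek|_]; last by rewrite mul0r.
by move/mnmP/(_ i): em; rewrite mnmDE -ek mnm1E eqxx => em; rewrite em in mi.
Qed.

Lemma mpoly_affine h : (msize h <= 2)%N ->
  h = (h@_0%MM)%:MP + \sum_i h@_U_(i) *: 'X_i.
Proof.
move=> sz; apply/mpolyP => m; rewrite mcoeffD mcoeffC raddf_sum /=.
under eq_bigr => i _ do rewrite mcoeffZ mcoeffX.
have [->|m0] := eqVneq m 0%MM.
  by rewrite mulr1 big1 ?addr0 // => i _; rewrite mnm1_eq0 mulr0.
rewrite mulr0 add0r; have [m1|m1] := eqVneq (mdeg m) 1%N.
  case/eqP/mdeg1P: m1 => i /eqP ->; rewrite (bigD1 i) //= eqxx mulr1 big1 ?addr0 //.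
  by move=> j /negbTE ji; rewrite eq_mnm1 ji mulr0.
rewrite big1; last first.
  by move=> i _; case: eqP => [E|]; rewrite ?mulr0 //; rewrite -E mdeg1 eqxx in m1.
apply/memN_msupp_eq0/msize_mdeg_ge/(leq_trans sz).
by move: m0 m1; rewrite -mdeg_eq0; case: (mdeg m) => // -[].
Qed.

(** For h affine, h = h(0) (1 - sum slope_i z_i). Hence [log_aff h] is log(h / h(0)): this branch
    vanishes at 0, is zero for constants and does not see the sign of h. [inv_aff h] is 1 / h. *)
Definition slope h : 'I_n -> K := fun i => - h@_U_(i) / h@_0%MM.

Definition log_aff h : series K n := loggeo (slope h).
Definition inv_aff h : series K n := cst (h@_0%MM)^-1 * geo (slope h).

Lemma conv_log_aff h : ps_convergent (log_aff h).
Proof. exact: conv_loggeo. Qed.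

Lemma conv_inv_aff h : ps_convergent (inv_aff h).
Proof. by apply: convM; [apply: conv_cst | apply: conv_geo]. Qed.

Lemma log_aff0 h : log_aff h 0%MM = 0.
Proof. by rewrite /log_aff /loggeo eqxx. Qed.

Lemma mulV_aff h : (msize h <= 2)%N -> h@_0%MM != 0 ->
  of_mpoly h * inv_aff h = 1.
Proof.
move=> sz h0; have -> : of_mpoly h =
    cst (h@_0%MM) * (1 - \sum_i cst (slope h i) * of_mpoly 'X_i).
  rewrite mulrBr mulr1 mulr_sumr {1}(mpoly_affine sz) of_mpolyD; congr (_ + _).
  rewrite -sumrN; apply: serP => m; rewrite ser_sumE /of_mpoly raddf_sum /=.
  apply: eq_bigr => i _; rewrite serNE !cstME mcoeffZ /slope.
  by field.
rewrite /inv_aff mulrACA -cstM mulfV // cst1 mul1r.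
rewrite mulrBl mul1r mulr_suml.
apply: serP => m; rewrite serBE ser_sumE.
rewrite (eq_bigr (fun i => if (0 < m i)%N
                           then slope h i * geo (slope h) (m - U_(i))%MM else 0)).
  rewrite -big_mkcond /= ser1E /of_mpoly mcoeff1.
  have [->|m0] := eqVneq m 0%MM; last by rewrite [in X in X - _]geo_rec // subrr.
  by rewrite geo0 big1 ?subr0 // => i; rewrite mnm0E.
by move=> i _; rewrite -mulrA cstME serXM; case: ifP; rewrite ?mulr0.
Qed.

Lemma sderiv_log_aff h i : (msize h <= 2)%N -> h@_0%MM != 0 ->
  sderiv i (log_aff h) = cst (h@_U_(i)) * inv_aff h.
Proof.
move=> sz h0; rewrite sderiv_loggeo /inv_aff /slope mulNr cstN mulNr opprK.
by rewrite cstM mulrA.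
Qed.

Lemma mderiv_affine h i : (msize h <= 2)%N -> h^`M(i) = (h@_U_(i))%:MP.
Proof.
move=> sz; apply/mpolyP => m; rewrite mcoeff_deriv mcoeffC.
have [->|m0] := eqVneq m 0%MM; first by rewrite add0m mnm0E mulr1.
rewrite mulr0 memN_msupp_eq0 ?mul0rn //; apply/msize_mdeg_ge/(leq_trans sz).
by rewrite mdegD mdeg1 addn1 ltnS lt0n mdeg_eq0.
Qed.

Lemma mul_dlog_aff h i : (msize h <= 2)%N -> h@_0%MM != 0 ->
  of_mpoly h * sderiv i (log_aff h) = sderiv i (of_mpoly h).
Proof.
move=> sz h0; rewrite sderiv_log_aff // mulrCA mulV_aff // mulr1.
by rewrite sderiv_mpoly mderiv_affine.
Qed.

End Convergence.

(** * The points of P^1 and the hyperplanes of A_{0,n+3} *)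

(* The index i < n stands for x_{i+1}, then come x_0, 0 and infinity: with
   homogeneous coordinates (cx i : cy i), the hyperplanes are the 2 x 2 minors
   of pairs of finite points. *)
Section Points.
Variable n : nat.

Definition ptv (i : 'I_n) : 'I_n.+3 := widen_ord (leq_addl 3 n) i.
Definition pt1 : 'I_n.+3 := Ordinal (leq_addl 2 n.+1).
Definition pt0 : 'I_n.+3 := Ordinal (leq_addl 1 n.+2).
Definition ptoo : 'I_n.+3 := ord_max.

Variant pt_spec : 'I_n.+3 -> Type :=
  | PtV i : pt_spec (ptv i)
  | Pt1 : pt_spec pt1
  | Pt0 : pt_spec pt0
  | Ptoo : pt_spec ptoo.

Lemma ptP j : pt_spec j.
Proof.
case: (ltnP j n) => [lt|ge].
  have -> : j = ptv (Ordinal lt) by apply: val_inj.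
  exact: PtV.
have [e|/eqP ne] := eqVneq (j : nat) n.
  have -> : j = pt1 by apply: val_inj.
  exact: Pt1.
have [e|/eqP ne1] := eqVneq (j : nat) n.+1.
  have -> : j = pt0 by apply: val_inj.
  exact: Pt0.
have -> : j = ptoo by apply: val_inj => /=; have := ltn_ord j; lia.
exact: Ptoo.
Qed.

Section Case.
Variables (T : Type) (f : 'I_n -> T) (t1 t0 too : T).

Definition ptcase (j : 'I_n.+3) : T :=
  match ptP j with PtV i => f i | Pt1 => t1 | Pt0 => t0 | Ptoo => too end.

Lemma ptcase_v i : ptcase (ptv i) = f i.
Proof.
rewrite /ptcase; move E : (ptv i) => j; case: (ptP j) E => [i'|||] /(congr1 val) /= E.
- by congr f; apply: val_inj.
- by have := ltn_ord i; rewrite E ltnn.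
- by have := ltn_ord i; rewrite E; lia.
- by have := ltn_ord i; rewrite E; lia.
Qed.
Lemma ptcase_1 : ptcase pt1 = t1.
Proof.
rewrite /ptcase; move E : pt1 => j.
by case: (ptP j) E => [i'|||] /(congr1 val) /= E //; first have := ltn_ord i';
  move: E; lia.
Qed.
Lemma ptcase_0 : ptcase pt0 = t0.
Proof.
rewrite /ptcase; move E : pt0 => j.
by case: (ptP j) E => [i'|||] /(congr1 val) /= E //; first have := ltn_ord i';
  move: E; lia.
Qed.
Lemma ptcase_oo : ptcase ptoo = too.
Proof.
rewrite /ptcase; move E : ptoo => j.
by case: (ptP j) E => [i'|||] /(congr1 val) /= E //; first have := ltn_ord i';
  move: E; lia.
Qed.
Definition ptcaseE := (ptcase_v, ptcase_1, ptcase_0, ptcase_oo).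
End Case.

(** The two marked points that collide on the hyperplane. Scaling the finite points by x_0 turns
    them into x_1, ..., x_n, x_0, 0, so the coordinate hyperplanes, x_0 = 0 included, are the
    collisions with the point 0. *)
Definition pair_of (k : A0_index n) : 'I_n.+3 * 'I_n.+3 :=
  match k with
  | inl (inl i) => (oapp ptv pt1 (unlift ord0 i), pt0)
  | inl (inr i) => (ptv i, pt1)
  | inr ij => (ptv (val ij).1, ptv (val ij).2)
  end.

Lemma pair_of_lt k : ((pair_of k).1 < (pair_of k).2)%N.
Proof.
have lt (i : 'I_n) := ltn_ord i.
case: k => [[i|i]|[[i j] /= ij]] //=.
by case: unliftP => [j|] _ //=; have := lt j; lia.
Qed.

Lemma pair_of_fin k : ((pair_of k).2 < n.+2)%N.
Proof.
by case: k => [[i|i]|[[i j] /= ij]] //=; have := ltn_ord j; lia.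
Qed.

Lemma pair_of_inj : injective pair_of.
Proof.
have V (i j : 'I_n) : ptv i = ptv j -> i = j by move/(congr1 val) => /= /val_inj.
have lt (i : 'I_n) := ltn_ord i.
case=> [[i|i]|[[i j] /= ij]] [[i'|i']|[[i' j'] /= ij']] //=.
- case: (unliftP ord0 i) => [j|] ->; case: (unliftP ord0 i') => [j'|] -> //= [].
  + by move/val_inj ->.
  + by move=> E; have := lt j; rewrite E ltnn.
  + by move=> E; have := lt j'; rewrite -E ltnn.
- by case=> _ /= E; move: E; lia.
- by case=> _ /= E; have := lt j'; rewrite -E; lia.
- by case=> _ /= E; move: E; lia.
- by case=> /val_inj ->.
- by case=> _ /= E; have := lt j'; rewrite -E; lia.
- by case=> _ /= E; have := lt j; rewrite E; lia.
- by case=> _ /= E; have := lt j; rewrite E; lia.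
- by case=> /val_inj E1 /val_inj E2; congr inr; apply: val_inj; rewrite /= E1 E2.
Qed.

Lemma pair_of_onto (i j : 'I_n.+3) : (i < j)%N -> (j < n.+2)%N ->
  exists k, pair_of k = (i, j).
Proof.
case: (ptP j) => [j'|||] /=; last by rewrite ltnn.
- case: (ptP i) => [i'|||] /= ij _; last 1 first.
  + by have := ltn_ord j'; lia.
  + by exists (inr (Sub (i', j') ij)).
  + by have := ltn_ord j'; lia.
  + by have := ltn_ord j'; lia.
- case: (ptP i) => [i'|||] /= ij _; try by move: ij; lia.
  by exists (inl (inr i')).
- case: (ptP i) => [i'|||] /= ij _; try by move: ij; lia.
    by exists (inl (inl (lift ord0 i'))); rewrite /= liftK.
  by exists (inl (inl ord0)); rewrite /= unlift_none.
Qed.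

Lemma pt_eqE : ((forall i j : 'I_n, (ptv i == ptv j) = (i == j)) *
  ((forall i : 'I_n, (ptv i == pt1) = false) * (forall i : 'I_n, (ptv i == pt0) = false) *
  (forall i : 'I_n, (ptv i == ptoo) = false) * (forall i : 'I_n, (pt1 == ptv i) = false) *
  (forall i : 'I_n, (pt0 == ptv i) = false) * (forall i : 'I_n, (ptoo == ptv i) = false)) *
  ((pt1 == pt0) = false) * ((pt1 == ptoo) = false) * ((pt0 == pt1) = false) *
  ((pt0 == ptoo) = false) * ((ptoo == pt1) = false) * ((ptoo == pt0) = false))%type.
Proof.
have lt (i : 'I_n) := ltn_ord i.
do ! split; try (move=> i); try (move=> j); rewrite -val_eqE //=;
  try (have := lt i); lia.
Qed.

End Points.

Arguments pt0 {n}.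
Arguments pt1 {n}.
Arguments ptoo {n}.

Definition minor (T : nzRingType) (I : Type) (x y : I -> T) (i j : I) : T :=
  x i * y j - x j * y i.

Lemma mderivXU (K : nzRingType) n (i j : 'I_n) :
  ('X_j : {mpoly K[n]})^`M(i) = (i == j)%:R%:MP.
Proof.
rewrite mderivX mnm1E eq_sym; case: eqP => [->|_]; last by rewrite scale0r mpolyC0.
have -> : (U_(j) - U_(j) = 0)%MM by apply/mnmP => l; rewrite mnmBE subnn mnm0E.
by rewrite scale1r mpolyX0 mpolyC1.
Qed.

Section Cone.
Variables (K : comNzRingType) (n : nat).

Definition cx : 'I_n.+3 -> {mpoly K[n.+1]} :=
  ptcase (fun i => 'X_(lift ord0 i)) 'X_ord0 0 1.
Definition cy : 'I_n.+3 -> {mpoly K[n.+1]} := ptcase (fun=> 1) 1 1 0.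

Lemma A0E k : A0 K k = minor cx cy (pair_of k).1 (pair_of k).2.
Proof.
rewrite /minor /cx /cy; case: k => [[i|i]|[[i j] /= ij]] /=.
- by case: unliftP => [j|] ->; rewrite /= !ptcaseE mul0r subr0 mulr1.
- by rewrite !ptcaseE !mulr1.
- by rewrite !ptcaseE !mulr1.
Qed.

End Cone.

(** * Isotropic pairs of logarithmic forms *)

Section Weights.
Variables (K : fieldType) (n : nat).
Local Notation W := {ffun A0_index n -> K^o}.
Implicit Types (a b : W) (i j : 'I_n.+3).

Definition hits (k : A0_index n) i j : bool :=
  (pair_of k == (i, j)) || (pair_of k == (j, i)).

Lemma hitsC k i j : hits k i j = hits k j i.
Proof. by rewrite /hits orbC. Qed.

Lemma hits_diag k i : hits k i i = false.
Proof.
by rewrite /hits orbb; apply/eqP => E; have := pair_of_lt k; rewrite E ltnn.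
Qed.

Lemma hits_oo k i : hits k i ptoo = false.
Proof.
apply/negP => /orP[]/eqP E; have := pair_of_fin k; have := pair_of_lt k;
  by rewrite E /=; lia.
Qed.

Lemma hitsE k k' : hits k (pair_of k').1 (pair_of k').2 = (k == k').
Proof.
rewrite /hits -surjective_pairing (inj_eq (@pair_of_inj n)).
case: (k == k') => //=; apply/eqP => E.
by have := pair_of_lt k; have := pair_of_lt k'; rewrite E /=; lia.
Qed.

Lemma hits_ex i j : i != j -> (i < n.+2)%N -> (j < n.+2)%N ->
  exists k, forall k', hits k' i j = (k' == k).
Proof.
move=> ij ilt jlt; have [lt|lt|/val_inj E] := ltngtP i j; last by rewrite E eqxx in ij.
  by have [k ek] := pair_of_onto lt jlt; exists k => k'; rewrite -hitsE ek.
by have [k ek] := pair_of_onto lt ilt; exists k => k'; rewrite -hitsE ek hitsC.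
Qed.

(** The weight matrix on the finite points only: entries at infinity are 0 here, and get their true
    value in [ewt]. *)
Definition wt a i j : K := \sum_k a k * (hits k i j)%:R.

Lemma wtC a i j : wt a i j = wt a j i.
Proof. by apply: eq_bigr => k _; rewrite hitsC. Qed.
Lemma wt_diag a i : wt a i i = 0.
Proof. by apply: big1 => k _; rewrite hits_diag mulr0. Qed.
Lemma wt_oo a i : wt a i ptoo = 0.
Proof. by apply: big1 => k _; rewrite hits_oo mulr0. Qed.

Lemma wt_pair a k : wt a (pair_of k).1 (pair_of k).2 = a k.
Proof.
rewrite /wt (bigD1 k) //= hitsE eqxx mulr1 big1 ?addr0 // => k' ne.
by rewrite hitsE (negbTE ne) mulr0.
Qed.

Lemma sum_wt a : \sum_i \sum_j wt a i j = (\sum_k a k) *+ 2.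
Proof.
transitivity (\sum_k a k * \sum_i \sum_j (hits k i j)%:R).
  rewrite exchange_big /=.
  under eq_bigr => i _ do under eq_bigr => j _ do rewrite /wt.
  under eq_bigr => i _ do rewrite exchange_big /=.
  rewrite exchange_big /=; apply: eq_bigr => k _.
  rewrite mulr_sumr exchange_big /=.
  by rewrite exchange_big /=; apply: eq_bigr => i _; rewrite mulr_sumr;
    apply: eq_bigr => j _; rewrite hitsC.
rewrite -sumrMnl; apply: eq_bigr => k _; rewrite -[RHS]mulr_natr; congr (_ * _).
rewrite pair_big /=.
have lt := pair_of_lt k; case E : (pair_of k) lt => [p q] /= lt.
have pq : (p, q) != (q, p) by apply: contraTneq lt => -[-> _]; rewrite ltnn.
rewrite (bigD1 (p, q)) //= (bigD1 (q, p)) /=; last by rewrite eq_sym.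
rewrite big1 ?addr0.
  by rewrite /hits E eqxx orbT -natrD.
move=> [i j] /andP[/= n1 n2]; rewrite /hits E.
rewrite eq_sym (negbTE n1) /=; case: ((p, q) =P (j, i)) n2 => // -[-> ->].
by rewrite eqxx.
Qed.

Lemma wt_is_linear i j (c : K) a b :
  wt (c *: a + b) i j = c * wt a i j + wt b i j.
Proof.
rewrite /wt mulr_sumr -big_split; apply: eq_bigr => k _ /=.
by rewrite !ffunE mulrDl mulrA.
Qed.

End Weights.

Section SumZero.
Variables (K : fieldType) (J : finType).

Lemma H1_sum0 (a : {ffun J -> K^o}) : a \in H1 K J -> \sum_k a k = 0.
Proof.
have gen (s : seq {ffun J -> K^o}) : (forall u : {ffun J -> K^o}, u \in s -> \sum_k u k = 0) ->
    a \in <<s>>%VS -> \sum_k a k = 0.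
  move=> s0 /(@coord_span _ _ _ (in_tuple s)) ->.
  under eq_bigr => k _ do rewrite sum_ffunE.
  rewrite exchange_big big1 //= => l _.
  under eq_bigr => k _ do rewrite ffunE.
  by rewrite -scaler_sumr s0 ?scaler0 // mem_nth.
apply: gen => u /allpairsP [[i j] /= [_ _ ->]].
under eq_bigr => k _ do rewrite ffunE.
rewrite sumrB (bigD1 i) //= eqxx big1 => [|k /negbTE -> //].
by rewrite (bigD1 j) //= eqxx big1 ?addr0 ?subrr // => k /negbTE ->.
Qed.

Lemma mem_H1 (a : {ffun J -> K^o}) : \sum_k a k = 0 -> a \in H1 K J.
Proof.
move=> s0; case: (pickP (fun _ : J => true)) => [k0 _|J0]; last first.
  by have -> : a = 0; [apply/ffunP => k; have := J0 k | exact: mem0v].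
have -> : a = \sum_k a k *: [ffun l => (l == k)%:R - (l == k0)%:R : K^o].
  apply/ffunP => l; rewrite sum_ffunE.
  under eq_bigr => k _ do rewrite !ffunE scalerBr.
  rewrite sumrB -scaler_suml s0 scale0r subr0 (bigD1 l) //= eqxx big1 ?addr0.
    by rewrite [_ *: _]mulr1.
  by move=> k /negbTE ne; rewrite eq_sym ne scaler0.
apply: memv_suml => k _; apply/memvZ/memv_span/allpairsP.
by exists (k, k0); rewrite !mem_enum.
Qed.

End SumZero.

Section LogForm.
Variables (K : numFieldType) (n : nat).
Local Notation W := {ffun A0_index n -> K^o}.
Implicit Types (a b : W) (i j : 'I_n.+3) (X : 'I_n.+3 -> K).

(** The coordinate of the cone that moves the point i. The values at [pt0] and [ptoo] are fillers,
    which [movable] excludes. *)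
Definition cone_var : 'I_n.+3 -> 'I_n.+1 :=
  ptcase (fun i : 'I_n => lift ord0 i) ord0 ord0 ord0.
Definition movable i := (i < n.+1)%N.

(** Configurations are taken up to translation: subtracting [X pt0] puts the point 0 back in place,
    so that in X all finite points play the same role. *)
Definition cone_pt X : 'I_n.+1 -> K :=
  fun m => X (oapp (@ptv n) pt1 (unlift ord0 m)) - X pt0.

Lemma eval_cxB X i : (i < n.+2)%N -> (cx K i).@[cone_pt X] = X i - X pt0.
Proof.
rewrite /cx /cone_pt; case: (ptP i) => [i'|||] /=; rewrite ?ptcaseE ?ltnn //.
- by rewrite mevalXU liftK.
- by rewrite mevalXU unlift_none.
- by rewrite meval0 subrr.
Qed.

Lemma cy_fin i : (i < n.+2)%N -> cy K i = 1.
Proof. by rewrite /cy; case: (ptP i) => [i'|||] /=; rewrite ?ptcaseE ?ltnn. Qed.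

Lemma eval_A0 X k :
  (A0 K k).@[cone_pt X] = X (pair_of k).1 - X (pair_of k).2.
Proof.
have f2 := pair_of_fin k; have f1 := ltn_trans (pair_of_lt k) f2.
rewrite A0E /minor !cy_fin // !mulr1 mevalB !eval_cxB //.
by rewrite opprB addrA subrK.
Qed.

Lemma mderiv_cx i j : movable i -> (j < n.+2)%N ->
  (cx K j)^`M(cone_var i) = (i == j)%:R%:MP.
Proof.
rewrite /cx /movable /cone_var; case: (ptP i) => [i'|||] /=; rewrite ?ptcaseE ?ltnn //;
  last by move=> ?; lia.
  move=> _; case: (ptP j) => [j'|||] /=; rewrite ?ptcaseE ?ltnn ?pt_eqE // => _.
  - by rewrite mderivXU (inj_eq (@lift_inj _ _)).
  - by rewrite mderivXU -val_eqE.
  - by rewrite mderiv0 mpolyC0.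
move=> _; case: (ptP j) => [j'|||] /=; rewrite ?ptcaseE ?ltnn ?pt_eqE // => _.
- by rewrite mderivXU -val_eqE.
- by rewrite mderivXU !eqxx.
- by rewrite mderiv0 mpolyC0.
Qed.

Lemma log_form_cone X a i : {in [pred j : 'I_n.+3 | (j < n.+2)%N] &, injective X} ->
  movable i ->
  log_form (A0 K (n := n)) a (cone_pt X) (cone_var i) = \sum_j wt a i j / (X i - X j).
Proof.
move=> inj mi; rewrite /log_form.
under [RHS]eq_bigr => j _ do rewrite /wt mulr_suml.
rewrite [RHS]exchange_big /=; apply: eq_bigr => k _.
under [RHS]eq_bigr => j _ do rewrite -mulrA.
rewrite -mulr_sumr; congr (_ * _).
rewrite /dlog eval_A0 A0E /minor.
have f2 := pair_of_fin k; have f1 := ltn_trans (pair_of_lt k) f2.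
have lt := pair_of_lt k; rewrite !cy_fin // !mulr1 mderivB !mderiv_cx //.
rewrite mevalB !mevalC /hits; case: (pair_of k) f1 f2 lt => p q /= f1 f2 lt.
have pq : p != q by apply: contraTneq lt => ->; rewrite ltnn.
have nz : X p - X q != 0.
  by rewrite subr_eq0; apply: contra_neq pq => /inj ->.
have [ip|ip] := eqVneq i p.
  subst i; rewrite (negbTE pq) subr0 (bigD1 q) //= eqxx /= big1 ?addr0 // => j jq.
  rewrite -[(p, q) == _]/((p == p) && (q == j)) eqxx (eq_sym q) (negbTE jq) /=.
  rewrite -[(p, q) == _]/((p == j) && (q == p)) (eq_sym q) (negbTE pq) andbF.
  by rewrite mul0r.
have [iq|iq] := eqVneq i q.
  subst i; rewrite (bigD1 p) //= eqxx orbT /= big1 ?addr0 ?sub0r ?mulN1r ?mul1r.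
    by rewrite -invrN opprB.
  move=> j jp.
  rewrite -[(p, q) == _]/((p == q) && (q == j)) (negbTE pq) /=.
  rewrite -[(p, q) == _]/((p == j) && (q == q)) (eq_sym p) (negbTE jp) /=.
  by rewrite mul0r.
rewrite subrr mul0r big1 // => j _.
rewrite -[(p, q) == (i, j)]/((p == i) && (q == j)) (eq_sym p) (negbTE ip) /=.
rewrite -[(p, q) == _]/((p == j) && (q == i)) (eq_sym q) (negbTE iq) andbF.
by rewrite mul0r.
Qed.

End LogForm.

(** * Limits at t = 0 of rational functions *)

Section Leading.
Variable K : numFieldType.
Implicit Types (f g : K -> K) (p q : {poly K}).

Lemma poly_fun0 p : (forall t, p.[t] = 0) -> p = 0.
Proof.
move=> p0; apply/eqP; apply: contraT => nz.
have := max_poly_roots nz (rs := [seq i%:R | i <- iota 0 (size p)]).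
rewrite size_map size_iota ltnn; apply; first by apply/allP => x _; apply/eqP/p0.
by rewrite map_inj_uniq ?iota_uniq // => i j /eqP; rewrite eqr_nat => /eqP.
Qed.

(** An algebraic substitute for the limit of f at t = 0: off t = 0 and the zeros of q, f is a
    rational function, which is regular at 0 with value v. *)
Definition extends0 f (v : K) : Prop := exists p q, [/\ q.[0] != 0,
  v = p.[0] / q.[0] & forall t, t != 0 -> q.[t] != 0 -> f t = p.[t] / q.[t]].

Lemma extends0_cst c : extends0 (fun=> c) c.
Proof.
exists c%:P, 1; split; rewrite ?hornerE ?oner_eq0 ?divr1 // => t _ _.
by rewrite !hornerE divr1.
Qed.

Lemma extends0D f g u v :
  extends0 f u -> extends0 g v -> extends0 (fun t => f t + g t) (u + v).
Proof.
move=> [p [q [q0 -> Hf]]] [p' [q' [q0' -> Hg]]].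
exists (p * q' + p' * q), (q * q'); split.
- by rewrite !hornerE mulf_neq0.
- by rewrite !hornerE addf_div.
move=> t t0; rewrite !hornerE mulf_eq0 negb_or => /andP[qt qt'].
by rewrite Hf // Hg // addf_div.
Qed.

Lemma extends0M f g u v :
  extends0 f u -> extends0 g v -> extends0 (fun t => f t * g t) (u * v).
Proof.
move=> [p [q [q0 -> Hf]]] [p' [q' [q0' -> Hg]]].
exists (p * p'), (q * q'); split.
- by rewrite !hornerE mulf_neq0.
- by rewrite !hornerM mulf_div.
move=> t t0; rewrite !hornerM mulf_eq0 negb_or => /andP[qt qt'].
by rewrite Hf // Hg // mulf_div.
Qed.

Lemma extends0_sum (I : Type) (r : seq I) (F : I -> K -> K) (v : I -> K) :
  (forall i, extends0 (F i) (v i)) ->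
  extends0 (fun t => \sum_(i <- r) F i t) (\sum_(i <- r) v i).
Proof.
move=> H; elim: r => [|i r IH].
  rewrite big_nil; case: (extends0_cst 0) => p [q [q0 e H0]]; exists p, q.
  by split=> // t t0 qt; rewrite big_nil (H0 t).
rewrite big_cons; case: (extends0D (H i) IH) => p [q [q0 e H0]]; exists p, q.
by split=> // t t0 qt; rewrite big_cons (H0 t).
Qed.

(** Here b + t s is the difference of two moving points: multiplication by t retains in the limit
    only the pairs that collide at t = 0. *)
Lemma extends0_inv (b s : K) : b != 0 \/ s != 0 ->
  extends0 (fun t => t / (b + t * s)) (if b == 0 then s^-1 else 0).
Proof.
have [-> [|s0]|b0 _] := eqVneq b 0; first by [].
  exists 1, s%:P; rewrite !hornerC; split=> // [|t t0 _]; first by rewrite div1r.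
  by rewrite !hornerC add0r invfM mulrA mulfV.
exists 'X, (b%:P + s *: 'X); rewrite hornerD hornerC hornerZ !hornerX mulr0 addr0.
rewrite mul0r; split=> // t t0 _.
by rewrite hornerD hornerC hornerZ !hornerX (mulrC s).
Qed.

Lemma extends0_eq0 f v (r : {poly K}) : extends0 f v -> r != 0 ->
  (forall t, t != 0 -> r.[t] != 0 -> f t = 0) -> v = 0.
Proof.
move=> [p [q [q0 -> H]]] r0 Hf; have q_nz : q != 0.
  by apply: contraNneq q0 => ->; rewrite horner0.
suff -> : p = 0 by rewrite horner0 mul0r.
suff /eqP : p * ('X * (q * r)) = 0.
  by rewrite !mulf_eq0 polyX_eq0 (negbTE q_nz) (negbTE r0) !orbF => /eqP.
apply: poly_fun0 => t; rewrite !hornerM hornerX.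
have [->|t0] := eqVneq t 0; first by rewrite mul0r mulr0.
have [->|rt] := eqVneq r.[t] 0; first by rewrite !mulr0.
have [->|qt] := eqVneq q.[t] 0; first by rewrite mul0r !mulr0.
have /eqP := H t t0 qt; rewrite Hf // eq_sym mulf_eq0 invr_eq0 (negbTE qt) orbF.
by move=> /eqP ->; rewrite mul0r.
Qed.

End Leading.

(** * Residue conditions on two forms with vanishing product *)

Section Isotropic.
Variables (K : numFieldType) (n : nat).
Local Notation W := {ffun A0_index n -> K^o}.
Implicit Types (a b : W) (i j k l : 'I_n.+3).

Definition wedge0 a b : Prop := forall x, in_compl (A0 K (n := n)) x ->
  covec_wedge0 (log_form (A0 K (n := n)) a x) (log_form (A0 K (n := n)) b x).

Lemma in_compl_cone (X : 'I_n.+3 -> K) :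
  {in [pred j : 'I_n.+3 | (j < n.+2)%N] &, injective X} ->
  in_compl (A0 K (n := n)) (cone_pt X).
Proof.
move=> inj k; rewrite eval_A0 subr_eq0; apply/eqP => /inj E.
have lt := pair_of_lt k; have f2 := pair_of_fin k.
by have f1 := ltn_trans lt f2; move: lt; rewrite E ?inE // ltnn.
Qed.

(* The points X j = c j + t * s j move with t; this is the leading coefficient,
   of order t^-2, of one of the coefficients of the 2-form. *)
Definition lead (c : 'I_n.+3 -> 'I_n.+3) (s : 'I_n.+3 -> K) w i :=
  \sum_(j | c i == c j) wt w i j / (s i - s j).

Lemma wedge0_leading a b c s i k : wedge0 a b ->
    (forall j l, j != l -> c j = c l -> s j != s l) ->
    movable i -> movable k ->
  lead c s a i * lead c s b k = lead c s a k * lead c s b i.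
Proof.
move=> ab sep0 mi mk; pose beta j : K := (c j : nat)%:R.
have betaE j l : (beta j == beta l) = (c j == c l) by rewrite eqr_nat val_eqE.
have sep j l : j != l -> beta j != beta l \/ s j != s l.
  by rewrite betaE => jl; have [/(sep0 _ _ jl)|] := eqVneq (c j) (c l); [right|left].
(* For i movable, t times the coefficient of the form along the point i, on the path X; it is
   regular at t = 0, where its value is [lead]. *)
pose F w (i : 'I_n.+3) t :=
  \sum_j wt w i j * (t / ((beta i - beta j) + t * (s i - s j))).
have regF w i0 : (i0 < n.+2)%N -> extends0 (F w i0) (lead c s w i0).
  move=> f0; rewrite /lead big_mkcond /=; apply: extends0_sum => j.
  have [w0|w0] := eqVneq (wt w i0 j) 0.
    have -> : (if c i0 == c j then wt w i0 j / (s i0 - s j) else 0) = 0.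
      by rewrite w0 mul0r if_same.
    case: (@extends0_cst K 0) => p [q [q0 e H]]; exists p, q; split=> // t t0 qt.
    by rewrite w0 mul0r (H t).
  have ij : i0 != j by apply: contraNneq w0 => ->; rewrite wt_diag.
  have fj : (j < n.+2)%N.
    case: (ptP j) w0 => [i'|||] //=; last by rewrite wt_oo eqxx.
      by move=> _; have := ltn_ord i'; lia.
  have -> : (if c i0 == c j then wt w i0 j / (s i0 - s j) else 0) =
     wt w i0 j * (if beta i0 - beta j == 0 then (s i0 - s j)^-1 else 0).
    by rewrite subr_eq0 betaE; case: ifP; rewrite ?mulr0.
  apply: extends0M; first exact: extends0_cst.
  by apply: extends0_inv; rewrite !subr_eq0; apply: sep.
have fm j : movable j -> (j < n.+2)%N by rewrite /movable => /ltnW.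
have := extends0D (extends0M (regF a i (fm _ mi)) (regF b k (fm _ mk)))
  (extends0M (@extends0_cst K (-1)) (extends0M (regF a k (fm _ mk)) (regF b i (fm _ mi)))).
(* The zeros of r are the times at which two finite points meet; at all other times the path lies in
   the complement. *)
pose r : {poly K} := \prod_(jl : 'I_n.+3 * 'I_n.+3 | [&& jl.1 != jl.2,
   (jl.1 < n.+2)%N & (jl.2 < n.+2)%N])
   ((beta jl.1 - beta jl.2)%:P + (s jl.1 - s jl.2) *: 'X).
move=> /(@extends0_eq0 K _ _ r) H; apply/eqP; rewrite -subr_eq0 -mulN1r; apply/eqP.
apply: H => [|t t0 rt].
  apply/prodf_neq0 => -[j l] /= /and3P[jl fj fl].
  apply/eqP => /(congr1 (fun p : {poly K} => (p`_0, p`_1))).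
  rewrite !coefE /= mulr0 mulr1 addr0 add0r => -[/eqP + /eqP].
  by rewrite !subr_eq0; case: (sep _ _ jl) => /negbTE ->.
pose X j := beta j + t * s j.
have inj : {in [pred j : 'I_n.+3 | (j < n.+2)%N] &, injective X}.
  move=> j l; rewrite !inE => fj fl XX; apply/eqP; apply: contraT => jl.
  move: rt; rewrite /r horner_prod => /prodf_neq0/(_ (j, l)).
  rewrite /= jl fj fl => /(_ isT); rewrite hornerD hornerC hornerZ hornerX.
  by rewrite mulrC mulrBr addrACA -opprD -/(X j) -/(X l) XX subrr eqxx.
have FX w i0 : movable i0 ->
    F w i0 t = t * log_form (A0 K (n := n)) w (cone_pt X) (cone_var i0).
  move=> m0; rewrite log_form_cone // mulr_sumr; apply: eq_bigr => j _.
  by rewrite mulrCA mulrBr addrACA -opprD.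
have /= := ab _ (in_compl_cone inj) (cone_var i) (cone_var k).
rewrite !FX // => E; rewrite mulN1r mulrACA E [X in _ - X]mulrACA -[X in X - _]mulrA.
by rewrite [X in X - _]mulrA subrr.
Qed.

(** The determinant of the vectors (wt a, wt b) of K^2 attached to the pairs ij and kl. *)
Definition cross a b i j k l := wt a i j * wt b k l - wt a k l * wt b i j.

Lemma crossC1 a b i j k l : cross a b i j k l = cross a b j i k l.
Proof. by rewrite /cross !(wtC _ i). Qed.
Lemma crossC2 a b i j k l : cross a b i j k l = cross a b i j l k.
Proof. by rewrite /cross !(wtC _ k). Qed.
Lemma lead_two c s w i j : i != j -> c i = c j ->
    (forall m, c i = c m -> m = i \/ m = j) ->
  lead c s w i = wt w i j / (s i - s j).
Proof.
move=> ij bij only; rewrite /lead (bigD1 j) /=; last by rewrite bij.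
rewrite big1 ?addr0 // => m /andP[/eqP /only [->|->]]; last by rewrite eqxx.
by rewrite wt_diag mul0r.
Qed.

Lemma lead_three c s w i j k : uniq [:: i; j; k] -> c i = c j -> c i = c k ->
    (forall m, c i = c m -> [\/ m = i, m = j | m = k]) ->
  lead c s w i = wt w i j / (s i - s j) + wt w i k / (s i - s k).
Proof.
rewrite /= !inE negb_or andbT => /andP[/andP[ij ik] jk] bij bik only.
rewrite /lead (bigD1 j) /=; last by rewrite bij.
rewrite (bigD1 k) /=; last by rewrite bik eqxx eq_sym.
rewrite big1 ?addr0 // => m /andP[/andP[/eqP /only [->|->|->]]].
- by rewrite wt_diag mul0r.
- by rewrite eqxx.
- by rewrite eqxx.
Qed.

Lemma cross_disjoint_movable a b i j k l : wedge0 a b -> uniq [:: i; j; k; l] ->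
  movable i -> movable k -> cross a b i j k l = 0.
Proof.
move=> ab /=; rewrite !inE !negb_or andbT => /and3P[/and3P[ij ik il] /andP[jk jl] kl].
move=> mi mk.
(* At t = 0, j collides with i and l with k, at two distinct places, and every other point stays
   alone. *)
pose c m := if m == j then i else if m == l then k else m.
pose s (m : 'I_n.+3) : K := (m : nat)%:R.
have s_inj p q : p != q -> s p - s q != 0 by rewrite subr_eq0 eqr_nat val_eqE.
have ci : c i = i by rewrite /c (negbTE ij) (negbTE il).
have ck : c k = k by rewrite /c eq_sym (negbTE jk) (negbTE kl).
have cj : c j = i by rewrite /c eqxx.
have cl : c l = k by rewrite /c eq_sym (negbTE jl) eqxx.
have oi m : c i = c m -> m = i \/ m = j.
  rewrite ci /c; case: (m =P j) => [->|_]; first by right.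
  by case: ifP => [_ E|_ ->]; [rewrite E eqxx in ik | left].
have ok m : c k = c m -> m = k \/ m = l.
  rewrite ck /c; case: (m =P j) => [_ E|_]; first by rewrite E eqxx in ik.
  by case: eqP => [->|_ ->]; [right | left].
have cij : c i = c j by rewrite ci cj.
have ckl : c k = c l by rewrite ck cl.
have sep p q : p != q -> c p = c q -> s p != s q.
  by move=> pq _; rewrite -subr_eq0 s_inj.
have := @wedge0_leading a b c s i k ab sep mi mk.
rewrite !(lead_two s _ ij cij oi) !(lead_two s _ kl ckl ok) /cross.
have h1 := s_inj _ _ ij; have h2 := s_inj _ _ kl.
move=> H; apply: (mulIf (invr_neq0 (mulf_neq0 h1 h2))).
rewrite mul0r mulrBl invfM; apply/eqP; rewrite subr_eq0; apply/eqP.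
by rewrite [LHS]mulrACA H [LHS]mulrACA [X in _ * X = _]mulrC.
Qed.

Lemma cross_triple_movable a b i j k : wedge0 a b -> uniq [:: i; j; k] ->
    movable i -> movable j ->
  [/\ cross a b i j j k + cross a b i j i k = 0 &
      cross a b i j j k + cross a b i k j k = 0].
Proof.
move=> ab u mi mj; have u' : uniq [:: j; i; k].
  by move: u; rewrite /= !inE !negb_or eq_sym andbT => /andP[/andP[-> ->] ->].
move: (u); rewrite /= !inE negb_or andbT => /andP[/andP[ij ik] jk].
pose c m := if (m == j) || (m == k) then i else m.
have ci : c i = i by rewrite /c (negbTE ij) (negbTE ik).
have cj : c j = i by rewrite /c eqxx.
have ck : c k = i by rewrite /c eqxx orbT.
have cij : c i = c j by rewrite ci cj.
have cik : c i = c k by rewrite ci ck.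
have oi m : c i = c m -> [\/ m = i, m = j | m = k].
  rewrite ci /c; case: (m =P j) => [->|_]; first by constructor 2.
  by case: (m =P k) => [->|_ ->]; [constructor 3 | constructor 1].
have oj m : c j = c m -> [\/ m = j, m = i | m = k].
  rewrite -cij => /oi[]; by [constructor 2|constructor 1|constructor 3].
(* The three points collide with speeds 1, x and 0, which have to be distinct. *)
have H (x : K) : x != 0 -> x != 1 ->
    (wt a i j / (1 - x) + wt a i k) * (wt b i j / (x - 1) + wt b j k / x) =
    (wt a i j / (x - 1) + wt a j k / x) * (wt b i j / (1 - x) + wt b i k).
  move=> x0 x1; pose s (m : 'I_n.+3) : K :=
    if m == i then 1 else if m == j then x else 0.
  have si : s i = 1 by rewrite /s eqxx.
  have sj : s j = x by rewrite /s eq_sym (negbTE ij) eqxx.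
  have sk : s k = 0 by rewrite /s eq_sym (negbTE ik) eq_sym (negbTE jk).
  have sep p q : p != q -> c p = c q -> s p != s q.
    have cl m : c m = i -> [\/ m = i, m = j | m = k] by rewrite -{1}ci => /esym/oi.
    rewrite /c => pq; have [pin|pout] := boolP ((p == j) || (p == k)).
    - move/esym/cl; case=> E; subst q; case/orP: pin pq => /eqP -> pq;
      first [by rewrite eqxx in pq | rewrite ?si ?sj ?sk //].
      + by rewrite eq_sym oner_eq0.
      + by rewrite eq_sym.
    - case: ifP => [|_ E]; last by rewrite E eqxx in pq.
      move=> /orP qin /esym E; subst p; case: qin => /eqP ->; rewrite ?si ?sj ?sk ?oner_eq0 //.
      by rewrite eq_sym.
  have := @wedge0_leading a b c s i j ab sep mi mj.
  rewrite !(lead_three s _ u cij cik oi) !(lead_three s _ u' (esym cij) (etrans (esym cij) cik) oj).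
  by rewrite si sj sk !subr0 !divr1 !(wtC _ j i).
(* Times x (1 - x), the identity reads D + x E + (1 - x) F = 0, with D, E, F the determinants of
   (ij, jk), (ij, ik), (ik, jk). It is affine in x, so the values x = 2 and x = -1 give those at x =
   1 and x = 0, which are the two claims. *)
have two0 : 2%:R != 0 :> K by rewrite pnatr_eq0.
have two1 : 2%:R != 1 :> K by rewrite (eqr_nat K 2 1).
have m0 : -1 != 0 :> K by rewrite oppr_eq0 oner_eq0.
have m1 : -1 != 1 :> K by rewrite -subr_eq0 -opprD oppr_eq0.
move: (H _ two0 two1) (H _ m0 m1); rewrite /cross.
move: (wt a i j) (wt a i k) (wt a j k) (wt b i j) (wt b i k) (wt b j k) => x y z u1 v w.
move=> /eqP + /eqP; rewrite -subr_eq0 => /eqP H1; rewrite -subr_eq0 => /eqP H2.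
split.
  transitivity (- (4%:R / 3%:R) * 0 - (2%:R / 3%:R) * 0 : K); last by rewrite !mulr0 subrr.
  by rewrite -{1}H1 -{1}H2; field.
transitivity (- (2%:R / 3%:R) * 0 - (4%:R / 3%:R) * 0 : K); last by rewrite !mulr0 subrr.
by rewrite -{1}H1 -{1}H2; field.
Qed.
End Isotropic.

(** * Pairs of balanced weight matrices *)

Section Combinatorics.
Variables (K : numFieldType) (T : finType).
Implicit Types (w : T -> T -> K) (i j k l p q r m : T).

(* The weights w of a logarithmic form along the divisors of the n+3 points,
   as an S_(n+3)-symmetric datum. *)
Definition balanced w : Prop :=
  [/\ forall i j, w i j = w j i, forall i, w i i = 0 & forall i, \sum_j w i j = 0].

(** The shape of the pull-back of a logarithmic form on P^1 minus three points by the cross-ratio of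
    p, q, r, m: complementary pairs have equal weights, and the weights of the three splittings have
    sum zero. *)
Definition carried_by w p q r m : Prop :=
  [/\ w p m = w q r, w q m = w p r, w r m = w p q, w p q + w p r + w q r = 0 &
      forall i j, i \notin [:: p; q; r; m] -> w i j = 0].

Variables w1 w2 : T -> T -> K.
Hypotheses (b1 : balanced w1) (b2 : balanced w2).

Let cr i j k l := w1 i j * w2 k l - w1 k l * w2 i j.

(** Being parallel to two independent vectors of K^2 forces x to be 0; all weights below are killed
    in this way. *)
Let vec0 (x1 x2 u1 u2 v1 v2 : K) : u1 * v2 - v1 * u2 != 0 ->
  x1 * u2 - u1 * x2 = 0 -> x1 * v2 - v1 * x2 = 0 -> x1 = 0 /\ x2 = 0.
Proof.
move=> d h1 h2; split; apply: (mulIf d); rewrite mul0r.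
  have -> : x1 * (u1 * v2 - v1 * u2) =
    u1 * (x1 * v2 - v1 * x2) - v1 * (x1 * u2 - u1 * x2) by ring.
  by rewrite h1 h2 !mulr0 subrr.
have -> : x2 * (u1 * v2 - v1 * u2) =
  u2 * (x1 * v2 - v1 * x2) - v2 * (x1 * u2 - u1 * x2) by ring.
by rewrite h1 h2 !mulr0 subrr.
Qed.

Hypothesis disj : forall i j k l, uniq [:: i; j; k; l] -> cr i j k l = 0.

Let s1 i j : w1 i j = w1 j i. Proof. by case: b1. Qed.
Let s2 i j : w2 i j = w2 j i. Proof. by case: b2. Qed.

(** Disjoint pairs have parallel weights by [disj], so two pairs with independent weights are
    distinct and meet in one point. *)
Lemma share_vertex i j k l : cr i j k l != 0 ->
  exists p q r, [/\ uniq [:: p; q; r] & cr p q p r != 0].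
Proof.
move=> nz; have [[_ d1 _] [_ d2 _]] := (b1, b2).
have ij : i != j by apply: contraNneq nz => ->; rewrite /cr d1 d2 mul0r mulr0 subrr.
have kl : k != l by apply: contraNneq nz => ->; rewrite /cr d1 d2 mul0r mulr0 subrr.
have [ik|ik] := eqVneq i k.
  subst k; have [jl|jl] := eqVneq j l; first by rewrite -jl /cr subrr eqxx in nz.
  by exists i, j, l; rewrite nz /= !inE negb_or ij kl jl.
have [il|il] := eqVneq i l.
  subst l; have [jk|jk] := eqVneq j k.
    by move: nz; rewrite -jk /cr s1 s2 subrr eqxx.
  exists i, j, k; rewrite /= !inE negb_or ij ik jk.
  by move: nz; rewrite /cr (s1 k) (s2 k) => ->.
have [jk|jk] := eqVneq j k.
  subst k; exists j, i, l; rewrite /= !inE negb_or eq_sym ij kl il.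
  by move: nz; rewrite /cr (s1 i) (s2 i) => ->.
have [jl|jl] := eqVneq j l.
  subst l; exists j, i, k; rewrite /= !inE negb_or eq_sym ij eq_sym kl ik.
  by move: nz; rewrite /cr (s1 i) (s2 i) (s1 k) (s2 k) => ->.
by rewrite disj ?eqxx //= !inE !negb_or ij ik il jk jl kl in nz.
Qed.

(** Start from pq and pr independent. A pair outside the triangle pqr is disjoint from both, so its
    weight is 0. The row sums then show that the weights of the triangle add up to 0, so any two of
    its sides are independent. Some m outside is joined to p by a nonzero weight, parallel to that
    of qr. For any further i, the pair qi is disjoint from pm, hence parallel to qr, and disjoint
    from pr, so its weight is 0; likewise for ri, and for pi by the row sum of i. *)
Lemma balanced_pair : (exists i j k l, cr i j k l != 0) ->
  exists p q r m, [/\ uniq [:: p; q; r; m], carried_by w1 p q r m &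
                      carried_by w2 p q r m].
Proof.
case=> [i [j [k [l /share_vertex [p [q [r [u nz]]]]]]]] {i j k l}.
move: (u); rewrite /= !inE negb_or andbT => /andP[/andP[pq pr] qr].
have out3 m : m \notin [:: p; q; r] -> [/\ m != p, m != q & m != r].
  by rewrite !inE !negb_or => /and3P.
have C0 l m : l \notin [:: p; q; r] -> m \notin [:: p; q; r] -> w1 l m = 0 /\ w2 l m = 0.
  move=> lC mC; have [<-|lm] := eqVneq l m; first by case: b1 b2 => _ -> _ [_ -> _].
  have [lp lq lr] := out3 _ lC; have [mp mq mr] := out3 _ mC.
  by apply: (vec0 nz); apply: disj; rewrite /= !inE !negb_or ?lm ?lp ?lq ?lr ?mp ?mq ?mr ?pq ?pr.
have mem4 i m : i \notin [:: p; q; r; m] -> i \notin [:: p; q; r].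
  by rewrite !inE !negb_or => /and4P[-> -> ->].
have u4 m : m \notin [:: p; q; r] -> uniq [:: p; q; r; m].
  move=> /out3[mp mq mr].
  by rewrite /= !inE !negb_or pq pr qr (eq_sym p) mp (eq_sym q) mq (eq_sym r) mr.
have split_row (w : T -> T -> K) (i : T) : balanced w ->
    w i p + w i q + w i r + \sum_(m | m \notin [:: p; q; r]) w i m = 0.
  move=> [_ _ ws]; rewrite -[RHS](ws i).
  rewrite [RHS](bigD1 p) //= [X in _ = _ + X](bigD1 q) 1?eq_sym //=.
  rewrite [X in _ = _ + (_ + X)](bigD1 r) /=; last by rewrite eq_sym pr eq_sym.
  rewrite -!addrA; do 3! congr (_ + _); apply: eq_bigl => m.
  by rewrite !inE !negb_or andbA.
have split_row4 (w : T -> T -> K) i m : balanced w -> m \notin [:: p; q; r] ->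
    (forall x, x \notin [:: p; q; r; m] -> w i x = 0) ->
    w i p + w i q + w i r + w i m = 0.
  move=> bw mC H; rewrite -[RHS](split_row w i bw); congr (_ + _).
  rewrite (bigD1 m) //= big1 ?addr0 // => x /andP[xC xm].
  by apply: H; move: xC; rewrite !inE !negb_or (negbTE xm) => /and3P[-> -> ->].
have rowC m : m \notin [:: p; q; r] ->
    w1 m p + w1 m q + w1 m r = 0 /\ w2 m p + w2 m q + w2 m r = 0.
  move=> mC; have := split_row _ m b1; have := split_row _ m b2.
  by rewrite !big1 ?addr0 // => x /(C0 m _ mC)[].
have tri (w : T -> T -> K) : balanced w ->
    (forall m, m \notin [:: p; q; r] -> w m p + w m q + w m r = 0) ->
    w p q + w p r + w q r = 0.
  move=> bw H; have [sw dw _] := bw.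
  have E : \sum_(m | m \notin [:: p; q; r]) (w p m + w q m + w r m) = 0.
    by apply: big1 => m mC; rewrite !(sw _ m) H.
  rewrite !big_split /= in E.
  have := split_row w p bw; have := split_row w q bw; have := split_row w r bw.
  rewrite !dw (sw q p) (sw r p) (sw r q) => h1 h2 h3.
  have two : 2%:R != 0 :> K by rewrite pnatr_eq0.
  apply: (mulfI two); rewrite mulr0; move: E h1 h2 h3.
  move: (\sum_(_ | _) w p _) (\sum_(_ | _) w q _) (\sum_(_ | _) w r _) => x y z E h1 h2 h3.
  transitivity ((w p r + w q r + 0 + z) + (w p q + 0 + w q r + y) +
    (0 + w p q + w p r + x) - (x + y + z)); first by ring.
  by rewrite h1 h2 h3 E !addr0 subr0.
have t1 := tri _ b1 (fun m mC => (rowC m mC).1).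
have t2 := tri _ b2 (fun m mC => (rowC m mC).2).
have nz2 : cr q r p r != 0.
  rewrite /cr; have -> : w1 q r = - (w1 p q + w1 p r) by apply/eqP; rewrite -addr_eq0 addrC t1.
  have -> : w2 q r = - (w2 p q + w2 p r) by apply/eqP; rewrite -addr_eq0 addrC t2.
  by rewrite -oppr_eq0; move: nz; rewrite /cr; congr (_ != 0); ring.
have nz3 : cr q r p q != 0.
  rewrite /cr; have -> : w1 q r = - (w1 p q + w1 p r) by apply/eqP; rewrite -addr_eq0 addrC t1.
  have -> : w2 q r = - (w2 p q + w2 p r) by apply/eqP; rewrite -addr_eq0 addrC t2.
  by move: nz; rewrite /cr; congr (_ != 0); ring.
(* Otherwise row p reduces to pq + pr = 0, and the triangle relation makes the weight of qr vanish,
   against [nz2]. *)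
have [m mC mnz] : exists2 m, m \notin [:: p; q; r] & (w1 p m != 0) || (w2 p m != 0).
  apply/exists_inP; apply: contraT; rewrite negb_exists_in => /forall_inP H.
  have Hz m : m \notin [:: p; q; r] -> w1 p m = 0 /\ w2 p m = 0.
    by move/H; rewrite negb_or !negbK => /andP[/eqP -> /eqP ->].
  have := split_row _ p b1; have := split_row _ p b2.
  rewrite !big1; try by move=> m /Hz[].
  have [[_ -> _] [_ -> _]] := (b1, b2); rewrite !add0r !addr0 => e2 e1.
  have z1 : w1 q r = 0 by move: t1; rewrite e1 add0r.
  have z2 : w2 q r = 0 by move: t2; rewrite e2 add0r.
  by rewrite /cr z1 z2 mul0r mulr0 subrr eqxx in nz2.
have [mp mq mr] := out3 _ mC.
have pm_qr : cr p m q r = 0.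
  by apply: disj; rewrite /= !inE !negb_or eq_sym mp pq pr mq mr qr.
(* Anything parallel to the nonzero vector at pm is parallel to the one at qr. *)
have trans i j : cr p m i j = 0 -> cr i j q r = 0.
  rewrite /cr => e; move: pm_qr; rewrite /cr => e'; case/orP: mnz => nzm; apply: (mulfI nzm).
    rewrite mulr0; transitivity (w1 i j * (w1 p m * w2 q r - w1 q r * w2 p m) -
      w1 q r * (w1 p m * w2 i j - w1 i j * w2 p m)); first by ring.
    by rewrite e e' !mulr0 subrr.
  rewrite mulr0; transitivity (w2 i j * (w1 p m * w2 q r - w1 q r * w2 p m) -
    w2 q r * (w1 p m * w2 i j - w1 i j * w2 p m)); first by ring.
  by rewrite e e' !mulr0 subrr.
have Z i : i \notin [:: p; q; r; m] -> [/\ w1 p i = 0 /\ w2 p i = 0,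
    w1 q i = 0 /\ w2 q i = 0 & w1 r i = 0 /\ w2 r i = 0].
  move=> iC4; have iC := mem4 _ _ iC4; have [ip iq ir] := out3 _ iC.
  have im : i != m by move: iC4; rewrite !inE !negb_or => /and4P[].
  have Zq : w1 q i = 0 /\ w2 q i = 0.
    apply: (vec0 nz2); first by apply/trans/disj;
      rewrite /= !inE !negb_or eq_sym mp pq (eq_sym p) ip mq eq_sym im eq_sym iq.
    by apply: disj; rewrite /= !inE !negb_or (eq_sym q i) iq (eq_sym q) pq qr ip ir pr.
  have Zr : w1 r i = 0 /\ w2 r i = 0.
    apply: (vec0 nz3); first by apply/trans/disj;
      rewrite /= !inE !negb_or eq_sym mp pr (eq_sym p) ip mr eq_sym im eq_sym ir.
    by apply: disj;
      rewrite /= !inE !negb_or (eq_sym r i) ir (eq_sym r p) pr (eq_sym r q) qr ip iq pq.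
  split=> //; case: (rowC i iC); rewrite !(s1 i) !(s2 i).
  by case: Zq Zr => -> -> [-> ->]; rewrite !addr0.
have fin (w : T -> T -> K) : balanced w -> w p q + w p r + w q r = 0 ->
    (forall i, i \notin [:: p; q; r; m] -> [/\ w p i = 0, w q i = 0 & w r i = 0]) ->
    (forall i j, i \notin [:: p; q; r] -> j \notin [:: p; q; r] -> w i j = 0) ->
    carried_by w p q r m.
  move=> bw tw zw cw; have [sw dw _] := bw.
  have rp : w p p + w p q + w p r + w p m = 0 by apply: split_row4 => // x /zw[].
  have rq : w q p + w q q + w q r + w q m = 0 by apply: split_row4 => // x /zw[].
  have rr : w r p + w r q + w r r + w r m = 0 by apply: split_row4 => // x /zw[].
  rewrite !dw ?(sw q p) ?(sw r p) ?(sw r q) in rp rq rr.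
  split=> //.
  - transitivity (w q r + ((0 + w p q + w p r + w p m) - (w p q + w p r + w q r))).
      by ring.
    by rewrite rp tw subrr addr0.
  - transitivity (w p r + ((w p q + 0 + w q r + w q m) - (w p q + w p r + w q r))).
      by ring.
    by rewrite rq tw subrr addr0.
  - transitivity (w p q + ((w p r + w q r + 0 + w r m) - (w p q + w p r + w q r))).
      by ring.
    by rewrite rr tw subrr addr0.
  - move=> i j iC4; have iC := mem4 _ _ iC4; have [h1 h2 h3] := zw _ iC4.
    have [jC|] := boolP (j \notin [:: p; q; r]); first exact: cw.
    by rewrite negbK !inE sw => /or3P[]/eqP->.
exists p, q, r, m; split; [exact: u4 | |]; apply: fin => //.
- by move=> i /Z[[-> _] [-> _] [-> _]].
- by move=> i j iC jC; case: (C0 i j).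
- by move=> i /Z[[_ ->] [_ ->] [_ ->]].
- by move=> i j iC jC; case: (C0 i j).
Qed.

End Combinatorics.

(** * Infinity as a point among the others *)

Section Extended.
Variables (K : numFieldType) (n : nat).
Local Notation W := {ffun A0_index n -> K^o}.
Implicit Types (a b : W) (i j k l : 'I_n.+3).

(* The weight of a logarithmic form along the divisor where the points i and j
   collide, with infinity among the points. *)
Definition ewt a i j : K :=
  if i == ptoo then (if j == ptoo then 0 else - \sum_l wt a j l)
  else if j == ptoo then - \sum_l wt a i l else wt a i j.

Lemma fin_oo i : (i != ptoo) = (i < n.+2)%N.
Proof.
case: (ptP i) => [i'|||]; rewrite ?pt_eqE ?eqxx /=; first have := ltn_ord i'; lia.
Qed.

Lemma ewt_fin a i j : i != ptoo -> j != ptoo -> ewt a i j = wt a i j.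
Proof. by rewrite /ewt => /negbTE -> /negbTE ->. Qed.

Lemma ewt_pair a (k : A0_index n) : ewt a (pair_of k).1 (pair_of k).2 = a k.
Proof.
rewrite ewt_fin ?wt_pair ?fin_oo ?pair_of_fin //.
exact: ltn_trans (pair_of_lt k) (pair_of_fin k).
Qed.

Lemma ewt_balanced a : \sum_k a k = 0 -> balanced (ewt a).
Proof.
move=> a0; split.
- move=> i j; rewrite /ewt.
  by case: (i =P ptoo) => _; case: (j =P ptoo) => _ //; rewrite wtC.
- by move=> i; rewrite /ewt; case: eqP => // _; rewrite wt_diag.
- move=> i; rewrite (bigD1 ptoo) //= /ewt eqxx.
  have [_|ioo] := eqVneq i ptoo.
    rewrite add0r (eq_bigr (fun j => - \sum_l wt a j l)); last by move=> j /negbTE ->.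
    rewrite sumrN -[RHS]oppr0; congr (- _).
    transitivity (\sum_i \sum_j wt a i j); last by rewrite sum_wt a0 mul0rn.
    rewrite [RHS](bigD1 ptoo) //= [X in _ = X + _]big1 ?add0r // => j _.
    by rewrite wtC wt_oo.
  rewrite [X in _ + X = _](eq_bigr (fun j => wt a i j)); last by move=> j /negbTE ->.
  by rewrite [X in - X](bigD1 ptoo) //= wt_oo add0r addNr.
Qed.

Lemma movable_or i : i != ptoo -> movable i \/ i = pt0.
Proof.
rewrite /movable; case: (ptP i) => [i'|||] /=; last by rewrite eqxx.
- by left; have := ltn_ord i'; lia.
- by left.
- by right.
Qed.

(** Of the finite points only [pt0] is not movable, so each of two disjoint pairs has a movable
    end. *)
Lemma cross_disjoint a b i j k l : wedge0 a b -> uniq [:: i; j; k; l] ->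
  i != ptoo -> j != ptoo -> k != ptoo -> l != ptoo -> cross a b i j k l = 0.
Proof.
move=> ab u fi fj fk fl.
have u1 : uniq [:: j; i; k; l].
  move: u; rewrite /= !inE !negb_or (eq_sym j i) !andbT.
  by case/and3P => /and3P[-> -> ->] /andP[-> ->] ->.
have u2 : uniq [:: i; j; l; k].
  move: u; rewrite /= !inE !negb_or (eq_sym l k) !andbT.
  by case/and3P => /and3P[-> -> ->] /andP[-> ->] ->.
have u3 : uniq [:: j; i; l; k].
  move: u; rewrite /= !inE !negb_or (eq_sym l k) (eq_sym j i) !andbT.
  by case/and3P => /and3P[-> -> ->] /andP[-> ->] ->.
have [mi|i0] := movable_or fi; have [mk|k0] := movable_or fk.
- exact: cross_disjoint_movable.
- have [ml|l0] := movable_or fl; last by move: u; rewrite k0 l0 /= !inE eqxx !andbF.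
  by rewrite crossC2; apply: cross_disjoint_movable.
- have [mj|j0] := movable_or fj; last by move: u; rewrite i0 j0 /= !inE eqxx.
  by rewrite crossC1; apply: cross_disjoint_movable.
- by move: u; rewrite i0 k0 /= !inE eqxx orbT.
Qed.

(** At least two of three finite points are movable; the relations of [cross_triple_movable] for
    these two give the third by subtraction. *)
Lemma cross_triple a b i j k : wedge0 a b -> uniq [:: i; j; k] ->
  i != ptoo -> j != ptoo -> k != ptoo ->
  cross a b i j j k + cross a b i j i k = 0.
Proof.
move=> ab u fi fj fk.
move: (u); rewrite /= !inE negb_or andbT => /andP[/andP[ij ik] jk].
have [mi|i0] := movable_or fi; last first.
  have [mj|j0] := movable_or fj; last by rewrite i0 j0 eqxx in ij.
  have [mk|k0] := movable_or fk; last by rewrite i0 k0 eqxx in ik.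
  have u' : uniq [:: j; k; i] by rewrite /= !inE negb_or jk eq_sym ij eq_sym ik.
  have [] := cross_triple_movable ab u' mj mk.
  rewrite /cross !(wtC _ k i) !(wtC _ j i) => e1 e2.
  by apply: (addIr 0); rewrite -{1}e1 -{2}e2; ring.
have [mj|j0] := movable_or fj; first by have [] := cross_triple_movable ab u mi mj.
have [mk|k0] := movable_or fk; last by rewrite j0 k0 eqxx in jk.
have u' : uniq [:: i; k; j] by rewrite /= !inE negb_or ij ik eq_sym jk.
have [] := cross_triple_movable ab u' mi mk.
rewrite /cross !(wtC _ k j) => e1 e2.
by apply: (addIr 0); rewrite -{1}e1 -{2}e2; ring.
Qed.

(** The weight at (i, infinity) is minus the sum over m of those at (i, m). Against the pair kl the
    terms with m different from k and l vanish by disjointness, and those with m = k and m = l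
    cancel by [cross_triple]. *)
Lemma ewt_disjoint a b i j k l : \sum_k a k = 0 -> \sum_k b k = 0 ->
  wedge0 a b -> uniq [:: i; j; k; l] ->
  ewt a i j * ewt b k l - ewt a k l * ewt b i j = 0.
Proof.
move=> /ewt_balanced [sa _ _] /ewt_balanced [sb _ _] ab.
have one i' k' l' : i' != ptoo -> uniq [:: i'; k'; l'] -> k' != ptoo -> l' != ptoo ->
    ewt a i' ptoo * ewt b k' l' - ewt a k' l' * ewt b i' ptoo = 0.
  move=> fi u fk fl; rewrite !(ewt_fin _ fk fl) /ewt (negbTE fi) eqxx.
  rewrite mulNr mulrN opprK mulr_suml mulr_sumr addrC -sumrB.
  move: (u); rewrite /= !inE negb_or andbT => /andP[/andP[ik il] kl].
  have T := @cross_triple a b k' l' i' ab _ fk fl fi.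
  rewrite (bigD1 k') //= (bigD1 l') /=; last by rewrite eq_sym.
  rewrite big1 ?addr0 => [|m /andP[mk ml]].
    transitivity (cross a b k' l' l' i' + cross a b k' l' k' i').
      by rewrite /cross !(wtC _ l' i') !(wtC _ k' i'); ring.
    by apply: T; rewrite /= !inE negb_or kl eq_sym ik eq_sym il.
  have [->|im] := eqVneq m i'; first by rewrite !wt_diag mul0r mulr0 subrr.
  have [->|fm] := eqVneq m ptoo; first by rewrite !wt_oo mul0r mulr0 subrr.
  have := @cross_disjoint a b i' m k' l' ab _ fi fm fk fl.
  rewrite /cross => H; rewrite -[RHS]oppr0 -H; first by ring.
  by rewrite /= !inE !negb_or (eq_sym i') im ik il mk ml kl.
rewrite /= !inE !negb_or !andbT => /and3P[/and3P[ij ik il] /andP[jk jl] kl].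
have u3 (x y z : 'I_n.+3) : x != y -> x != z -> y != z -> uniq [:: x; y; z].
  by rewrite /= !inE negb_or andbT => -> -> ->.
have [e|fi] := eqVneq i ptoo.
  subst i; rewrite (sa ptoo) (sb ptoo).
  by apply: (one _ _ _ _ (u3 _ _ _ jk jl kl)); rewrite eq_sym.
have [e|fj] := eqVneq j ptoo.
  by subst j; apply: (one _ _ _ _ (u3 _ _ _ ik il kl)); rewrite // eq_sym.
have [e|fk] := eqVneq k ptoo.
  subst k; rewrite (sa ptoo) (sb ptoo) -[LHS]opprK opprB -[RHS]oppr0; congr (- _).
  by apply: (one _ _ _ _ (u3 l i j _ _ _)); rewrite // eq_sym.
have [e|fl] := eqVneq l ptoo.
  subst l; rewrite -[LHS]opprK opprB -[RHS]oppr0; congr (- _).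
  by apply: (one _ _ _ _ (u3 k i j _ _ _)); rewrite // eq_sym.
rewrite !ewt_fin //; apply: cross_disjoint => //.
by rewrite /= !inE !negb_or ij ik il jk jl kl.
Qed.

End Extended.

(** * The resonance components *)

Section Quads.
Variable n : nat.

Definition quad : Type := {J : {set 'I_n.+3} | #|J| == 4%N}.
HB.instance Definition _ := SubType.on quad.
HB.instance Definition _ := Finite.on quad.
Implicit Type J : quad.

(** The points of J come in increasing order, so only [qpt J 3] can be infinity and [qpt J 0] is
    always one of the coordinates x_1, ..., x_n. *)
Definition qpt J (t : nat) : 'I_n.+3 := nth ord0 (enum (val J)) t.

Lemma card_quad J : #|val J| = 4%N. Proof. exact/eqP/(valP J). Qed.

Lemma size_quad J : size (enum (val J)) = 4%N.
Proof. by rewrite -cardE card_quad. Qed.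

Lemma enum_quad J : enum (val J) = [:: qpt J 0; qpt J 1; qpt J 2; qpt J 3].
Proof. by rewrite /qpt; case: (enum (val J)) (size_quad J) => [|? [|? [|? [|? []]]]]. Qed.

Lemma mem_quad J i :
  (i \in val J) = (i \in [:: qpt J 0; qpt J 1; qpt J 2; qpt J 3]).
Proof. by rewrite -mem_enum enum_quad. Qed.

Lemma sorted_enum_set (A : {set 'I_n.+3}) : sorted ltn (map val (enum A)).
Proof.
rewrite sorted_map {1}/enum_mem; apply: sorted_filter.
  by move=> ? ? ?; apply: ltn_trans.
by rewrite -(@sorted_map _ _ val ltn) -enumT val_enum_ord iota_ltn_sorted.
Qed.

Lemma quad_lt J : [/\ (qpt J 0 < qpt J 1)%N, (qpt J 1 < qpt J 2)%N & (qpt J 2 < qpt J 3)%N].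
Proof. by have := sorted_enum_set (val J); rewrite enum_quad /= andbT => /and3P. Qed.

Lemma quad_enumE J (a b c d : 'I_n.+3) : (a < b)%N -> (b < c)%N -> (c < d)%N ->
    (forall i, (i \in val J) = (i \in [:: a; b; c; d])) ->
  [/\ qpt J 0 = a, qpt J 1 = b, qpt J 2 = c & qpt J 3 = d].
Proof.
move=> ab bc cd mem; suff E : enum (val J) = [:: a; b; c; d] by rewrite /qpt E.
apply: (inj_map val_inj); apply: (@irr_sorted_eq _ ltn ltn_trans ltnn).
- exact: sorted_enum_set.
- by rewrite /= ab bc cd.
by move=> x; apply/mapP/mapP => -[i im ->]; exists i => //;
  rewrite ?mem_enum ?mem // -mem -mem_enum.
Qed.

Lemma quad_ex (a b c d : 'I_n.+3) : uniq [:: a; b; c; d] ->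
  exists J, forall i, (i \in val J) = (i \in [:: a; b; c; d]).
Proof.
move=> u; have cJ : #|[set i in [:: a; b; c; d]]| == 4%N.
  by rewrite cardsE; move/card_uniqP: u => ->.
by exists (exist (fun J : {set 'I_n.+3} => #|J| == 4%N) _ cJ) => i; rewrite inE.
Qed.

Lemma quad_eqP J J' : (forall i, (i \in val J) = (i \in val J')) -> J = J'.
Proof. by move=> e; apply/val_inj/setP. Qed.

Lemma card_quads : #|{: quad}| = 'C(n.+3, 4).
Proof.
rewrite card_sig -[n.+3 in RHS]card_ord -card_draws.
by apply: eq_card => A; rewrite !inE.
Qed.

Lemma quad_ne J : [/\ qpt J 0 != qpt J 1, qpt J 0 != qpt J 2, qpt J 0 != qpt J 3 &
  [/\ qpt J 1 != qpt J 2, qpt J 1 != qpt J 3 & qpt J 2 != qpt J 3]].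
Proof.
have [l1 l2 l3] := quad_lt J.
by do ! split; rewrite -val_eqE /= neq_ltn; apply/orP; left; lia.
Qed.

Lemma quad_movable J : [/\ (qpt J 0 < n)%N, (qpt J 1 < n.+1)%N & (qpt J 2 < n.+2)%N].
Proof.
have [l1 l2 l3] := quad_lt J; have := ltn_ord (qpt J 3) => l4.
by split; lia.
Qed.

End Quads.

Section Components.
Variables (K : numFieldType) (n : nat).
Local Notation W := {ffun A0_index n -> K^o}.
Implicit Types (a b : W) (i j : 'I_n.+3) (J : quad n).

(** Zero when i or j is infinity, so that the formulas below are the same whether J contains
    infinity or not. *)
Definition edge i j : W := [ffun k => (hits k i j)%:R].

Lemma hits_eq i j p q : i != j -> i != ptoo -> j != ptoo -> forall k : A0_index n,
  hits k i j -> hits k p q = ((p == i) && (q == j)) || ((p == j) && (q == i)).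
Proof.
move=> ij fi fj k; rewrite /hits => /orP[]/eqP ->.
  rewrite -[(i, j) == (p, q)]/((i == p) && (j == q)) -[(i, j) == (q, p)]/((i == q) && (j == p)).
  by rewrite (eq_sym i) (eq_sym j) (eq_sym i) (eq_sym j) (andbC (q == i)).
rewrite -[(j, i) == (p, q)]/((j == p) && (i == q)) -[(j, i) == (q, p)]/((j == q) && (i == p)).
by rewrite (eq_sym j) (eq_sym i) (eq_sym j) (eq_sym i) orbC (andbC (q == j)).
Qed.

Lemma wt_edge p q i j : i != j -> i != ptoo -> j != ptoo ->
  wt (edge p q) i j = (((p == i) && (q == j)) || ((p == j) && (q == i)))%:R.
Proof.
move=> ij fi fj; rewrite /wt.
have [k0 Hk] : exists h : A0_index n, forall h' : A0_index n, hits h' i j = (h' == h).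
  by apply: hits_ex; rewrite // -fin_oo.
rewrite (bigD1 k0) //= Hk eqxx mulr1 big1 ?addr0.
  by rewrite ffunE (hits_eq _ _ ij fi fj) // Hk eqxx.
by move=> k /negbTE ne; rewrite Hk ne mulr0.
Qed.

Definition split1 J := edge (qpt J 0) (qpt J 1) + edge (qpt J 2) (qpt J 3).
Definition split2 J := edge (qpt J 0) (qpt J 2) + edge (qpt J 1) (qpt J 3).
Definition split3 J := edge (qpt J 0) (qpt J 3) + edge (qpt J 1) (qpt J 2).

(** With P / Q the cross-ratio of J, the three splittings are the logarithmic differentials of P, Q
    and P - Q, and the two forms those of P / (P - Q) and Q / (P - Q). *)
Definition form1 J : W := split1 J - split3 J.
Definition form2 J : W := split2 J - split3 J.
Definition res_comp J : {vspace W} := <<[:: form1 J; form2 J]>>%VS.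

Lemma res_compP J a :
  reflect (exists x y : K, a = x *: form1 J + y *: form2 J) (a \in res_comp J).
Proof.
apply: (iffP idP) => [|[x [y ->]]].
  rewrite /res_comp span_cons span_seq1 => /memv_addP [u /vlineP [x ->] [v /vlineP [y ->] ->]].
  by exists x, y.
by apply: memvD; apply: memvZ; apply: memv_span; rewrite !inE eqxx ?orbT.
Qed.

(** [carried_by] is symmetric in its four points; this allows passing to the increasing order of
    [qpt]. *)
Lemma carried_swap (w : 'I_n.+3 -> 'I_n.+3 -> K) p q r m i j k l :
    (forall i j, w i j = w j i) -> carried_by w p q r m -> uniq [:: i; j; k; l] ->
    all (mem [:: p; q; r; m]) [:: i; j; k; l] ->
  w i j = w k l.
Proof.
move=> sw [e1 e2 e3 _ _] u; rewrite [all _ _]/= !andbT => /and4P[ii jj kk ll].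
rewrite !inE in ii jj kk ll.
case/or4P: ii => /eqP ei; case/or4P: jj => /eqP ej;
  try (by move: u; rewrite ei ej /= !inE eqxx);
  case/or4P: kk => /eqP ek;
  try (by move: u; rewrite ei ej ek /= !inE eqxx ?orbT ?andbF);
  case/or4P: ll => /eqP el;
  try (by move: u; rewrite ei ej ek el /= !inE eqxx ?orbT ?andbF);
  by rewrite ei ej ek el ?(sw q p) ?(sw r p) ?(sw m p) ?(sw r q) ?(sw m q) ?(sw m r)
    ?e1 ?e2 ?e3.
Qed.

Lemma carried_comp a p q r m J : \sum_k a k = 0 -> carried_by (ewt a) p q r m ->
    (forall i, (i \in val J) = (i \in [:: p; q; r; m])) ->
  a \in res_comp J.
Proof.
move=> a0 ca memE; have [sw dw rw] := ewt_balanced a0.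
have [_ _ _ _ out] := ca.
have outJ i j : i \notin val J -> ewt a i j = 0 by rewrite memE; apply: out.
have [n01 n02 n03 [n12 n13 n23]] := quad_ne J.
have memJ t : (t < 4)%N -> qpt J t \in [:: p; q; r; m].
  by move=> t4; rewrite -memE mem_quad !inE; case: t t4 => [|[|[|[|]]]] //; rewrite eqxx ?orbT.
have swap i j k l : uniq [:: i; j; k; l] -> all (mem [:: p; q; r; m]) [:: i; j; k; l] ->
  ewt a i j = ewt a k l by exact: carried_swap.
pose A := qpt J 0; pose B := qpt J 1; pose C := qpt J 2; pose D := qpt J 3.
have eAB : ewt a A B = ewt a C D.
  by apply: swap; rewrite /= ?memJ // !inE !negb_or n01 n02 n03 n12 n13 n23.
have eAC : ewt a A C = ewt a B D.
  by apply: swap; rewrite /= ?memJ // !inE !negb_or n01 n02 n03 (eq_sym _ B) n12 n13 n23.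
have eAD : ewt a A D = ewt a B C.
  by apply: swap; rewrite /= ?memJ // !inE !negb_or n01 n02 n03 (eq_sym D B) (eq_sym D C)
    n12 n13 n23.
have row : ewt a A B + ewt a A C + ewt a A D = 0.
  rewrite -[RHS](rw A) (bigD1 A) //= dw add0r (bigD1 B) 1?eq_sym //=.
  rewrite (bigD1 C) /=; last by rewrite eq_sym n02 eq_sym.
  rewrite (bigD1 D) /=; last by rewrite eq_sym n03 (eq_sym D B) n13 eq_sym.
  rewrite big1 ?addr0 ?addrA // => i /andP[/andP[/andP[i0 i1] i2] i3].
  by rewrite sw outJ // mem_quad !inE !negb_or i0 i1 i2 i3.
apply/res_compP; exists (ewt a A B), (ewt a A C); apply/ffunP => k.
have e3 : ewt a A D = - ewt a A B - ewt a A C.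
  by apply: (addrI (ewt a A B + ewt a A C)); rewrite row; ring.
transitivity (ewt a A B * ((hits k A B)%:R + (hits k C D)%:R) +
  ewt a A C * ((hits k A C)%:R + (hits k B D)%:R) +
  ewt a A D * ((hits k A D)%:R + (hits k B C)%:R)); last first.
  by rewrite e3 !ffunE -!/(_ * _); rewrite /GRing.scale /=; ring.
rewrite -ewt_pair; have kl := pair_of_lt k; have kf := pair_of_fin k.
have fi : (pair_of k).1 != ptoo by rewrite fin_oo (ltn_trans kl).
have fj : (pair_of k).2 != ptoo by rewrite fin_oo.
have hk : hits k (pair_of k).1 (pair_of k).2 by rewrite /hits -surjective_pairing eqxx.
move: (pair_of k).1 (pair_of k).2 kl fi fj hk => i j lij fi fj hk {kf}.
have nij : i != j by apply: contraTneq lij => ->; rewrite ltnn.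
rewrite !(hits_eq _ _ nij fi fj hk).
have [l1 l2 l3] := quad_lt J; rewrite -/A -/B -/C -/D in l1 l2 l3.
have [iJ|iJ] := boolP (i \in val J); last first.
  have iN t : (t < 4)%N -> (qpt J t == i) = false.
    by move=> t4; apply: contraNF iJ => /eqP <-; rewrite memE memJ.
  by rewrite outJ // !iN // !andbF !addr0 !mulr0 !addr0.
have [jJ|jJ] := boolP (j \in val J); last first.
  have jN t : (t < 4)%N -> (qpt J t == j) = false.
    by move=> t4; apply: contraNF jJ => /eqP <-; rewrite memE memJ.
  by rewrite sw outJ // !jN // !andbF !addr0 !mulr0 !addr0.
have F (x y : 'I_n.+3) : x != y -> ((x == y) = false) * ((y == x) = false).
  by move=> xy; split; last rewrite eq_sym; apply: negbTE.
have := (F _ _ n01, F _ _ n02, F _ _ n03, F _ _ n12, F _ _ n13, F _ _ n23).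
rewrite -/A -/B -/C -/D => Fs.
rewrite mem_quad !inE -/A -/B -/C -/D in iJ; rewrite mem_quad !inE -/A -/B -/C -/D in jJ.
have S := (sw B A, sw C A, sw D A, sw C B, sw D B, sw D C).
case/or4P: iJ nij => /eqP -> nij; case/or4P: jJ nij => /eqP -> nij;
  try (by rewrite eqxx in nij);
  by rewrite !eqxx !Fs /= !addr0 ?add0r ?mulr0 ?mulr1 ?addr0 ?add0r ?S ?eAB ?eAC ?eAD.
Qed.

End Components.

Section ComponentAlgebra.
Variables (K : numFieldType) (n : nat).
Local Notation W := {ffun A0_index n -> K^o}.
Implicit Types (a b : W) (i j : 'I_n.+3) (J : quad n).

Lemma qpt_fin J t : (t < 3)%N -> qpt J t != ptoo.
Proof.
have [m0 m1 m2] := quad_movable J.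
by rewrite fin_oo; case: t => [|[|[|]]] // _; lia.
Qed.

Definition same_pair i j p q : bool := ((p == i) && (q == j)) || ((p == j) && (q == i)).

Lemma wt_comp J (x y : K) i j : i != j -> i != ptoo -> j != ptoo ->
  let s t u := (same_pair i j (qpt J t) (qpt J u))%:R in
  wt (x *: form1 K J + y *: form2 K J) i j =
    x * (s 0%N 1%N + s 2%N 3%N) + y * (s 0%N 2%N + s 1%N 3%N)
    - (x + y) * (s 0%N 3%N + s 1%N 2%N) :> K.
Proof.
move=> ij fi fj s.
have -> : x *: form1 K J + y *: form2 K J =
  x *: split1 K J + (y *: split2 K J + ((- (x + y)) *: split3 K J + 0)).
  apply/ffunP => k; rewrite /form1 /form2 !ffunE /GRing.scale /=; ring.
have z0 : wt (0 : W) i j = 0 by apply: big1 => k _; rewrite ffunE mul0r.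
rewrite !wt_is_linear z0 addr0.
have S p q r m : wt (edge K p q + edge K r m) i j = wt (edge K p q) i j + wt (edge K r m) i j.
  by rewrite -[edge K p q]scale1r wt_is_linear scale1r mul1r.
by rewrite /split1 /split2 /split3 !S !wt_edge // mulNr addrA.
Qed.

Lemma wt_comp_pts J (x y : K) : let v := x *: form1 K J + y *: form2 K J in
  [/\ wt v (qpt J 0) (qpt J 1) = x, wt v (qpt J 0) (qpt J 2) = y,
      wt v (qpt J 1) (qpt J 2) = - (x + y) &
      qpt J 3 != ptoo -> wt v (qpt J 3) (qpt J 2) = x /\ wt v (qpt J 3) (qpt J 1) = y].
Proof.
rewrite /=; have [n01 n02 n03 [n12 n13 n23]] := quad_ne J.
have F (p q : 'I_n.+3) : p != q -> ((p == q) = false) * ((q == p) = false).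
  by move=> pq; split; last rewrite eq_sym; apply: negbTE.
have Fs := (F _ _ n01, F _ _ n02, F _ _ n03, F _ _ n12, F _ _ n13, F _ _ n23).
have [f0 f1 f2] : [/\ qpt J 0 != ptoo, qpt J 1 != ptoo & qpt J 2 != ptoo].
  by rewrite !qpt_fin.
split; last (move=> f3; split); rewrite wt_comp ?f0 ?f1 ?f2 ?Fs ?f3 //;
  by rewrite /same_pair ?eqxx ?Fs ?andbF ?andbT /=; ring.
Qed.

(** Any nonzero element of a component remembers the finite points of J; whether infinity belongs to
    J then follows from #|J| = 4. *)
Lemma comp_support J a i : a \in res_comp K J -> a != 0 -> i != ptoo ->
  (i \in val J) <-> exists j, wt a i j != 0.
Proof.
move=> /res_compP [x [y ->]] nz fi; have [w01 w02 w12 w3] := wt_comp_pts J x y; split.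
  have xy : (x != 0) || (y != 0).
    apply: contraNT nz; rewrite negb_or !negbK => /andP[/eqP-> /eqP->].
    by rewrite !scale0r addr0.
  rewrite mem_quad !inE => /or4P[]/eqP e; rewrite e in fi *.
  - by case/orP: xy => h; [exists (qpt J 1); rewrite w01 | exists (qpt J 2); rewrite w02].
  - have [x0|x0] := eqVneq x 0; last by exists (qpt J 0); rewrite wtC w01.
    exists (qpt J 2); rewrite w12 oppr_eq0 x0 add0r.
    by move: xy; rewrite x0 eqxx.
  - have [y0|y0] := eqVneq y 0; last by exists (qpt J 0); rewrite wtC w02.
    exists (qpt J 1); rewrite wtC w12 oppr_eq0 y0 addr0.
    by move: xy; rewrite y0 eqxx orbF.
  - have [w32 w31] := w3 fi.
    by case/orP: xy => h; [exists (qpt J 2); rewrite w32 | exists (qpt J 1); rewrite w31].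
case=> j; apply: contraNT => iJ.
have [->|ij] := eqVneq i j; first by rewrite wt_diag.
have [->|fj] := eqVneq j ptoo; first by rewrite wt_oo.
have iN t : (t < 4)%N -> (qpt J t == i) = false.
  move=> t4; apply: contraNF iJ => /eqP <-; rewrite mem_quad !inE.
  by case: t t4 => [|[|[|[|]]]] // _; rewrite eqxx ?orbT.
by rewrite wt_comp // /same_pair !iN // !andbF !addr0 !mulr0 addr0 subr0.
Qed.

(** Distinct components meet only in 0. This gives their maximality, and keeps an isotropic space
    from spreading over several of them. *)
Lemma comp_inter J J' a : a \in res_comp K J -> a \in res_comp K J' -> a != 0 -> J = J'.
Proof.
move=> aJ aJ' nz.
have fin i : i != ptoo -> (i \in val J) = (i \in val J').
  move=> fi; apply/idP/idP.
    by move/(comp_support aJ nz fi)/(comp_support aJ' nz fi).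
  by move/(comp_support aJ' nz fi)/(comp_support aJ nz fi).
have E : val J :\ ptoo = val J' :\ ptoo.
  by apply/setP => i; rewrite !in_setD1; case: (i =P ptoo) => //= /eqP /fin.
apply: quad_eqP => i; have [->|/fin //] := eqVneq i ptoo.
have := cardsD1 ptoo (val J); rewrite card_quad E => e1.
have e2 := cardsD1 ptoo (val J'); rewrite card_quad in e2.
by move: (etrans (esym e1) e2) => /addIn; case: (_ \in _); case: (_ \in _).
Qed.

Lemma comp_free J : free [:: form1 K J; form2 K J].
Proof.
apply/(@freeP _ _ _ [tuple of [:: form1 K J; form2 K J]]) => c.
rewrite !big_ord_recl big_ord0 addr0 /= => E.
have [w01 w02 _ _] := wt_comp_pts J (c ord0) (c (lift ord0 ord0)).
have z0 i j : wt (0 : W) i j = 0 by apply: big1 => k _; rewrite ffunE mul0r.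
rewrite E !z0 in w01 w02; case=> [[|[|]]] // p.
  by rewrite [RHS]w01; congr c; apply: val_inj.
by rewrite [RHS]w02; congr c; apply: val_inj.
Qed.

Lemma dim_comp J : \dim (res_comp K J) = 2%N.
Proof. by have := comp_free J; rewrite /free => /eqP. Qed.

Lemma comp_inj : injective (@res_comp K n).
Proof.
move=> J J' E; apply: (@comp_inter J J' (form1 K J)).
- by apply: memv_span; rewrite inE eqxx.
- by rewrite -E; apply: memv_span; rewrite inE eqxx.
- by apply: contraTneq (comp_free J) => ->; rewrite free_cons mem0v.
Qed.

Lemma sum_hits i j : i != j ->
  \sum_(k : A0_index n) (hits k i j)%:R = ((i != ptoo) && (j != ptoo))%:R :> K.
Proof.
move=> ij; have [->|fi] := eqVneq i ptoo.
  by apply: big1 => k _; rewrite hitsC hits_oo.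
have [->|fj] := eqVneq j ptoo; first by apply: big1 => k _; rewrite hits_oo.
have [k0 Hk] : exists h : A0_index n, forall h' : A0_index n, hits h' i j = (h' == h).
  by apply: hits_ex; rewrite // -fin_oo.
rewrite (bigD1 k0) //= Hk eqxx big1 ?addr0 // => k /negbTE ne.
by rewrite Hk ne.
Qed.

Lemma comp_H1 J : (res_comp K J <= H1 K (A0_index n))%VS.
Proof.
have [n01 n02 n03 [n12 n13 n23]] := quad_ne J.
have [f0 f1 f2] : [/\ qpt J 0 != ptoo, qpt J 1 != ptoo & qpt J 2 != ptoo].
  by rewrite !qpt_fin.
apply/span_subvP => u; rewrite !inE => /orP[]/eqP ->; apply: mem_H1;
  rewrite /form1 /form2 /split1 /split2 /split3;
  under eq_bigr => k _ do rewrite !ffunE /=;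
  rewrite sumrB !big_split /= !sum_hits // f0 f1 f2 /=;
  by case: (qpt J 3 != ptoo); rewrite ?addr0 ?add0r subrr.
Qed.

End ComponentAlgebra.

(** * Components of the resonance variety and logarithmic forms of cross-ratios *)

Section CrossRatio.
Variables (K : numFieldType) (n : nat).
Local Notation W := {ffun A0_index n -> K^o}.
Local Notation h := (A0 K (n := n)).
Implicit Types (a b : W) (i j : 'I_n.+3) (J : quad n) (x : 'I_n.+1 -> K).

Lemma dlogM N (p q : {mpoly K[N]}) (x : 'I_N -> K) (i : 'I_N) : p.@[x] != 0 -> q.@[x] != 0 ->
  dlog (p * q) x i = dlog p x i + dlog q x i.
Proof.
by move=> p0 q0; rewrite /dlog mderivM mevalD !mevalM; field; rewrite p0 q0.
Qed.

Lemma dlogN N (p : {mpoly K[N]}) (x : 'I_N -> K) (i : 'I_N) : dlog (- p) x i = dlog p x i.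
Proof. by rewrite /dlog mderivN !mevalN invrN mulrNN. Qed.

Lemma dlogC N (c : K) (x : 'I_N -> K) (i : 'I_N) : dlog c%:MP x i = 0.
Proof. by rewrite /dlog mderivC meval0 mul0r. Qed.

Lemma log_form_is_linear N (J : finType) (g : J -> {mpoly K[N]})
    (c : K) (a b : {ffun J -> K^o}) (x : 'I_N -> K) (i : 'I_N) :
  log_form g (c *: a + b) x i = c * log_form g a x i + log_form g b x i.
Proof.
rewrite /log_form mulr_sumr -big_split; apply: eq_bigr => j _ /=.
by rewrite !ffunE /GRing.scale /=; ring.
Qed.

Lemma log_formD N (J : finType) (g : J -> {mpoly K[N]}) (a b : {ffun J -> K^o})
    (x : 'I_N -> K) (i : 'I_N) :
  log_form g (a + b) x i = log_form g a x i + log_form g b x i.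
Proof. by rewrite -[a]scale1r log_form_is_linear mul1r scale1r. Qed.

Lemma log_formB N (J : finType) (g : J -> {mpoly K[N]}) (a b : {ffun J -> K^o})
    (x : 'I_N -> K) (i : 'I_N) :
  log_form g (a - b) x i = log_form g a x i - log_form g b x i.
Proof. by rewrite addrC -scaleN1r log_form_is_linear mulN1r addrC. Qed.

Definition cminor i j : {mpoly K[n.+1]} := minor (cx K (n := n)) (cy K (n := n)) i j.

Lemma cminor_anti i j : cminor i j = - cminor j i.
Proof. by rewrite /cminor /minor opprB. Qed.

Lemma cminor_oo i : i != ptoo -> cminor i ptoo = (-1)%:MP.
Proof.
by rewrite fin_oo => fi; rewrite /cminor /minor (cy_fin K fi) /cx /cy !ptcaseE mulr0 sub0r mulr1
  mpolyCN mpolyC1.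
Qed.

Lemma cminor_cases i j : i != j ->
  [\/ (i == ptoo) || (j == ptoo), exists2 k, pair_of k = (i, j) & cminor i j = h k |
      exists2 k, pair_of k = (j, i) & cminor i j = - h k].
Proof.
move=> ij; have [|fi] := eqVneq i ptoo; first by constructor 1.
have [|fj] := eqVneq j ptoo; first by constructor 1.
rewrite fin_oo in fi; rewrite fin_oo in fj.
have [lt|lt|/val_inj E] := ltngtP i j; last by rewrite E eqxx in ij.
  by have [k e] := pair_of_onto lt fj; constructor 2; exists k; rewrite // A0E e.
by have [k e] := pair_of_onto lt fi; constructor 3; exists k; rewrite // A0E e cminor_anti.
Qed.

Lemma cminor_neq0 i j x : i != j -> in_compl h x -> (cminor i j).@[x] != 0.
Proof.
move=> ij cx; have [/orP oo|[k _ ->]|[k _ ->]] := cminor_cases ij.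
- have m0 : -1 != 0 :> K by rewrite oppr_eq0 oner_eq0.
  case: oo => /eqP e; subst.
    by rewrite cminor_anti cminor_oo; [rewrite mevalN mevalC oppr_eq0 | rewrite eq_sym].
  by rewrite cminor_oo // mevalC.
- exact: cx.
- by rewrite mevalN oppr_eq0; apply: cx.
Qed.

Lemma log_form_edge i j x m : i != j ->
  log_form h (edge K i j) x m = dlog (cminor i j) x m.
Proof.
move=> ij; rewrite /log_form.
have one k : (forall k', hits k' i j = (k' == k)) ->
  \sum_k' edge K i j k' * dlog (h k') x m = dlog (h k) x m.
  move=> H; rewrite (bigD1 k) //= ffunE H eqxx mul1r big1 ?addr0 // => k' /negbTE ne.
  by rewrite ffunE H ne mul0r.
have [/orP oo|[k e E]|[k e E]] := cminor_cases ij.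
- have -> : dlog (cminor i j) x m = 0.
    case: oo => /eqP e; subst; last by rewrite cminor_oo // dlogC.
    by rewrite cminor_anti dlogN cminor_oo; [rewrite dlogC | rewrite eq_sym].
  apply: big1 => k _; rewrite ffunE.
  by case: oo => /eqP ->; rewrite ?hits_oo 1?hitsC ?hits_oo mul0r.
- by rewrite E (one k) // => k'; rewrite -hitsE e.
- by rewrite E dlogN (one k) // => k'; rewrite hitsC -hitsE e.
Qed.

Definition crossP J := cminor (qpt J 0) (qpt J 1) * cminor (qpt J 2) (qpt J 3).
Definition crossQ J := cminor (qpt J 0) (qpt J 2) * cminor (qpt J 1) (qpt J 3).
Definition cross_map J := (crossP J, crossQ J).

Lemma plucker (T : comNzRingType) (u v : 'I_n.+3 -> T) p q r s :
  minor u v p q * minor u v r s - minor u v p r * minor u v q s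
  = - (minor u v p s * minor u v q r).
Proof. by rewrite /minor; ring. Qed.

Lemma crossPQ J :
  crossP J - crossQ J = - (cminor (qpt J 0) (qpt J 3) * cminor (qpt J 1) (qpt J 2)).
Proof. exact: plucker. Qed.

Lemma crossP_neq0 J x : in_compl h x -> (crossP J).@[x] != 0.
Proof.
by move=> cx; have [? ? ? [? ? ?]] := quad_ne J; rewrite mevalM mulf_neq0 ?cminor_neq0.
Qed.
Lemma crossQ_neq0 J x : in_compl h x -> (crossQ J).@[x] != 0.
Proof.
by move=> cx; have [? ? ? [? ? ?]] := quad_ne J; rewrite mevalM mulf_neq0 ?cminor_neq0.
Qed.
Lemma crossPQ_neq0 J x : in_compl h x -> (crossP J - crossQ J).@[x] != 0.
Proof.
move=> cx; have [? ? ? [? ? ?]] := quad_ne J.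
by rewrite crossPQ mevalN oppr_eq0 mevalM mulf_neq0 ?cminor_neq0.
Qed.

Lemma log_form_split1 J x m : in_compl h x ->
  log_form h (split1 K J) x m = dlog (crossP J) x m.
Proof.
move=> cx; have [? ? ? [? ? ?]] := quad_ne J.
by rewrite log_formD !log_form_edge // dlogM ?cminor_neq0.
Qed.
Lemma log_form_split2 J x m : in_compl h x ->
  log_form h (split2 K J) x m = dlog (crossQ J) x m.
Proof.
move=> cx; have [? ? ? [? ? ?]] := quad_ne J.
by rewrite log_formD !log_form_edge // dlogM ?cminor_neq0.
Qed.
Lemma log_form_split3 J x m : in_compl h x ->
  log_form h (split3 K J) x m = dlog (crossP J - crossQ J) x m.
Proof.
move=> cx; have [? ? ? [? ? ?]] := quad_ne J.
by rewrite log_formD !log_form_edge // crossPQ dlogN dlogM ?cminor_neq0.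
Qed.

Lemma log_form_comp J (s t : K) x m : in_compl h x ->
  log_form h (s *: form1 K J + t *: form2 K J) x m =
  s * dlog (crossP J) x m + t * dlog (crossQ J) x m
    - (s + t) * dlog (crossP J - crossQ J) x m.
Proof.
move=> cx; rewrite log_form_is_linear -[t *: _]addr0 log_form_is_linear.
rewrite /form1 /form2 !log_formB log_form_split1 // log_form_split2 // log_form_split3 //.
have -> : log_form h (0 : W) x m = 0 by apply: big1 => k _; rewrite ffunE mul0r.
ring.
Qed.

Lemma comp_isotropic J : isotropic h (res_comp K J).
Proof.
move=> _ _ /res_compP [s [t ->]] /res_compP [s' [t' ->]] x cx i j.
rewrite !log_form_comp // /dlog !mderivB !mevalB.
have p0 := crossP_neq0 J cx; have q0 := crossQ_neq0 J cx.
have r0 := crossPQ_neq0 J cx; rewrite mevalB in r0.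
move: p0 q0 r0; move: (crossP J).@[x] (crossQ J).@[x] => p q p0 q0 r0.
by field; rewrite p0 q0 r0.
Qed.

Lemma isotropic_pair a b : a \in H1 K (A0_index n) -> b \in H1 K (A0_index n) ->
  wedge0 a b -> (exists k k', a k * b k' - a k' * b k != 0) ->
  exists2 J, a \in res_comp K J & b \in res_comp K J.
Proof.
move=> /H1_sum0 a0 /H1_sum0 b0 ab [k [k' nz]].
have [p [q [r [m [u ca cb]]]]] : exists p q r m, [/\ uniq [:: p; q; r; m],
    carried_by (ewt a) p q r m & carried_by (ewt b) p q r m].
  apply: balanced_pair; try exact: ewt_balanced.
    by move=> i j i' j' u; apply: ewt_disjoint.
  exists (pair_of k).1, (pair_of k).2, (pair_of k').1, (pair_of k').2.
  by rewrite !ewt_pair.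
have [J memJ] := quad_ex u; exists J; exact: carried_comp memJ.
Qed.

(** Two independent vectors a, b of T lie in a common component. Any other vector of T is a multiple
    of a or shares a component with a, which is the same one by [comp_inter]. *)
Lemma subv_comp (T : {vspace W}) : (T <= H1 K (A0_index n))%VS -> isotropic h T ->
  (2 <= \dim T)%N -> exists J, (T <= res_comp K J)%VS.
Proof.
move=> TH isoT dT.
have [a [b [aT bT ab]]] : exists a b, [/\ a \in T, b \in T & free [:: a; b]].
  have mT v : v \in tval (vbasis T) -> v \in T by apply: vbasis_mem.
  move: (size_tuple (vbasis T)) (basis_free (vbasisP T)) mT.
  case: (tval (vbasis T)) => [|a [|b s]] /= sz fT mT; try by rewrite -sz in dT.
  exists a, b; split; [by rewrite mT ?inE ?eqxx | by rewrite mT ?inE ?eqxx ?orbT |].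
  exact: (@catl_free _ _ s [:: a; b]).
have wT u v : u \in T -> v \in T -> wedge0 u v by move=> uT vT; apply: isoT.
have dep (u v : W) : (forall k k', u k * v k' - u k' * v k = 0) -> u != 0 ->
    exists c : K, v = c *: u.
  move=> H u0; have [k uk] : exists k, u k != 0.
    apply/existsP; apply: contraNT u0; rewrite negb_exists => /forallP z.
    by apply/eqP/ffunP => k; rewrite ffunE; apply/eqP; move: (z k); rewrite negbK.
  exists (v k / u k); apply/ffunP => k'; rewrite ffunE; apply: (mulfI uk).
  have /eqP := H k k'; rewrite subr_eq0 => /eqP ->.
  by rewrite /GRing.scale /=; field.
have cases (u v : W) : u \in T -> v \in T -> u != 0 ->
    (exists c : K, v = c *: u) \/ exists2 J, u \in res_comp K J & v \in res_comp K J.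
  move=> uT vT u0; have [/existsP[k /existsP[k' nz]]|] :=
    boolP [exists k, exists k', u k * v k' - u k' * v k != 0].
    by right; apply: isotropic_pair;
      [exact: (subvP TH) | exact: (subvP TH) | exact: wT | exists k, k'].
  rewrite negb_exists => /forallP H; left; apply: dep => // k k'; apply/eqP.
  by have := H k; rewrite negb_exists => /forallP/(_ k'); rewrite negbK.
have a0 : a != 0 by apply: contraTneq ab => ->; rewrite free_cons mem0v.
have [[c e]|[J aJ bJ]] := cases a b aT bT a0.
  have : b \notin <<[:: a]>>%VS.
    have pm : perm_eq [:: a; b] [:: b; a] by apply/permPl/(perm_catC [:: a] [:: b]).
    by move: ab; rewrite (perm_free pm) free_cons => /andP[].
  by rewrite e memvZ // memv_span ?inE.
exists J; apply/subvP => v vT.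
have [[c ->]|[J' aJ' vJ']] := cases a v aT vT a0; first exact: memvZ.
by rewrite (comp_inter aJ aJ' a0).
Qed.

Lemma resonance_componentP (T : {vspace W}) :
  resonance_component h T <-> exists J, T = res_comp K J.
Proof.
split=> [[TH isoT dT maxT]|[J ->]].
  have [J TJ] := subv_comp TH isoT dT; exists J; apply/esym/maxT => //.
    exact: comp_H1.
  exact: comp_isotropic.
split; [exact: comp_H1 | exact: comp_isotropic | by rewrite dim_comp |].
move=> S' S'H isoS' sub; have [|J' S'J'] := subv_comp S'H isoS'.
  by apply: leq_trans (dimvS sub); rewrite dim_comp.
apply/eqP; rewrite eqEsubv sub andbT.
have f1 : form1 K J \in res_comp K J by apply: memv_span; rewrite inE eqxx.
rewrite (@comp_inter K n J J' (form1 K J)) //.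
  by apply/(subvP S'J')/(subvP sub).
by apply: contraTneq (comp_free K J) => ->; rewrite free_cons mem0v.
Qed.

End CrossRatio.

(** * Irreducibility of the fibres of the cross-ratios *)

Section ResonanceMap.
Variables (K : numFieldType) (n : nat).
Local Notation W := {ffun A0_index n -> K^o}.
Local Notation h := (A0 K (n := n)).
Implicit Types (i j : 'I_n.+3) (J : quad n) (x : 'I_n.+1 -> K).

Lemma affine_eval N (r : {mpoly K[N]}) (x : 'I_N -> K) : (msize r <= 2)%N ->
  r.@[x] = r@_0%MM + \sum_i r@_U_(i) * x i.
Proof.
move=> sz; rewrite {1}(mpoly_affine sz) mevalD mevalC raddf_sum /=.
by congr (_ + _); apply: eq_bigr => i _; rewrite mevalZ mevalXU.
Qed.

Lemma mconstant_msize N (r : {mpoly K[N]}) : (msize r <= 1)%N -> mconstant r.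
Proof. by move/msize1_polyC => ->; exists r@_0%MM. Qed.

(* A quadratic form with three nonzero off-diagonal coefficients and no squares
   is nondegenerate on a 3-space, so it is not a product of affine functions. *)
Lemma quadric_nonsplit (u v w r0 r1 r2 r3 s0 s1 s2 s3 : K) :
    u != 0 -> v != 0 -> w != 0 ->
    (forall x y z : K, (r0 + x * r1 + y * r2 + z * r3) * (s0 + x * s1 + y * s2 + z * s3)
       = u * (x * y) + v * (x * z) + w * (y * z)) -> False.
Proof.
move=> u0 v0 w0 H.
have two : 2%:R != 0 :> K by rewrite pnatr_eq0.
have e0 : r0 * s0 = 0 by move: (H 0 0 0); rewrite !mul0r !mulr0 !addr0.
(* Adding the values at opposite points removes the linear part of the product and leaves its
   quadratic part. *)
have sq a b : (r0 + a) * (s0 + b) = 0 -> (r0 - a) * (s0 - b) = 0 -> a * b = 0.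
  move=> h1 h2; apply: (mulfI two); rewrite mulr0.
  transitivity ((r0 + a) * (s0 + b) + (r0 - a) * (s0 - b) - 2%:R * (r0 * s0)); first by ring.
  by rewrite h1 h2 e0 mulr0 addr0 subr0.
have mix a b c d f : (r0 + (a + b)) * (s0 + (c + d)) = f ->
    (r0 - (a + b)) * (s0 - (c + d)) = f -> a * c = 0 -> b * d = 0 -> a * d + b * c = f.
  move=> h1 h2 h3 h4; apply: (mulfI two).
  transitivity ((r0 + (a + b)) * (s0 + (c + d)) + (r0 - (a + b)) * (s0 - (c + d))
     - 2%:R * (r0 * s0) - 2%:R * (a * c) - 2%:R * (b * d)); first by ring.
  by rewrite h1 h2 h3 h4 e0 !mulr0 !subr0; ring.
have q1 : r1 * s1 = 0.
  by apply: sq; [have := H 1 0 0 | have := H (-1) 0 0]; move=> E;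
    (etransitivity; [|etransitivity; [exact: E|]]); ring.
have q2 : r2 * s2 = 0.
  by apply: sq; [have := H 0 1 0 | have := H 0 (-1) 0]; move=> E;
    (etransitivity; [|etransitivity; [exact: E|]]); ring.
have q3 : r3 * s3 = 0.
  by apply: sq; [have := H 0 0 1 | have := H 0 0 (-1)]; move=> E;
    (etransitivity; [|etransitivity; [exact: E|]]); ring.
have m12 : r1 * s2 + r2 * s1 = u.
  by apply: mix => //; [have := H 1 1 0 | have := H (-1) (-1) 0]; move=> E;
    (etransitivity; [|etransitivity; [exact: E|]]); ring.
have m13 : r1 * s3 + r3 * s1 = v.
  by apply: mix => //; [have := H 1 0 1 | have := H (-1) 0 (-1)]; move=> E;
    (etransitivity; [|etransitivity; [exact: E|]]); ring.
have m23 : r2 * s3 + r3 * s2 = w.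
  by apply: mix => //; [have := H 0 1 1 | have := H 0 (-1) (-1)]; move=> E;
    (etransitivity; [|etransitivity; [exact: E|]]); ring.
have zero (a b : K) : a * b = 0 -> a = 0 \/ b = 0.
  by move=> /eqP; rewrite mulf_eq0 => /orP[]/eqP; [left|right].
(* For each index one of the two linear coefficients is 0. Two of the three indices lose theirs in
   the same factor, and the corresponding mixed coefficient vanishes. *)
case: (zero _ _ q1) => z1; case: (zero _ _ q2) => z2; case: (zero _ _ q3) => z3;
  rewrite ?z1 ?z2 ?z3 ?mulr0 ?mul0r ?addr0 ?add0r in m12 m13 m23;
  by move: u0 v0 w0; rewrite -?m12 -?m13 -?m23 ?eqxx.
Qed.

Lemma eval_cminor X i j : (i < n.+2)%N -> (j < n.+2)%N ->
  (cminor K i j).@[cone_pt X] = X i - X j.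
Proof.
move=> fi fj; rewrite /cminor /minor !cy_fin // !mulr1 mevalB !eval_cxB //.
by rewrite opprB addrA subrK.
Qed.

Lemma msize_cminor i j : (msize (cminor K i j) <= 2)%N.
Proof.
have sx (k : 'I_n.+3) : (msize (cx K k) <= 2)%N.
  by rewrite /cx; case: (ptP k) => [k'|||]; rewrite ptcaseE ?msizeX ?mdeg1 ?msize0 ?msize1.
have sy (k : 'I_n.+3) : exists c : K, cy K k = c%:MP.
  by rewrite /cy; case: (ptP k) => [k'|||]; rewrite ptcaseE;
    [exists 1 | exists 1 | exists 1 | exists 0]; rewrite ?mpolyC1 ?mpolyC0.
have sM (k l : 'I_n.+3) : (msize (cx K k * cy K l) <= 2)%N.
  have [c ->] := sy l; rewrite mulrC mul_mpolyC.
  exact: leq_trans (msizeZ_le _ _) (sx k).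
rewrite /cminor /minor (leq_trans (msizeD_le _ _)) // geq_max msizeN !sM //.
Qed.

(** The first three points of J vary and all others sit at 0: this restricts a member of the pencil
    to a 3-dimensional space. *)
Definition probe (J : quad n) (x y z : K) : 'I_n.+3 -> K := fun i =>
  x * (i == qpt J 0)%:R + y * (i == qpt J 1)%:R + z * (i == qpt J 2)%:R.

(** If J contains infinity, the member of the pencil is affine and not constant. Otherwise its
    restriction to [probe] is - l x y + x z + (l - 1) y z, which does not split; a factor that is
    not constant has to be affine, by degrees. *)
Lemma cross_irreducible J (l : K) : l != 0 -> l != 1 ->
  mirreducible (crossP K J - l *: crossQ K J).
Proof.
move=> l0 l1; set q := _ - _.
have [n01 n02 n03 [n12 n13 n23]] := quad_ne J.
have [m0 m1 m2] := quad_movable J.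
have f0 : (qpt J 0 < n.+2)%N by lia.
have f1 : (qpt J 1 < n.+2)%N by lia.
have F (p r : 'I_n.+3) : p != r -> ((p == r) = false) * ((r == p) = false).
  by move=> pr; split; last rewrite eq_sym; apply: negbTE.
have Fs := (F _ _ n01, F _ _ n02, F _ _ n03, F _ _ n12, F _ _ n13, F _ _ n23).
have p0 (x y z : K) : probe J x y z (qpt J 0) = x.
  by rewrite /probe eqxx !Fs !mulr0 mulr1 !addr0.
have p1 (x y z : K) : probe J x y z (qpt J 1) = y.
  by rewrite /probe eqxx !Fs !mulr0 mulr1 addr0 add0r.
have p2 (x y z : K) : probe J x y z (qpt J 2) = z.
  by rewrite /probe eqxx !Fs !mulr0 mulr1 !add0r.
have p3 (x y z : K) : probe J x y z (qpt J 3) = 0.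
  by rewrite /probe !Fs !mulr0 !addr0.
have nconst (x y : 'I_n.+1 -> K) : q.@[x] != q.@[y] -> ~ mconstant q.
  by move=> + [c e]; rewrite e !mevalC eqxx.
have split r s : q = r * s -> q != 0 -> (msize q <= 2)%N -> mconstant r \/ mconstant s.
  move=> e q0 sz; have r0 : r != 0 by apply: contraNneq q0 => z; rewrite e z mul0r.
  have s0 : s != 0 by apply: contraNneq q0 => z; rewrite e z mulr0.
  move: sz; rewrite e msizeM //.
  have [|r1] := leqP (msize r) 1; first by left; apply: mconstant_msize.
  have [|s1] := leqP (msize s) 1; first by right; apply: mconstant_msize.
  move=> sz; exfalso; move: r1 s1 sz; move: (msize r) (msize s) => A B.
  by clear; lia.
have nz_of_nconst : ~ mconstant q -> q != 0.
  by move=> nc; apply/eqP => z; apply: nc; exists 0; rewrite z mpolyC0.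
have [d_oo|d_fin] := eqVneq (qpt J 3) ptoo.
  have qE : q = l *: cminor K (qpt J 0) (qpt J 2) - cminor K (qpt J 0) (qpt J 1).
    rewrite /q /crossP /crossQ d_oo !cminor_oo -?d_oo // !mpolyCN !mpolyC1.
    by rewrite !mulrN1 scalerN opprK addrC.
  have ev (x y z : K) : q.@[cone_pt (probe J x y z)] = l * (x - z) - (x - y).
    by rewrite qE mevalB mevalZ !eval_cminor // p0 p1 p2.
  have nc : ~ mconstant q.
    apply: (nconst (cone_pt (probe J 0 0 0)) (cone_pt (probe J 0 1 0))).
    by rewrite !ev !subrr !mulr0 !sub0r opprK oppr0 eq_sym oner_eq0.
  split=> // r s e; apply: (split _ _ e); first exact: nz_of_nconst.
  rewrite qE (leq_trans (msizeD_le _ _)) // geq_max msizeN msize_cminor andbT.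
  exact: leq_trans (msizeZ_le _ _) (msize_cminor _ _).
have f3 : (qpt J 3 < n.+2)%N by rewrite -fin_oo.
have qE (x y z : K) : q.@[cone_pt (probe J x y z)] =
    - l * (x * y) + 1 * (x * z) + (l - 1) * (y * z).
  rewrite /q mevalB mevalZ /crossP /crossQ !mevalM !eval_cminor // p0 p1 p2 p3; ring.
have nc : ~ mconstant q.
  apply: (nconst (cone_pt (probe J 0 0 0)) (cone_pt (probe J 1 0 1))).
  rewrite !qE !(mul0r, mulr0, addr0, mulr1) add0r eq_sym oner_eq0 //.
have q0 := nz_of_nconst nc.
split=> // r s e.
have r0 : r != 0 by apply: contraNneq q0 => z; rewrite e z mul0r.
have s0 : s != 0 by apply: contraNneq q0 => z; rewrite e z mulr0.
have [|r1] := leqP (msize r) 1; first by left; apply: mconstant_msize.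
have [|s1] := leqP (msize s) 1; first by right; apply: mconstant_msize.
have szM (p p' : {mpoly K[n.+1]}) : (msize p <= 2)%N -> (msize p' <= 2)%N ->
    (msize (p * p') <= 3)%N.
  move=> sp sp'; have [->|pn] := eqVneq p 0; first by rewrite mul0r msize0.
  have [->|pn'] := eqVneq p' 0; first by rewrite mulr0 msize0.
  rewrite msizeM //; move: sp sp'; move: (msize p) (msize p') => A B.
  by clear; lia.
have sz : (msize q <= 3)%N.
  rewrite (leq_trans (msizeD_le _ _)) // geq_max msizeN szM ?msize_cminor //=.
  by rewrite (leq_trans (msizeZ_le _ _)) // szM ?msize_cminor.
have [rs ss] : (msize r <= 2)%N /\ (msize s <= 2)%N.
  move: sz r1 s1; rewrite e msizeM //; move: (msize r) (msize s) => A B.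
  by clear; lia.
exfalso; have ev (p : {mpoly K[n.+1]}) : (msize p <= 2)%N -> exists c0 c1 c2 c3, forall x y z : K,
    p.@[cone_pt (probe J x y z)] = c0 + x * c1 + y * c2 + z * c3.
  move=> sp; pose c (t : nat) : K := \sum_i p@_U_(i) *
     (((oapp (@ptv n) pt1 (unlift ord0 i)) == qpt J t)%:R - (pt0 == qpt J t)%:R).
  exists p@_0%MM, (c 0%N), (c 1%N), (c 2%N) => x y z.
  rewrite affine_eval // -!addrA; congr (_ + _).
  rewrite !mulr_sumr -!big_split /=; apply: eq_bigr => i _.
  by rewrite /cone_pt /probe; ring.
have [c0 [c1 [c2 [c3 cE]]]] := ev r rs; have [d0 [d1 [d2 [d3 dE]]]] := ev s ss.
apply: (@quadric_nonsplit (- l) 1 (l - 1) c0 c1 c2 c3 d0 d1 d2 d3).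
- by rewrite oppr_eq0.
- exact: oner_neq0.
- by rewrite subr_eq0.
by move=> x y z; rewrite -cE -dE -mevalM -e qE.
Qed.

(** A common factor r divides every member of the pencil. If r is not constant, irreducibility at l
    = 2 and l = 3 makes s - 2 t and s - 3 t constant, hence s and t; the member at l = s / t is then
    0, against irreducibility there. *)
Lemma cross_coprime J : mcoprime (crossP K J) (crossQ K J).
Proof.
move=> r s t eP eQ.
have e (l : K) : crossP K J - l *: crossQ K J = r * (s - l *: t).
  by rewrite eP eQ mulrBr scalerAr.
have irr (l : K) : l != 0 -> l != 1 -> mconstant r \/ mconstant (s - l *: t).
  by move=> l0 l1; have [_] := cross_irreducible J l0 l1; apply; exact: e.
have l2 : 2%:R != 0 :> K by rewrite pnatr_eq0.
have l21 : 2%:R != 1 :> K by rewrite (eqr_nat K 2 1).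
have l3 : 3%:R != 0 :> K by rewrite pnatr_eq0.
have l31 : 3%:R != 1 :> K by rewrite (eqr_nat K 3 1).
case: (irr _ l2 l21) => [//|[c2 e2]]; case: (irr _ l3 l31) => [//|[c3 e3]].
have et : t = (c2 - c3)%:MP.
  by rewrite mpolyCB -e2 -e3 !scaler_nat; ring.
have es : s = (c2 + 2%:R * (c2 - c3))%:MP.
  by rewrite mpolyCD -e2 mpolyCM -et mul_mpolyC subrK.
have cpl : in_compl h (cone_pt (fun i : 'I_n.+3 => (i : nat)%:R : K)).
  by apply: in_compl_cone => i j _ _ /eqP; rewrite eqr_nat val_eqE => /eqP.
have P0 := crossP_neq0 J cpl; have Q0 := crossQ_neq0 J cpl; have R0 := crossPQ_neq0 J cpl.
have crossP_nz : crossP K J != 0 by apply: contraNneq P0 => ->; rewrite meval0.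
have crossQ_nz : crossQ K J != 0 by apply: contraNneq Q0 => ->; rewrite meval0.
have crossR_nz : crossP K J - crossQ K J != 0 by apply: contraNneq R0 => ->; rewrite meval0.
set sg := c2 + _ in es; set tau := c2 - c3 in et.
have tau0 : tau != 0 by apply: contraNneq crossQ_nz => z; rewrite eQ et z mpolyC0 mulr0.
have sg0 : sg != 0 by apply: contraNneq crossP_nz => z; rewrite eP es z mpolyC0 mulr0.
have st : sg != tau.
  by apply: contraNneq crossR_nz => z; rewrite eP eQ es et z subrr.
have l0 : sg / tau != 0 by rewrite mulf_neq0 ?invr_eq0.
have l1 : sg / tau != 1.
  by apply: contra_neq st => /(congr1 ( *%R^~ tau)); rewrite divfK // mul1r.
have [nc _] := cross_irreducible J l0 l1; case: nc; exists 0.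
by rewrite e es et -mul_mpolyC -mpolyCM divfK // subrr mulr0 mpolyC0.
Qed.

Lemma cross_homog J : exists d : nat, crossP K J \is d.-homog /\ crossQ K J \is d.-homog.
Proof.
have hx k : k != ptoo -> cx K k \is 1.-homog.
  rewrite /cx; case: (ptP k) => [k'|||]; rewrite ptcaseE ?eqxx // => _;
    by rewrite ?rpred0 // dhomogX /= mdeg1.
have h1 i j : i != ptoo -> j != ptoo -> cminor K i j \is 1.-homog.
  move=> fi fj; rewrite /cminor /minor !cy_fin -?fin_oo // !mulr1.
  by rewrite rpredB ?hx.
have h0 i : i != ptoo -> cminor K i ptoo \is 0.-homog.
  by move=> fi; rewrite cminor_oo // mpolyCN mpolyC1 rpredN dhomog1.
have f t := @qpt_fin n J t.
have [d_oo|d_fin] := eqVneq (qpt J 3) ptoo.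
  by exists 1%N; rewrite /crossP /crossQ d_oo;
    split; apply: (@dhomogM _ _ _ 1 _ 0); rewrite ?h1 ?h0 ?f.
by exists 2%N; split; apply: (@dhomogM _ _ _ 1 _ 1); apply: h1;
  rewrite // ?d_fin // qpt_fin.
Qed.

Lemma cross_resonance_map J : resonance_map h (res_comp K J) (cross_map K J).
Proof.
rewrite /resonance_map dim_comp; split.
- by split; [exact: cross_homog | exact: cross_coprime].
- exists [:: 0; 1] => l; rewrite !inE negb_or => /andP[l0 l1].
  exact: cross_irreducible.
(* The points 0, infinity and 1 of P^1; infinity is written (-1 : 0) so that its equation pulls back
   to Q rather than to -Q. *)
pose u (k : 'I_3) : K := nth 0 [:: 0; -1; 1] k.
pose v (k : 'I_3) : K := nth 0 [:: 1; 0; 1] k.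
exists u, v; set g := fun k : 'I_3 => v k *: (cross_map K J).1 - u k *: (cross_map K J).2.
have g0 : g ord0 = crossP K J by rewrite /g /u /v /= scale1r scale0r subr0.
have g1 : g (lift ord0 ord0) = crossQ K J.
  by rewrite /g /u /v /= scaleN1r scale0r opprK add0r.
have g2 : g (lift ord0 (lift ord0 ord0)) = crossP K J - crossQ K J.
  by rewrite /g /u /v /= !scale1r.
have logg (b : {ffun 'I_3 -> K^o}) x m : log_form g b x m =
    b ord0 * dlog (crossP K J) x m + b (lift ord0 ord0) * dlog (crossQ K J) x m
    + b (lift ord0 (lift ord0 ord0)) * dlog (crossP K J - crossQ K J) x m.
  by rewrite /log_form !big_ord_recl big_ord0 addr0 addrA g0 g1 g2.
split.
- by case=> [[|[|[|]]] p] // [[|[|[|]]] p'] //= _; rewrite /u /v /=;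
    rewrite ?mul0r ?mulr0 ?mulr1 ?mul1r ?oppr_eq0 ?oner_eq0 // 1?eq_sym ?oppr_eq0 ?oner_eq0 //;
    rewrite -subr_eq0 -opprD oppr_eq0.
- move=> x cx; case=> [[|[|[|]]] p] //.
  + have -> : Ordinal p = ord0 by apply: val_inj.
    by rewrite g0 crossP_neq0.
  + have -> : Ordinal p = lift ord0 ord0 by apply: val_inj.
    by rewrite g1 crossQ_neq0.
  + have -> : Ordinal p = lift ord0 (lift ord0 ord0) by apply: val_inj.
    by rewrite g2 crossPQ_neq0.
- move=> b /H1_sum0; rewrite !big_ord_recl big_ord0 addr0 => b0.
  exists (b ord0 *: form1 K J + b (lift ord0 ord0) *: form2 K J).
    by apply/res_compP; exists (b ord0), (b (lift ord0 ord0)).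
  move=> x cx m; rewrite log_form_comp // logg.
  have -> : b (lift ord0 (lift ord0 ord0)) = - (b ord0 + b (lift ord0 ord0)) :> K.
    by apply/eqP; rewrite -addr_eq0 addrC -addrA b0.
  by ring.
- move=> _ /res_compP [s [t ->]].
  exists [ffun k : 'I_3 => nth 0 [:: s; t; - (s + t)] k : K^o].
    apply: mem_H1; rewrite !big_ord_recl big_ord0 addr0 !ffunE /=.
    by rewrite addrA subrr.
  move=> x cx m; rewrite log_form_comp // logg !ffunE /=; ring.
Qed.

End ResonanceMap.

(** * The cross-ratio web at a generic point *)

Section Local.
Variables (K : numFieldType) (n : nat) (p : 'I_n -> K).
Implicit Types (J : quad n).

Definition lx : 'I_n.+3 -> {mpoly K[n]} := ptcase (fun i : 'I_n => 'X_i + (p i)%:MP) 1 0 1.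
Definition ly : 'I_n.+3 -> {mpoly K[n]} := ptcase (fun=> 1) 1 1 0.
Definition px : 'I_n.+3 -> K := ptcase p 1 0 1.
Definition py : 'I_n.+3 -> K := ptcase (fun=> 1) 1 1 0.

Definition chart_pt : 'I_n.+1 -> K := fun m => oapp p 1 (unlift ord0 m).

Definition lminor i j := minor lx ly i j.
Definition pminor i j := minor px py i j.

Lemma localize_cx i : localize p (cx K i) = lx i.
Proof.
rewrite /localize /cx /lx; case: (ptP i) => [k|||]; rewrite !ptcaseE.
- by rewrite comp_mpolyXU -tnth_nth tnth_mktuple liftK.
- by rewrite comp_mpolyXU -tnth_nth tnth_mktuple unlift_none.
- by rewrite comp_mpoly0.
- by rewrite comp_mpoly1.
Qed.

Lemma localize_cy i : localize p (cy K i) = ly i.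
Proof.
by rewrite /localize /cy /ly; case: (ptP i) => [k|||]; rewrite !ptcaseE
  ?comp_mpoly1 ?comp_mpoly0.
Qed.

Lemma localizeM (P Q : {mpoly K[n.+1]}) :
  localize p (P * Q) = localize p P * localize p Q.
Proof. exact: rmorphM. Qed.
Lemma localizeB (P Q : {mpoly K[n.+1]}) :
  localize p (P - Q) = localize p P - localize p Q.
Proof. exact: rmorphB. Qed.

Lemma localize_cminor i j : localize p (cminor K i j) = lminor i j.
Proof. by rewrite /cminor /minor localizeB !localizeM !localize_cx !localize_cy. Qed.

Lemma lx0 i : (lx i)@_0%MM = px i.
Proof.
rewrite /lx /px; case: (ptP i) => [k|||]; rewrite !ptcaseE ?mcoeff1 ?eqxx ?mcoeff0 //.
by rewrite mcoeffD mcoeffX mnm1_eq0 add0r mcoeffC eqxx mulr1.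
Qed.
Lemma lyE i : ly i = (py i)%:MP.
Proof. by rewrite /ly /py; case: (ptP i) => [k|||]; rewrite !ptcaseE ?mpolyC1 ?mpolyC0. Qed.

Lemma coef0M (P Q : {mpoly K[n]}) : (P * Q)@_0%MM = P@_0%MM * Q@_0%MM.
Proof. exact: rmorphM. Qed.

Lemma lminor0 i j : (lminor i j)@_0%MM = pminor i j.
Proof. by rewrite /lminor /pminor /minor mcoeffB !coef0M !lx0 !lyE !mcoeffC eqxx !mulr1. Qed.

Lemma lminor_anti i j : lminor i j = - lminor j i. Proof. by rewrite /lminor /minor opprB. Qed.

Lemma msize_lminor i j : (msize (lminor i j) <= 2)%N.
Proof.
have sx k : (msize (lx k) <= 2)%N.
  rewrite /lx; case: (ptP k) => [k'|||]; rewrite ptcaseE ?msize0 ?msize1 //.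
  rewrite (leq_trans (msizeD_le _ _)) // geq_max msizeX mdeg1 /=.
  by rewrite mmeasureC; case: (_ == 0).
have sM k l : (msize (lx k * ly l) <= 2)%N.
  by rewrite lyE mulrC mul_mpolyC; apply: leq_trans (msizeZ_le _ _) (sx k).
by rewrite /lminor /minor (leq_trans (msizeD_le _ _)) // geq_max msizeN !sM.
Qed.

Lemma eval_cminor_chart i j : (cminor K i j).@[chart_pt] = pminor i j.
Proof.
have ex k : (cx K k).@[chart_pt] = px k.
  rewrite /cx /px /chart_pt; case: (ptP k) => [k'|||]; rewrite !ptcaseE ?meval0 ?meval1 //.
  - by rewrite mevalXU liftK.
  - by rewrite mevalXU unlift_none.
have ey k : (cy K k).@[chart_pt] = py k.
  by rewrite /cy /py; case: (ptP k) => [k'|||]; rewrite !ptcaseE ?meval0 ?meval1.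
by rewrite /cminor /minor mevalB !mevalM !ex !ey.
Qed.

Hypothesis gen : in_compl (A0 K (n := n)) chart_pt.

Lemma pminor_neq0 i j : i != j -> pminor i j != 0.
Proof. by move=> ij; rewrite -eval_cminor_chart cminor_neq0. Qed.

Definition locP J := lminor (qpt J 0) (qpt J 1) * lminor (qpt J 2) (qpt J 3).
Definition locQ J := lminor (qpt J 0) (qpt J 2) * lminor (qpt J 1) (qpt J 3).

Definition omega J : form_germ K n := fun i =>
  of_mpoly (locQ J * (locP J)^`M(i) - locP J * (locQ J)^`M(i)).

Lemma level_form_cross J : level_form (cross_map K J) p = omega J.
Proof.
rewrite /level_form /omega /locP /locQ /= /crossP /crossQ.
by rewrite !localizeM !localize_cminor.
Qed.

Definition pairing (w v : 'I_n -> K) : K := \sum_i v i * w i.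

(* Tangent vectors to the n+3 points moving one at a time; moving 0, 1 or
   infinity is compensated by an infinitesimal Moebius transformation. *)
Definition mvec j : 'I_n -> K :=
  ptcase (fun (k : 'I_n) (i : 'I_n) => (i == k)%:R) p (fun i : 'I_n => p i - 1)
    (fun i : 'I_n => p i * (p i - 1)) j.

Definition extend (v : 'I_n -> K) : 'I_n.+3 -> K := ptcase v 0 0 0.

(** Up to a quadratic vector field, that is, an infinitesimal Moebius transformation, [mvec j] moves
    the point j alone. The homogeneous form makes the identity meaningful at infinity too, where px
    = 1 and py = 0. *)
Lemma mvec_quadratic j : exists a b c e : K, e != 0 /\ forall i,
  extend (mvec j) i * py i = a * (px i * px i) + b * (px i * py i) + c * (py i * py i)
    + e * (i == j)%:R.
Proof.
have m1 : -1 != 0 :> K by rewrite oppr_eq0 oner_eq0.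
case: (ptP j) => [k|||]; rewrite /mvec !ptcaseE.
- exists 0, 0, 0, 1; split=> [|i]; first exact: oner_neq0.
  rewrite !mul0r !add0r mul1r /extend /py.
  by case: (ptP i) => [i'|||]; rewrite !ptcaseE ?pt_eqE ?mul0r ?mulr1.
- exists 0, 1, 0, (-1); split=> // i; rewrite /extend /py /px.
  by case: (ptP i) => [i'|||]; rewrite !ptcaseE ?pt_eqE ?eqxx /=; ring.
- exists 0, 1, (-1), 1; split=> [|i]; first exact: oner_neq0.
  rewrite /extend /py /px.
  by case: (ptP i) => [i'|||]; rewrite !ptcaseE ?pt_eqE ?eqxx /=; ring.
- exists 1, (-1), 0, (-1); split=> // i; rewrite /extend /py /px.
  by case: (ptP i) => [i'|||]; rewrite !ptcaseE ?pt_eqE ?eqxx /=; ring.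
Qed.

Definition dir0 (v : 'I_n -> K) (P : {mpoly K[n]}) : K := \sum_i v i * (P^`M(i))@_0%MM.

Lemma dir0M v P Q : dir0 v (P * Q) = dir0 v P * Q@_0%MM + P@_0%MM * dir0 v Q.
Proof.
rewrite /dir0 mulr_suml mulr_sumr -big_split; apply: eq_bigr => i _ /=.
rewrite mderivM mcoeffD !coef0M; ring.
Qed.

Lemma dir0_lminor v i j : dir0 v (lminor i j) = extend v i * py j - extend v j * py i.
Proof.
have dx k : dir0 v (lx k) = extend v k.
  rewrite /dir0 /lx /extend; case: (ptP k) => [k'|||]; rewrite !ptcaseE.
  - rewrite (bigD1 k') //= mderivD mderivC addr0 mderivXU eqxx mcoeffC eqxx !mulr1.
    rewrite big1 ?addr0 // => l /negbTE lk.
    by rewrite mderivD mderivC addr0 mderivXU lk mpolyC0 mcoeff0 mulr0.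
  - by apply: big1 => l _; rewrite -mpolyC1 mderivC mcoeff0 mulr0.
  - by apply: big1 => l _; rewrite mderiv0 mcoeff0 mulr0.
  - by apply: big1 => l _; rewrite -mpolyC1 mderivC mcoeff0 mulr0.
have dy k : dir0 v (ly k) = 0.
  by rewrite lyE; apply: big1 => l _; rewrite mderivC mcoeff0 mulr0.
have dB P Q : dir0 v (P - Q) = dir0 v P - dir0 v Q.
  rewrite /dir0 -sumrB; apply: eq_bigr => l _.
  by rewrite mderivB mcoeffB mulrBr.
rewrite /lminor /minor dB !dir0M !dx !dy !mulr0 !addr0 !lyE !mcoeffC eqxx !mulr1 //.
Qed.

Definition omega0 J : 'I_n -> K := form_at0 (omega J).

Lemma pair_omega0 J v : pairing (omega0 J) v =
  (locQ J)@_0%MM * dir0 v (locP J) - (locP J)@_0%MM * dir0 v (locQ J).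
Proof.
rewrite /pairing /dir0 !mulr_sumr -sumrB; apply: eq_bigr => i _.
rewrite /omega0 /form_at0 /omega /of_mpoly mcoeffB !coef0M; ring.
Qed.

(** The pairing is linear in the velocities of the points of J. The quadratic part of [mvec j]
    cancels by Moebius invariance; there remains, for j in J, up to sign e times the product of the
    three minors of the other points of J. *)
Lemma pair_mvec J j : (pairing (omega0 J) (mvec j) == 0) = (j \notin val J).
Proof.
have [a [b [c [e [e0 E]]]]] := mvec_quadratic j.
rewrite pair_omega0 /locP /locQ !dir0M !dir0_lminor !coef0M !lminor0.
have [n01 n02 n03 [n12 n13 n23]] := quad_ne J.
have d01 := pminor_neq0 n01; have d02 := pminor_neq0 n02; have d03 := pminor_neq0 n03.
have d12 := pminor_neq0 n12; have d13 := pminor_neq0 n13; have d23 := pminor_neq0 n23.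
set ev := extend (mvec j).
have E0 := E (qpt J 0); have E1 := E (qpt J 1).
have E2 := E (qpt J 2); have E3 := E (qpt J 3).
have : (j \in val J) = [|| qpt J 0 == j, qpt J 1 == j, qpt J 2 == j | qpt J 3 == j].
  by rewrite mem_quad !inE !(eq_sym j).
have Fs (x y : 'I_n.+3) : x != y -> x == j -> (y == j) = false.
  by move=> xy /eqP xj; apply/negbTE; rewrite -xj eq_sym.
have -> : pminor (qpt J 0) (qpt J 2) * pminor (qpt J 1) (qpt J 3) *
   ((ev (qpt J 0) * py (qpt J 1) - ev (qpt J 1) * py (qpt J 0)) * pminor (qpt J 2) (qpt J 3) +
    pminor (qpt J 0) (qpt J 1) * (ev (qpt J 2) * py (qpt J 3) - ev (qpt J 3) * py (qpt J 2))) -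
   pminor (qpt J 0) (qpt J 1) * pminor (qpt J 2) (qpt J 3) *
   ((ev (qpt J 0) * py (qpt J 2) - ev (qpt J 2) * py (qpt J 0)) * pminor (qpt J 1) (qpt J 3) +
    pminor (qpt J 0) (qpt J 2) * (ev (qpt J 1) * py (qpt J 3) - ev (qpt J 3) * py (qpt J 1))) =
   (ev (qpt J 0) * py (qpt J 0)) *
     (pminor (qpt J 1) (qpt J 2) * pminor (qpt J 1) (qpt J 3) * pminor (qpt J 2) (qpt J 3))
   - (ev (qpt J 1) * py (qpt J 1)) *
     (pminor (qpt J 0) (qpt J 2) * pminor (qpt J 0) (qpt J 3) * pminor (qpt J 2) (qpt J 3))
   + (ev (qpt J 2) * py (qpt J 2)) *
     (pminor (qpt J 0) (qpt J 1) * pminor (qpt J 0) (qpt J 3) * pminor (qpt J 1) (qpt J 3))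
   - (ev (qpt J 3) * py (qpt J 3)) *
     (pminor (qpt J 0) (qpt J 1) * pminor (qpt J 0) (qpt J 2) * pminor (qpt J 1) (qpt J 2)).
  by rewrite /pminor /minor; ring.
rewrite E0 E1 E2 E3.
have -> (x0 x1 x2 x3 : K)
    (q := fun t => a * (px t * px t) + b * (px t * py t) + c * (py t * py t)) :
  (q (qpt J 0) + e * x0) *
     (pminor (qpt J 1) (qpt J 2) * pminor (qpt J 1) (qpt J 3) * pminor (qpt J 2) (qpt J 3))
   - (q (qpt J 1) + e * x1) *
     (pminor (qpt J 0) (qpt J 2) * pminor (qpt J 0) (qpt J 3) * pminor (qpt J 2) (qpt J 3))
   + (q (qpt J 2) + e * x2) *
     (pminor (qpt J 0) (qpt J 1) * pminor (qpt J 0) (qpt J 3) * pminor (qpt J 1) (qpt J 3))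
   - (q (qpt J 3) + e * x3) *
     (pminor (qpt J 0) (qpt J 1) * pminor (qpt J 0) (qpt J 2) * pminor (qpt J 1) (qpt J 2)) =
  e * (x0 * (pminor (qpt J 1) (qpt J 2) * pminor (qpt J 1) (qpt J 3) * pminor (qpt J 2) (qpt J 3))
   - x1 * (pminor (qpt J 0) (qpt J 2) * pminor (qpt J 0) (qpt J 3) * pminor (qpt J 2) (qpt J 3))
   + x2 * (pminor (qpt J 0) (qpt J 1) * pminor (qpt J 0) (qpt J 3) * pminor (qpt J 1) (qpt J 3))
   - x3 * (pminor (qpt J 0) (qpt J 1) * pminor (qpt J 0) (qpt J 2) * pminor (qpt J 1) (qpt J 2))).
  by rewrite /q /pminor /minor; ring.
move=> ->; rewrite mulf_eq0 (negbTE e0) /=.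
have [h0|h0] := boolP (qpt J 0 == j).
  rewrite (Fs _ _ n01 h0) (Fs _ _ n02 h0) (Fs _ _ n03 h0) !mul0r !subr0 addr0 mul1r.
  by rewrite !mulf_eq0 (negbTE d12) (negbTE d13) (negbTE d23).
have [h1|h1] := boolP (qpt J 1 == j).
  rewrite (Fs _ _ n12 h1) (Fs _ _ n13 h1) !mul0r subr0 addr0 mul1r sub0r oppr_eq0.
  by rewrite !mulf_eq0 (negbTE d02) (negbTE d03) (negbTE d23).
have [h2|h2] := boolP (qpt J 2 == j).
  rewrite (Fs _ _ n23 h2) !mul0r !subr0 add0r mul1r.
  by rewrite !mulf_eq0 (negbTE d01) (negbTE d03) (negbTE d13).
have [h3|h3] := boolP (qpt J 3 == j).
  rewrite !mul0r subr0 add0r mul1r sub0r oppr_eq0.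
  by rewrite !mulf_eq0 (negbTE d01) (negbTE d02) (negbTE d12).
by rewrite !mul0r !subr0 addr0 eqxx.
Qed.

End Local.

Section WebGerm.
Variables (K : numFieldType) (n : nat) (p : 'I_n -> K).
Hypothesis gen : in_compl (A0 K (n := n)) (chart_pt p).
Implicit Types (J : quad n).

Lemma omega_holo J : form_holo (omega p J).
Proof. by move=> i; apply: conv_mpoly. Qed.

Lemma omega_integrable J : form_integrable (omega p J).
Proof.
move=> i j k m; set w : 'I_n -> series K n := omega p J.
change ((w i * (sderiv j (w k) - sderiv k (w j)) + w j * (sderiv k (w i) - sderiv i (w k))
   + w k * (sderiv i (w j) - sderiv j (w i))) m = 0).
rewrite /w /omega; move: (locP p J) (locQ p J) => P Q.
rewrite !sderiv_mpoly -!of_mpolyB -!of_mpolyM -!of_mpolyD !mderivB !mderivM.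
rewrite (mderiv_comm k j P) (mderiv_comm k j Q) (mderiv_comm k i P) (mderiv_comm k i Q).
rewrite (mderiv_comm j i P) (mderiv_comm j i Q).
rewrite [X in of_mpoly X](_ : _ = 0) ?of_mpoly0 //; ring.
Qed.

Lemma omega_nonzero J : exists v, pairing (omega0 p J) v != 0.
Proof.
exists (mvec p (qpt J 0)).
by rewrite (pair_mvec gen) negbK mem_quad inE eqxx.
Qed.

Lemma quad_neq J J' : J != J' -> exists2 j, j \in val J & j \notin val J'.
Proof.
move=> ne; apply/subsetPn; apply: contra ne => sub.
by rewrite -val_eqE eqEcard sub !card_quad.
Qed.

(** Two distinct 4-subsets each contain a point that the other lacks; on the two corresponding
    tangent vectors the pair of covectors has a diagonal matrix with nonzero entries. *)
Lemma cross_web_germ k (J : 'I_k -> quad n) : injective J ->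
  web_germ (fun a => omega p (J a)).
Proof.
move=> injJ; split.
- by move=> a; split; [apply: omega_holo | apply: omega_integrable].
- move=> a; have [v] := omega_nonzero (J a) => nz.
  apply/existsP; apply: contraNT nz; rewrite negb_exists => /forallP z.
  by apply/eqP/big1 => i _; have := z i; rewrite negbK => /eqP e; rewrite /omega0 e mulr0.
move=> a b ab W; have ne : J a != J b by apply: contra_neq ab => /injJ.
have ne' : J b != J a by rewrite eq_sym.
have [j ja jb] := quad_neq ne; have [i ib ia] := quad_neq ne'.
have : pairing (omega0 p (J a)) (mvec p j) * pairing (omega0 p (J b)) (mvec p i) =
       pairing (omega0 p (J a)) (mvec p i) * pairing (omega0 p (J b)) (mvec p j).
  rewrite /pairing !big_distrlr /= exchange_big /=.
  apply: eq_bigr => l _; apply: eq_bigr => l' _.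
  have e : omega0 p (J a) l' * omega0 p (J b) l = omega0 p (J a) l * omega0 p (J b) l'.
    exact: W.
  transitivity (mvec p j l' * mvec p i l * (omega0 p (J a) l' * omega0 p (J b) l)); first by ring.
  by rewrite e; ring.
have := pair_mvec gen (J a) i; rewrite ia => /eqP ->.
have := pair_mvec gen (J a) j; have := pair_mvec gen (J b) i; rewrite ja ib.
move: (pairing _ _) (pairing _ _) (pairing _ _) => x y z /negbT x0 /negbT y0.
by rewrite mul0r => /eqP; rewrite mulf_eq0 (negbTE x0) (negbTE y0).
Qed.

End WebGerm.

(** * Leading parts of closed forms proportional to a given form *)

Section Orders.
Variables (K : numFieldType) (n : nat).
Implicit Types (a b g : series K n) (u v : 'I_n -> K) (eta : 'I_n -> series K n).

Definition vanish m a : Prop := forall M, (mdeg M < m)%N -> a M = 0.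

Definition dirder v a : series K n := \sum_i cst (v i) * sderiv i a.
Definition contract v eta : series K n := \sum_i cst (v i) * eta i.

Lemma vanish0 a : vanish 0 a. Proof. by []. Qed.
Lemma vanish_le m m' a : (m' <= m)%N -> vanish m a -> vanish m' a.
Proof. by move=> le va M lt; apply: va; apply: leq_trans le. Qed.
Lemma vanishD m a b : vanish m a -> vanish m b -> vanish m (a + b).
Proof. by move=> va vb M lt; rewrite serDE va ?vb ?addr0. Qed.
Lemma vanishZ m c a : vanish m a -> vanish m (cst c * a).
Proof. by move=> va M lt; rewrite cstME va ?mulr0. Qed.
Lemma vanish_zero m : vanish m (0 : series K n). Proof. by []. Qed.
Lemma vanish_sum m (I : Type) (r : seq I) (P : pred I) (F : I -> series K n) :
  (forall i, P i -> vanish m (F i)) -> vanish m (\sum_(i <- r | P i) F i).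
Proof. by apply: big_ind; [exact: vanish_zero | move=> *; apply: vanishD]. Qed.

Lemma vanish_sderiv m i a : vanish m a -> vanish m.-1 (sderiv i a).
Proof.
case: m => [|m] va M lt //; rewrite sderivE va ?mul0rn //.
by rewrite mdegD mdeg1 addn1 ltnS.
Qed.

Lemma vanish_dirder m v a : vanish m a -> vanish m.-1 (dirder v a).
Proof. by move=> va; apply: vanish_sum => i _; apply: vanishZ; apply: vanish_sderiv. Qed.

Lemma vanish_contract m v eta : (forall i, vanish m (eta i)) -> vanish m (contract v eta).
Proof. by move=> ve; apply: vanish_sum => i _; apply: vanishZ. Qed.

Lemma vanish_mul_coef m a b M : vanish m a -> (mdeg M <= m)%N ->
  (a * b) M = a M * b 0%MM.
Proof.
move=> va le; rewrite serME /ps_mul.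
have lM : (mdeg M < (mdeg M).+1)%N by [].
have l0 : (mdeg (0%MM : 'X_{1..n}) < (mdeg M).+1)%N by rewrite mdeg0.
rewrite (bigD1 (BMultinom lM, BMultinom l0)) /=; last by rewrite addm0.
rewrite big1 ?addr0 // => -[k1 k2] /andP[/eqP /= em ne].
rewrite va ?mul0r //; apply: leq_trans le.
have dM : mdeg M = (mdeg k1 + mdeg k2)%N by rewrite -mdegD; congr mdeg.
rewrite [X in (_ < X)%N]dM -[X in (X < _)%N]addn0 ltn_add2l lt0n mdeg_eq0.
apply: contraNneq ne => k20.
have e1 : k1 = BMultinom lM :> 'X_{1..n} by move: em; rewrite k20 addm0.
by apply/eqP; congr (_, _); apply: val_inj.
Qed.

Lemma dirderC u v a : dirder u (dirder v a) = dirder v (dirder u a).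
Proof.
rewrite /dirder.
under eq_bigr => i _ do rewrite sderiv_sum mulr_sumr.
under [RHS]eq_bigr => i _ do rewrite sderiv_sum mulr_sumr.
rewrite exchange_big; apply: eq_bigr => i _; apply: eq_bigr => j _.
by rewrite !sderiv_cstM sderivC; ring.
Qed.

Lemma dirder_sum v (I : Type) (r : seq I) (F : I -> series K n) :
  dirder v (\sum_(i <- r) F i) = \sum_(i <- r) dirder v (F i).
Proof.
rewrite /dirder exchange_big; apply: eq_bigr => i _.
by rewrite sderiv_sum mulr_sumr.
Qed.

Definition dirders (vs : seq ('I_n -> K)) a := foldl (fun b v => dirder v b) a vs.

Lemma dirders_sum vs (I : Type) (r : seq I) (F : I -> series K n) :
  dirders vs (\sum_(i <- r) F i) = \sum_(i <- r) dirders vs (F i).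
Proof.
elim: vs F => [|v vs IH] F //=; rewrite dirder_sum IH //.
Qed.

Lemma vanish_dirders m vs a : vanish m a -> vanish (m - size vs) (dirders vs a).
Proof.
elim: vs m a => [|v vs IH] m a va /=; first by rewrite subn0.
by rewrite subnS -subn1 subnAC subn1; apply/IH/vanish_dirder.
Qed.

Lemma vanish_of_sderiv m a : vanish 1 a -> (forall i, vanish m (sderiv i a)) ->
  vanish m.+1 a.
Proof.
move=> v1 vd M lt; have [->|M0] := eqVneq M 0%MM; first by rewrite v1 ?mdeg0.
have [i Mi] : exists i, (0 < M i)%N.
  apply/existsP; apply: contraNT M0; rewrite negb_exists => /forallP z.
  by apply/eqP/mnmP => i; rewrite mnm0E; apply/eqP; rewrite -leqn0 leqNgt z.
have em : M = (M - U_(i) + U_(i))%MM.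
  by rewrite submK //; apply/mnm_lepP => j; rewrite mnm1E; case: eqP => // <-.
have := vd i (M - U_(i))%MM; rewrite sderivE -em => H.
have /eqP : a M *+ ((M - U_(i))%MM i).+1 = 0.
  by apply: H; move: lt; rewrite {1}em mdegD mdeg1 addn1 ltnS.
by rewrite mulrn_eq0 => /eqP.
Qed.

(* A function whose lowest order part is a power of the linear form l. *)
Section Power.
Variable l : 'I_n -> K.

(** A homogeneous polynomial of degree m is a multiple of l^m, for l nonzero, when the derivations
    along ker l kill it; in this form the property passes to derivatives. *)
Definition power_like m g : Prop := vanish m g /\
  forall u, pairing l u = 0 -> vanish m (dirder u g).

Lemma power_like_dirder m v g : power_like m g -> power_like m.-1 (dirder v g).
Proof.
move=> [vg H]; split; first exact: vanish_dirder.
by move=> u lu; rewrite dirderC; apply/vanish_dirder/H.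
Qed.

Lemma power_like_killed m vs g : power_like m g ->
  (exists2 v, v \in [seq pairing l v | v <- vs] & v == 0) ->
  vanish (m.+1 - size vs) (dirders vs g).
Proof.
elim: vs m g => [|v vs IH] m g pg; first by case=> ?; rewrite in_nil.
case=> x; rewrite /= inE => /orP[/eqP -> /eqP lv|xin x0].
  by rewrite subSS; apply: vanish_dirders; case: pg => _; apply.
case: m pg => [|m] pg; first by rewrite subSS sub0n; apply: vanish0.
by rewrite subSS; apply: IH; [exact: power_like_dirder pg | exists x].
Qed.

(** At most m derivations of l^m along directions transverse to l give a nonzero multiple of a power
    of l, so they detect the leading coefficient of g. *)
Lemma power_like_vanish m vs g : power_like m g -> (size vs <= m)%N ->
  all (fun v => pairing l v != 0) vs ->
  vanish (m.+1 - size vs) (dirders vs g) -> vanish m.+1 g.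
Proof.
elim: vs m g => [|v vs IH] m g pg; first by rewrite subn0.
case: m pg => // m pg le /= /andP[lv lvs]; rewrite subSS => V.
have vd : vanish m.+1 (dirder v g).
  by apply: IH V => //; apply: power_like_dirder pg.
case: pg => vg H; apply: vanish_of_sderiv; first exact: vanish_le vg.
(* The i-th coordinate vector is split as u + c v with u in ker l. *)
move=> i; pose c := l i / pairing l v.
pose u k := (k == i)%:R - c * v k.
have lu : pairing l u = 0.
  rewrite /pairing /u; under eq_bigr => k _ do rewrite mulrBl -mulrA.
  rewrite sumrB -mulr_sumr (bigD1 i) //= eqxx mul1r big1 ?addr0.
    by rewrite -/(pairing l v) /c divfK // subrr.
  by move=> k /negbTE ->; rewrite mul0r.
have -> : sderiv i g = dirder u g + cst c * dirder v g.
  rewrite /dirder mulr_sumr -big_split /= (bigD1 i) //= big1 ?addr0.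
    by rewrite /u eqxx cstD cstN cstM cst1; ring.
  by move=> k /negbTE ne; rewrite /u ne cstD cstN cstM cst0; ring.
by apply: vanishD; [apply: H | apply: vanishZ].
Qed.

End Power.

Section ClosedForm.
Variables (eta : 'I_n -> series K n) (w : 'I_n -> series K n) (m : nat).
Hypothesis closed : forall i j, sderiv i (eta j) = sderiv j (eta i).
Hypothesis wedge : forall i j, eta i * w j = eta j * w i.
Hypothesis van : forall i, vanish m (eta i).
Let l i := w i 0%MM.
Hypothesis l_neq0 : exists v, pairing l v != 0.

(** In degree m only the constant term l of w enters the wedge condition, so the leading part of eta
    is a function times the constant covector l. *)
Lemma contract_proportional u v :
  vanish m.+1 (cst (pairing l v) * contract u eta - cst (pairing l u) * contract v eta).
Proof.
have H i j : vanish m.+1 (cst (l j) * eta i - cst (l i) * eta j).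
  move=> M lt; rewrite serBE !cstME ![l _ * _]mulrC.
  by rewrite -!(@vanish_mul_coef m) // wedge subrr.
rewrite /pairing /contract.
have cs x : cst (\sum_i x i) = \sum_i cst (x i) :> series K n.
  by apply: (big_morph (fun y => cst y : series K n)); [exact: cstD | exact: cst0].
rewrite !cs !big_distrlr /= [X in _ - X]exchange_big /= -sumrB.
apply: vanish_sum => i _; rewrite -sumrB; apply: vanish_sum => j _.
have -> : cst (v i * l i) * (cst (u j) * eta j) - cst (u j * l j) * (cst (v i) * eta i)
  = cst (v i * u j) * (cst (l i) * eta j - cst (l j) * eta i).
  by rewrite !cstM; ring.
exact: vanishZ.
Qed.

Lemma contract_vanish u v : pairing l v != 0 ->
  vanish m.+1 (cst (pairing l u) * contract v eta) -> vanish m.+1 (contract u eta).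
Proof.
move=> lv van_v; have -> : contract u eta = cst (pairing l v)^-1 *
    ((cst (pairing l v) * contract u eta - cst (pairing l u) * contract v eta)
     + cst (pairing l u) * contract v eta).
  by rewrite subrK mulrA -cstM mulVf // cst1 mul1r.
by apply/vanishZ/vanishD => //; apply: contract_proportional.
Qed.

(** For a closed form, differentiating eta(v) along u is differentiating eta(u) along v; if l(u) =
    0, then eta(u) vanishes to order m + 1 by proportionality. *)
Lemma contract_power_like v : power_like l m (contract v eta).
Proof.
split; first exact: vanish_contract.
have sw u : dirder u (contract v eta) = dirder v (contract u eta).
  rewrite /dirder /contract.
  under eq_bigr => i _ do rewrite sderiv_sum mulr_sumr.
  under [RHS]eq_bigr => i _ do rewrite sderiv_sum mulr_sumr.
  rewrite exchange_big; apply: eq_bigr => i _; apply: eq_bigr => j _.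
  by rewrite !sderiv_cstM closed; ring.
move=> u lu; rewrite sw; apply: (@vanish_dirder m.+1).
have [v0 lv0] := l_neq0; apply: (contract_vanish lv0).
by rewrite lu cst0 mul0r; apply: vanish_zero.
Qed.

Lemma form_killed t ts :
  has (fun v => pairing l v == 0) (t :: ts) ->
  vanish (m.+1 - size ts) (dirders ts (contract t eta)).
Proof.
have [v0 lv0] := l_neq0; have pl := contract_power_like t.
rewrite [has _ _]/=; case/orP => [/eqP lt|].
  apply: vanish_dirders; apply: (contract_vanish lv0).
  by rewrite lt cst0 mul0r; apply: vanish_zero.
move=> /hasP [v vin lv]; apply: (power_like_killed pl).
by exists (pairing l v) => //; apply: map_f.
Qed.

Lemma form_vanish t ts : (size ts <= m)%N ->
  all (fun v => pairing l v != 0) (t :: ts) ->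
  vanish (m.+1 - size ts) (dirders ts (contract t eta)) ->
  forall i, vanish m.+1 (eta i).
Proof.
move=> le /= /andP[lt lts] V i.
have vt : vanish m.+1 (contract t eta).
  exact: power_like_vanish (contract_power_like t) le lts V.
have -> : eta i = contract (fun k => (k == i)%:R) eta.
  rewrite /contract (bigD1 i) //= eqxx cst1 mul1r big1 ?addr0 // => k /negbTE ->.
  by rewrite cst0 mul0r.
by apply: (contract_vanish lt); apply: vanishZ.
Qed.

End ClosedForm.
End Orders.

(** * The jets that determine a relation *)

Section UpperBound.
Variables (K : numFieldType) (n : nat) (p : 'I_n -> K).
Hypothesis gen : in_compl (A0 K (n := n)) (chart_pt p).
Implicit Types (J I : quad n).

(* The coefficients [jet m J] for J not containing [anchor m], m < 3, determine an
   abelian relation: their number is the rank. *)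
Definition anchor (m : nat) : {set 'I_n.+3} := [set i : 'I_n.+3 | (n + m <= i)%N].

Definition jet (m : nat) J (eta : 'I_n -> series K n) : K :=
  dirders (nseq m (mvec p (qpt J 0))) (contract (mvec p (qpt J 0)) eta) 0%MM.

Variable eta : quad n -> 'I_n -> series K n.
Hypothesis closed : forall J i j, sderiv i (eta J j) = sderiv j (eta J i).
Hypothesis wedge : forall J i j,
  eta J i * (omega p J j : series K n) = eta J j * (omega p J i : series K n).
Hypothesis sum0 : forall i, \sum_J eta J i = 0.

Lemma card_anchor m : #|anchor m| = (3 - m)%N.
Proof.
rewrite -sum1_card (eq_bigl (fun i : 'I_n.+3 => (n + m <= i)%N)); last first.
  by move=> i; rewrite inE.
rewrite big_mkcond !big_ord_recr big1 => [|i _] /=.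
  by do ! (case: ifP => /=); lia.
by rewrite leqNgt (leq_trans (ltn_ord i)) ?leq_addr.
Qed.

(** If I contains the anchor, its m + 1 other points give one contraction and m derivations. These
    kill the leading part of every other component: by hypothesis if J does not contain the anchor,
    and otherwise because J lacks one of these m + 1 points. As the components have sum zero, the
    leading part of the I-th one is killed too, and all the directions are transverse to it. *)
Lemma vanish_step m : (forall J i, vanish m (eta J i)) ->
    (forall J i, ~~ (anchor m \subset val J) -> vanish m.+1 (eta J i)) ->
  forall J i, vanish m.+1 (eta J i).
Proof.
move=> van out I i; have [sub|] := boolP (anchor m \subset val I); last exact: out.
have lnz J := omega_nonzero gen J.
have szE : (size (enum (val I :\: anchor m)) + (3 - m) = 4)%N.
  by rewrite -cardE cardsD (setIidPr sub) card_quad card_anchor; clear; lia.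
case E : (enum (val I :\: anchor m)) szE => [|t ts] szE.
  by move: szE; clear; rewrite add0n; lia.
have memI x : x \in t :: ts -> x \in val I.
  by rewrite -E mem_enum inE => /andP[].
have sz : (size ts <= m)%N.
  by move: szE; rewrite [size (_ :: _)]/=; move: (size ts) => z; clear; lia.
have key : dirders (map (mvec p) ts) (contract (mvec p t) (eta I)) =
   - \sum_(J | J != I) dirders (map (mvec p) ts) (contract (mvec p t) (eta J)).
  apply/eqP; rewrite -addr_eq0 -(bigD1 I (P := xpredT)) //= -dirders_sum.
  have -> : \sum_J contract (mvec p t) (eta J) = 0.
    rewrite /contract exchange_big big1 //= => k _.
    by rewrite -mulr_sumr sum0 mulr0.
  apply/eqP; elim: (map _ _) => //= v vs IH.
  have -> : dirder v (0 : series K n) = 0; last exact: IH.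
  by rewrite /dirder big1 // => k _; rewrite sderiv0 mulr0.
apply: (@form_vanish _ _ (eta I) (omega p I) m (closed I) (@wedge I) (van I) (lnz I)
  (mvec p t) (map (mvec p) ts)).
- by rewrite size_map.
- apply/allP => v; rewrite -map_cons => /mapP [x xin ->].
  by have := pair_mvec gen I x; rewrite (memI x xin) => /negbT.
rewrite key -sumrN; apply: vanish_sum => J ne.
rewrite -mulN1r -cst1 -cstN; apply: vanishZ.
have [subJ|nsubJ] := boolP (anchor m \subset val J); last first.
  by apply: vanish_dirders; apply: vanish_contract => k; apply: out.
apply: (@form_killed _ _ (eta J) (omega p J) m (closed J) (@wedge J) (van J) (lnz J)).
have ne' : I != J by rewrite eq_sym.
have [x xI xJ] := quad_neq ne'.
rewrite -map_cons; apply/hasP; exists (mvec p x).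
  apply: map_f; rewrite -E mem_enum inE xI andbT.
  by apply: contra xJ => /(subsetP subJ).
by have := pair_mvec gen J x; rewrite xJ.
Qed.

Lemma jet_vanish m J : (forall i, vanish m (eta J i)) -> jet m J (eta J) = 0 ->
  forall i, vanish m.+1 (eta J i).
Proof.
move=> van j0; apply: (@form_vanish _ _ (eta J) (omega p J) m (closed J) (@wedge J) van
  (omega_nonzero gen J) (mvec p (qpt J 0)) (nseq m (mvec p (qpt J 0)))).
- by rewrite size_nseq.
- have lJ : pairing (omega0 p J) (mvec p (qpt J 0)) != 0.
    by rewrite pair_mvec // negbK mem_quad inE eqxx.
  by rewrite /= lJ; apply/allP => v /nseqP [-> _].
rewrite size_nseq subSnn => M; rewrite ltnS leqn0 mdeg_eq0 => /eqP ->.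
exact: j0.
Qed.

Lemma jets_determine :
  (forall m J, (m < 3)%N -> ~~ (anchor m \subset val J) -> jet m J (eta J) = 0) ->
  forall J i M, eta J i M = 0.
Proof.
move=> H; have all_van m : forall J i, vanish m (eta J i).
  elim: m => [|m IH] J i; first exact: vanish0.
  apply: vanish_step => // {}J {}i ns; apply: jet_vanish => //.
  (* From order 3 on the anchor is empty, so every J contains it and no further jet is required. *)
  apply: H => //; rewrite ltnNge; apply: contra ns => m3.
  have /eqP : #|anchor m| = 0%N by rewrite card_anchor; move: m3; lia.
  by rewrite cards_eq0 => /eqP ->; apply: sub0set.
by move=> J i M; apply: (all_van (mdeg M).+1).
Qed.

End UpperBound.

(** * Logarithmic and dilogarithmic abelian relations *)

Section Relations.
Variables (K : numFieldType) (n : nat) (p : 'I_n -> K).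
Hypothesis gen : in_compl (A0 K (n := n)) (chart_pt p).
Implicit Types (J : quad n).

Definition lg (i j : 'I_n.+3) : series K n := log_aff (lminor p i j).

Lemma log_affN (h : {mpoly K[n]}) : log_aff (- h) = log_aff h.
Proof.
congr loggeo; apply: funext => i.
by rewrite /slope !mcoeffN invrN mulrNN.
Qed.

Lemma log_affC (c : K) : log_aff (c%:MP : {mpoly K[n]}) = 0.
Proof.
apply: serP => m; rewrite /log_aff /loggeo; case: eqP => // /eqP m0.
have [i Mi] : exists i, (0 < m i)%N.
  apply/existsP; apply: contraNT m0; rewrite negb_exists => /forallP z.
  by apply/eqP/mnmP => i; rewrite mnm0E; apply/eqP; rewrite -leqn0 leqNgt z.
rewrite /geo (bigD1 i (P := xpredT) (F := fun i => _ ^+ m i)) //=.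
rewrite /slope mcoeffC mnm1_eq0 mulr0 oppr0 mul0r expr0n.
by case: (m i) Mi => // k _; rewrite /= mul0r mulr0 oppr0 mul0r.
Qed.

Lemma lgC i j : lg i j = lg j i.
Proof. by rewrite /lg lminor_anti log_affN. Qed.

Lemma lg_oo i : lg i ptoo = 0.
Proof.
rewrite /lg /lminor /minor; have -> : lx p i * ly K ptoo - lx p ptoo * ly K i = (- py K i)%:MP.
  by rewrite !lyE /lx /py !ptcaseE mpolyC0 mulr0 sub0r mul1r mpolyCN.
exact: log_affC.
Qed.

Lemma lg_edge i j : i != j ->
  \sum_k cst (edge K i j k) * lg (pair_of k).1 (pair_of k).2 = lg i j.
Proof.
move=> ij; have one k : (forall k', hits k' i j = (k' == k)) ->
  \sum_k' cst (edge K i j k') * lg (pair_of k').1 (pair_of k').2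
    = lg (pair_of k).1 (pair_of k).2.
  move=> H; rewrite (bigD1 k) //= ffunE H eqxx cst1 mul1r big1 ?addr0 // => k' /negbTE ne.
  by rewrite ffunE H ne cst0 mul0r.
have [/orP oo|[k e E]|[k e E]] := cminor_cases K ij.
- have -> : lg i j = 0 by case: oo => /eqP ->; rewrite ?lg_oo 1?lgC ?lg_oo.
  apply: big1 => k _; rewrite ffunE.
  by case: oo => /eqP ->; rewrite ?hits_oo 1?hitsC ?hits_oo cst0 mul0r.
- by rewrite (one k) ?e // => k'; rewrite -hitsE e.
- by rewrite (one k) ?e 1?lgC // => k'; rewrite hitsC -hitsE e.
Qed.

Lemma mul_dlg i j m : i != j ->
  of_mpoly (lminor p i j) * sderiv m (lg i j) = sderiv m (of_mpoly (lminor p i j)).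
Proof. by move=> ij; apply: mul_dlog_aff; [apply: msize_lminor | rewrite lminor0 pminor_neq0]. Qed.

Lemma conv_sderiv_lg i j m : i != j -> ps_convergent (sderiv m (lg i j)).
Proof.
move=> ij; rewrite /lg sderiv_log_aff ?msize_lminor ?lminor0 ?pminor_neq0 //.
by apply: convM; [apply: conv_cst | apply: conv_inv_aff].
Qed.

Definition log1 J : series K n :=
  lg (qpt J 0) (qpt J 1) + lg (qpt J 2) (qpt J 3)
    - (lg (qpt J 0) (qpt J 3) + lg (qpt J 1) (qpt J 2)).
Definition log2 J : series K n :=
  lg (qpt J 0) (qpt J 2) + lg (qpt J 1) (qpt J 3)
    - (lg (qpt J 0) (qpt J 3) + lg (qpt J 1) (qpt J 2)).

Lemma dlog_proportional J : exists u1 u2 : series K n, forall m,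
  sderiv m (log1 J) = u1 * (omega p J m : series K n) /\
  sderiv m (log2 J) = u2 * (omega p J m : series K n).
Proof.
have [n01 n02 n03 [n12 n13 n23]] := quad_ne J.
have inv i j : i != j -> exists u : series K n, of_mpoly (lminor p i j) * u = 1.
  by move=> ij; exists (inv_aff (lminor p i j));
    apply: mulV_aff; [apply: msize_lminor | rewrite lminor0 pminor_neq0].
have [v01 e01] := inv _ _ n01; have [v02 e02] := inv _ _ n02.
have [v03 e03] := inv _ _ n03; have [v12 e12] := inv _ _ n12.
have [v13 e13] := inv _ _ n13; have [v23 e23] := inv _ _ n23.
have pl : lminor p (qpt J 0) (qpt J 3) * lminor p (qpt J 1) (qpt J 2) = locQ p J - locP p J.
  by rewrite -[LHS]opprK /lminor -plucker opprB.
(* With R = Q - P and omega = Q dP - P dQ, one has d log(P / R) = omega / (P R) and d log(Q / R) =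
   omega / (Q R). *)
exists (v01 * v23 * v03 * v12), (v02 * v13 * v03 * v12) => m.
have d i j : i != j -> sderiv m (of_mpoly (lminor p i j)) =
    of_mpoly (lminor p i j) * sderiv m (lg i j).
  by move=> ij; rewrite mul_dlg.
have wE : (omega p J m : series K n) =
    of_mpoly (locQ p J) * sderiv m (of_mpoly (locP p J))
      - of_mpoly (locP p J) * sderiv m (of_mpoly (locQ p J)).
  rewrite /omega; move: (locP p J) (locQ p J) => P Q.
  by rewrite of_mpolyB !of_mpolyM !sderiv_mpoly.
have PE : sderiv m (of_mpoly (locP p J)) = of_mpoly (locP p J) *
    (sderiv m (lg (qpt J 0) (qpt J 1)) + sderiv m (lg (qpt J 2) (qpt J 3))).
  by rewrite /locP of_mpolyM sderivM !d //; ring.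
have QE : sderiv m (of_mpoly (locQ p J)) = of_mpoly (locQ p J) *
    (sderiv m (lg (qpt J 0) (qpt J 2)) + sderiv m (lg (qpt J 1) (qpt J 3))).
  by rewrite /locQ of_mpolyM sderivM !d //; ring.
have RE : sderiv m (of_mpoly (locQ p J)) - sderiv m (of_mpoly (locP p J)) =
    (of_mpoly (locQ p J) - of_mpoly (locP p J)) *
    (sderiv m (lg (qpt J 0) (qpt J 3)) + sderiv m (lg (qpt J 1) (qpt J 2))).
  by rewrite -sderivB -of_mpolyB -pl of_mpolyM sderivM !d //; ring.
have pl' : of_mpoly (locQ p J) - of_mpoly (locP p J) =
  of_mpoly (lminor p (qpt J 0) (qpt J 3)) * of_mpoly (lminor p (qpt J 1) (qpt J 2)).
  by rewrite -of_mpolyM pl of_mpolyB.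
set x := sderiv m (lg (qpt J 0) (qpt J 1)) + _ in PE.
set y := sderiv m (lg (qpt J 0) (qpt J 2)) + _ in QE.
set z := sderiv m (lg (qpt J 0) (qpt J 3)) + _ in RE.
have l1 : sderiv m (log1 J) = x - z by rewrite /log1 sderivB !sderivD.
have l2 : sderiv m (log2 J) = y - z by rewrite /log2 sderivB !sderivD.
rewrite l1 l2 wE PE QE; rewrite PE QE in RE; move: RE; rewrite pl'.
rewrite !of_mpolyM in pl' *.
move: (of_mpoly (lminor p (qpt J 0) (qpt J 1))) (of_mpoly (lminor p (qpt J 2) (qpt J 3)))
  (of_mpoly (lminor p (qpt J 0) (qpt J 2))) (of_mpoly (lminor p (qpt J 1) (qpt J 3)))
  (of_mpoly (lminor p (qpt J 0) (qpt J 3))) (of_mpoly (lminor p (qpt J 1) (qpt J 2)))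
  pl' e01 e23 e02 e13 e03 e12 => L01 L23 L02 L13 L03 L12 pl' e01 e23 e02 e13 e03 e12 RE.
have k1 : L02 * L13 * (x - y) = L03 * L12 * (x - z).
  by rewrite [RHS]mulrBr -RE -pl'; ring.
have k2 : L01 * L23 * (x - y) = L03 * L12 * (y - z).
  by rewrite [RHS]mulrBr -RE -pl'; ring.
split.
  transitivity ((L01 * v01) * (L23 * v23) * (v03 * v12) * (L02 * L13 * (x - y))); last by ring.
  rewrite k1; transitivity ((L01 * v01) * (L23 * v23) * (L03 * v03) * (L12 * v12) * (x - z));
    last by ring.
  by rewrite e01 e23 e03 e12 !mul1r.
transitivity ((L02 * v02) * (L13 * v13) * (v03 * v12) * (L01 * L23 * (x - y))); last by ring.
rewrite k2; transitivity ((L02 * v02) * (L13 * v13) * (L03 * v03) * (L12 * v12) * (y - z));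
  last by ring.
by rewrite e02 e13 e03 e12 !mul1r.
Qed.

(* The weight-2 part is the derivative of a Rogers dilogarithm of the cross-ratio. *)
Definition rel_form (c : K * K * K) J : 'I_n -> series K n := fun i =>
  cst c.1.1 * sderiv i (log1 J) + cst c.1.2 * sderiv i (log2 J)
  + cst c.2 * (log1 J * sderiv i (log2 J) - log2 J * sderiv i (log1 J)).

Lemma rel_form_holo c J i : ps_convergent (rel_form c J i).
Proof.
have [n01 n02 n03 [n12 n13 n23]] := quad_ne J.
have cl j k : ps_convergent (lg j k) by apply: conv_log_aff.
have c1 : ps_convergent (log1 J) by apply: convB; apply: convD.
have c2 : ps_convergent (log2 J) by apply: convB; apply: convD.
have d1 : ps_convergent (sderiv i (log1 J)).
  by rewrite /log1 sderivB !sderivD; apply: convB; apply: convD; apply: conv_sderiv_lg.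
have d2 : ps_convergent (sderiv i (log2 J)).
  by rewrite /log2 sderivB !sderivD; apply: convB; apply: convD; apply: conv_sderiv_lg.
apply: convD; first by apply: convD; apply: convM => //; apply: conv_cst.
by apply: convM; [apply: conv_cst | apply: convB; apply: convM].
Qed.

Lemma rel_form_closed c J : form_closed (rel_form c J).
Proof.
have [u1 [u2 D]] := dlog_proportional J.
move=> i j m; suff E : sderiv i (rel_form c J j) = sderiv j (rel_form c J i).
  exact: (congr1 (fun a : series K n => a m) E).
rewrite /rel_form; move: (log1 J) (log2 J) D => A B D.
rewrite !sderivD !sderiv_cstM !sderivB !sderivM.
rewrite !(sderivC j i); have [E1 E2] := D i; have [F1 F2] := D j.
by rewrite E1 E2 F1 F2; ring.
Qed.

Lemma rel_form_wedge c J : form_wedge0 (rel_form c J) (omega p J).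
Proof.
have [u1 [u2 D]] := dlog_proportional J.
move=> i j m; suff E : rel_form c J i * (omega p J j : series K n) =
    rel_form c J j * (omega p J i : series K n).
  exact: (congr1 (fun a : series K n => a m) E).
rewrite /rel_form.
have [E1 E2] := D i; have [F1 F2] := D j.
by rewrite E1 E2 F1 F2; ring.
Qed.

Lemma log_at0 J : log1 J 0%MM = 0 /\ log2 J 0%MM = 0.
Proof. by rewrite /log1 /log2 !serBE !serDE /lg !log_aff0 !addr0 subr0. Qed.

(* Along the first point, log1 and log2 have independent derivatives (a nonzero
   Wronskian), while the weight-2 form vanishes to order exactly 2. *)
Lemma rel_form_inj c J : (forall i, rel_form c J i = 0) -> c = (0, 0, 0).
Proof.
move=> H; have [n01 n02 n03 [n12 n13 n23]] := quad_ne J.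
have [m0 m1 m2] := quad_movable J.
pose i : 'I_n := Ordinal m0.
have qi : qpt J 0 = ptv i by apply: val_inj.
have y0 : py K (qpt J 0) = 1 by rewrite qi /py ptcaseE.
have dlx (q : 'I_n.+3) : (lx p q)^`M(i) = (q == ptv i)%:R%:MP.
  rewrite /lx; case: (ptP q) => [q'|||];
    rewrite ptcaseE pt_eqE -?mpolyC1 ?mderivC ?mderiv0 ?mpolyC0 //.
  by rewrite mderivD mderivC addr0 mderivXU eq_sym.
have dL (q r : 'I_n.+3) : (lminor p q r)^`M(i) =
    ((q == ptv i)%:R * py K r - (r == ptv i)%:R * py K q)%:MP.
  by rewrite /lminor /minor mderivB !mderivM !lyE !mderivC !mulr0 !addr0 !dlx -!mpolyCM -mpolyCB.
have lg0 (q r : 'I_n.+3) : q != r -> qpt J 0 != q -> qpt J 0 != r -> sderiv i (lg q r) = 0.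
  move=> qr q0 r0; have := mul_dlg i qr; rewrite sderiv_mpoly dL -qi.
  rewrite !(eq_sym _ (qpt J 0)) (negbTE q0) (negbTE r0) !mul0r subrr mpolyC0 of_mpoly0 => E.
  rewrite -[LHS]mul1r -(@mulV_aff _ _ (lminor p q r)) ?msize_lminor ?lminor0 ?pminor_neq0 //.
  by rewrite mulrAC E mul0r.
(* 1 / (x - x_q) for q finite, with x the position of the first point, and 0 for q infinite: the
   logarithmic derivative of the minor along x. *)
pose s q : K := py K q / pminor p (qpt J 0) q.
have lg2 (q : 'I_n.+3) : qpt J 0 != q -> sderiv i (lg (qpt J 0) q) 0%MM = s q /\
    sderiv i (sderiv i (lg (qpt J 0) q)) 0%MM = - s q ^+ 2.
  move=> q0; have dq := pminor_neq0 gen q0; have E := mul_dlg i q0.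
  rewrite sderiv_mpoly dL -qi eqxx (eq_sym q) (negbTE q0) mul0r mul1r subr0 in E.
  have E0 := congr1 (fun a : series K n => a 0%MM) E; rewrite /= ser_mul0E in E0.
  rewrite /of_mpoly lminor0 mcoeffC eqxx mulr1 in E0.
  have sq : sderiv i (lg (qpt J 0) q) 0%MM = s q.
    by apply: (mulfI dq); rewrite E0 /s mulrC divfK.
  split=> //; have := congr1 (sderiv i) E; rewrite sderivM sderiv_cst => E1.
  have := congr1 (fun a : series K n => a 0%MM) E1; rewrite /= serDE !ser_mul0E ser0E.
  rewrite sderiv_mpoly dL -qi eqxx (eq_sym q) (negbTE q0) mul0r mul1r subr0.
  rewrite {2}/of_mpoly lminor0 [of_mpoly _ _]mcoeffC eqxx mulr1 sq => E2.
  have E3 : pminor p (qpt J 0) q * sderiv i (sderiv i (lg (qpt J 0) q)) 0%MM = - (py K q * s q).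
    by apply/eqP; rewrite -addr_eq0 addrC; apply/eqP.
  by apply: (mulfI dq); rewrite E3 /s; field.
have sne (q r : 'I_n.+3) : qpt J 0 != q -> qpt J 0 != r -> q != r -> s q != s r.
  move=> q0 r0 qr; have dq := pminor_neq0 gen q0; have dr := pminor_neq0 gen r0.
  have dqr := pminor_neq0 gen qr; rewrite -subr_eq0.
  have -> : s q - s r = pminor p q r / (pminor p (qpt J 0) q * pminor p (qpt J 0) r).
    have e : py K q * pminor p (qpt J 0) r - py K r * pminor p (qpt J 0) q = pminor p q r.
      by rewrite /pminor /minor y0; ring.
    by rewrite -e /s; field; rewrite dq dr.
  by rewrite mulf_neq0 ?invr_eq0 ?mulf_neq0.
have [A0 B0] := log_at0 J.
have [[b0 b1] [[c0 c1] [d0 d1]]] := (lg2 _ n01, (lg2 _ n02, lg2 _ n03)).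
have dA : sderiv i (log1 J) = sderiv i (lg (qpt J 0) (qpt J 1)) - sderiv i (lg (qpt J 0) (qpt J 3)).
  by rewrite /log1 sderivB !sderivD (lg0 _ _ n23 n02 n03) (lg0 _ _ n12 n01 n02) !addr0.
have dB : sderiv i (log2 J) = sderiv i (lg (qpt J 0) (qpt J 2)) - sderiv i (lg (qpt J 0) (qpt J 3)).
  by rewrite /log2 sderivB !sderivD (lg0 _ _ n13 n01 n03) (lg0 _ _ n12 n01 n02) !addr0.
have u10 : sderiv i (log1 J) 0%MM = s (qpt J 1) - s (qpt J 3) by rewrite dA serBE b0 d0.
have u20 : sderiv i (log2 J) 0%MM = s (qpt J 2) - s (qpt J 3) by rewrite dB serBE c0 d0.
have u11 : sderiv i (sderiv i (log1 J)) 0%MM = - s (qpt J 1) ^+ 2 + s (qpt J 3) ^+ 2.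
  by rewrite dA sderivB serBE b1 d1 opprK.
have u21 : sderiv i (sderiv i (log2 J)) 0%MM = - s (qpt J 2) ^+ 2 + s (qpt J 3) ^+ 2.
  by rewrite dB sderivB serBE c1 d1 opprK.
have Hi := H i; move: Hi A0 B0 u10 u20 u11 u21; rewrite /rel_form {dA dB}.
move: (log1 J) (log2 J) => A B Hi A0 B0 u10 u20 u11 u21.
have H1 := congr1 (sderiv i) Hi; have H2 := congr1 (sderiv i) H1.
have E0 := congr1 (fun a : series K n => a 0%MM) Hi.
have E1 := congr1 (fun a : series K n => a 0%MM) H1.
have E2 := congr1 (fun a : series K n => a 0%MM) H2.
rewrite /= in E0 E1 E2.
rewrite !(sderivD, sderivN, sderivM, sderiv_cst, sderiv0) in E1 E2.
rewrite !(serDE, serNE, ser_mul0E, ser0E, A0, B0, u10, u20, u11, u21, cstE, eqxx,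
  mulr1, mul0r, mulr0) in E0 E1 E2.
have := sne _ _ n01 n03 n13; have := sne _ _ n02 n03 n23; have := sne _ _ n01 n02 n12.
case: c {H Hi H1 H2} E0 E1 E2 => [[x y] z] /=.
move: (s (qpt J 1)) (s (qpt J 2)) (s (qpt J 3)) => b c d E0 E1 E2 bc cd bd.
(* The Wronskian of the two logarithms at 0: the determinant of [E0], [E1] in x and y, and the
   coefficient of z in [E2]. *)
have W0 : (b - d) * (c - d) * (b - c) != 0 by rewrite !mulf_neq0 // subr_eq0.
have lin (u v e f : K) : u = 0 -> v = 0 -> u * e - v * f = 0.
  by move=> -> ->; rewrite !mul0r subrr.
have x0 : x = 0.
  apply: (mulIf W0); rewrite mul0r.
  by rewrite -[RHS](lin _ _ (- c ^+ 2 + d ^+ 2) (c - d) E0 E1); ring.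
have yy0 : y = 0.
  apply: (mulIf W0); rewrite mul0r.
  by rewrite -[RHS](lin _ _ (b - d) (- b ^+ 2 + d ^+ 2) E1 E0); ring.
have z0 : z = 0.
  apply: (mulIf W0); rewrite mul0r; move: E2; rewrite x0 yy0 => E2.
  by rewrite -[RHS]E2; ring.
by rewrite x0 yy0 z0.
Qed.

End Relations.

Section SumZero.
Variables (K : numFieldType) (n : nat) (p : 'I_n -> K).
Implicit Types (J : quad n).

Lemma log_comp J :
  log1 p J = \sum_k cst (form1 K J k) * lg p (pair_of k).1 (pair_of k).2 /\
  log2 p J = \sum_k cst (form2 K J k) * lg p (pair_of k).1 (pair_of k).2.
Proof.
have [n01 n02 n03 [n12 n13 n23]] := quad_ne J.
pose S (a : {ffun A0_index n -> K^o}) : series K n :=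
  \sum_k cst (a k) * lg p (pair_of k).1 (pair_of k).2.
have SD a b : S (a + b) = S a + S b.
  by rewrite /S -big_split; apply: eq_bigr => k _; rewrite ffunE cstD mulrDl.
have SN a : S (- a) = - S a.
  by rewrite /S -sumrN; apply: eq_bigr => k _; rewrite ffunE cstN mulNr.
rewrite -/(S (form1 K J)) -/(S (form2 K J)) /form1 /form2 !SD !SN !SD.
by rewrite /S !lg_edge.
Qed.

(** The hyperplane X_0 = 0: its equation is 1 in the chart, so it imposes no condition on the
    logarithmic relations. *)
Definition unit_index : A0_index n := inl (inl ord0).

Lemma lg_unit : lg p (pair_of unit_index).1 (pair_of unit_index).2 = 0.
Proof.
rewrite /lg /lminor /minor /= unlift_none /= /lx /ly !ptcaseE.
by rewrite mul1r mul0r subr0 -mpolyC1 log_affC.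
Qed.

Lemma sum_log_relation (al be : quad n -> K) :
  (forall k, k != unit_index ->
     \sum_J (al J * form1 K J k + be J * form2 K J k) = 0) ->
  forall i, \sum_J rel_form p (al J, be J, 0) J i = 0.
Proof.
move=> H i; transitivity (sderiv i (\sum_J (cst (al J) * log1 p J + cst (be J) * log2 p J))).
  rewrite sderiv_sum; apply: eq_bigr => J _.
  rewrite /rel_form; move: (log1 p J) (log2 p J) => A B.
  by rewrite cst0 mul0r addr0 sderivD !sderiv_cstM.
rewrite (_ : \sum_J _ = 0) ?sderiv0 //.
transitivity (\sum_k cst (\sum_J (al J * form1 K J k + be J * form2 K J k)) *
    lg p (pair_of k).1 (pair_of k).2).
  under eq_bigr => J _ do (have [-> ->] := log_comp J).
  under eq_bigr => J _ do rewrite !mulr_sumr -big_split /=.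
  rewrite exchange_big; apply: eq_bigr => k _.
  have cs (F : quad n -> K) : cst (\sum_J F J) = \sum_J cst (F J) :> series K n.
    by apply: (big_morph (fun y => cst y : series K n)); [exact: cstD | exact: cst0].
  rewrite cs mulr_suml; apply: eq_bigr => J _.
  by rewrite cstD !cstM mulrDl !mulrA.
apply: big1 => k _; have [->|ne] := eqVneq k unit_index; first by rewrite lg_unit mulr0.
by rewrite H // cst0 mul0r.
Qed.

(* Abel's five-term relation on the points of J and infinity. *)
Lemma five_term J : ptoo \notin val J -> exists f : quad n -> K,
  [/\ f J = 1, forall J', J' != J -> ptoo \notin val J' -> f J' = 0 &
      forall i, \sum_J' rel_form p (0, 0, f J') J' i = 0].
Proof.
move=> Joo; have [l1 l2 l3] := quad_lt J.
have l4 : (qpt J 3 < (@ptoo n))%N.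
  rewrite /= -fin_oo; apply: contraNneq Joo => <-.
  by rewrite mem_quad !inE eqxx !orbT.
have mk (a b c : 'I_n.+3) : (a < b)%N -> (b < c)%N -> (c < (@ptoo n))%N ->
    exists I : quad n, [/\ qpt I 0 = a, qpt I 1 = b, qpt I 2 = c & qpt I 3 = ptoo].
  move=> ab bc co; have u : uniq [:: a; b; c; ptoo].
    by rewrite /= !inE -!val_eqE /= !negb_or !neq_ltn ab bc (ltn_trans ab bc) co
      (ltn_trans bc co) (ltn_trans ab (ltn_trans bc co)).
  by have [I memI] := quad_ex u; exists I; apply: quad_enumE.
have l02 := ltn_trans l1 l2; have l13 := ltn_trans l2 l3.
have [I3 [a3 b3 c3 d3]] := mk _ _ _ l1 l2 (ltn_trans l3 l4).
have [I2 [a2 b2 c2 d2]] := mk _ _ _ l1 l13 l4.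
have [I1 [a1 b1 c1 d1]] := mk _ _ _ l02 l3 l4.
have [I0 [a0 b0 c0 d0]] := mk _ _ _ l2 l3 l4.
have oo_in I : qpt I 3 = ptoo -> ptoo \in val I by move=> e; rewrite mem_quad !inE e eqxx !orbT.
(* The five 4-subsets of J with infinity added, with alternating signs; [I0], ..., [I3] omit the
   corresponding point of J. *)
pose f J' : K := (J' == J)%:R - (J' == I3)%:R + (J' == I2)%:R - (J' == I1)%:R + (J' == I0)%:R.
have noI I J' : qpt I 3 = ptoo -> ptoo \notin val J' -> (J' == I) = false.
  by move=> e; apply: contraNF => /eqP ->; apply: oo_in.
exists f; split.
- by rewrite /f eqxx !(noI _ J) // !subr0 !addr0.
- by move=> J' /negbTE ne J'oo; rewrite /f ne !(noI _ J') // !subr0 !addr0.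
move=> i; pose kap J' : series K n :=
  log1 p J' * sderiv i (log2 p J') - log2 p J' * sderiv i (log1 p J').
have pick I : \sum_J' cst (J' == I)%:R * kap J' = kap I.
  rewrite (bigD1 I) //= eqxx cst1 mul1r big1 ?addr0 // => J' /negbTE ->.
  by rewrite cst0 mul0r.
have cst_alt (x0 x1 x2 x3 x4 : K) (g : series K n) : cst x0 * g - cst x1 * g + cst x2 * g
    - cst x3 * g + cst x4 * g = cst (x0 - x1 + x2 - x3 + x4) * g.
  by rewrite (cstD _ (_ - _ + _ - _)) (cstD _ (_ - _ + _)) (cstD _ (_ - _)) (cstD _ x0) !cstN; ring.
transitivity (kap J - kap I3 + kap I2 - kap I1 + kap I0).
  rewrite -!pick -!sumrB -!big_split /= -!sumrB -!big_split /=; apply: eq_bigr => J' _.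
  have -> : rel_form p (0, 0, f J') J' i = cst (f J') * kap J'.
    by rewrite /rel_form cst0 !mul0r !add0r.
  exact/esym/cst_alt.
(* The sum cancels formally, as an identity between the [lg] of pairs among the five points and
   their derivatives. *)
rewrite /kap /log1 /log2 a0 b0 c0 d0 a1 b1 c1 d1 a2 b2 c2 d2 a3 b3 c3 d3.
rewrite !(sderivB, sderivD); ring.
Qed.

End SumZero.

(** * The rank *)

Section LinearAlgebra.
Variable K : fieldType.

Lemma ker_rows m d r (M : 'M[K]_(m, d)) : (r <= m - d)%N ->
  exists B : 'M[K]_(r, m), row_free B /\ B *m M = 0.
Proof.
move=> le; have rk : (r <= \rank (kermx M))%N.
  by rewrite mxrank_ker; apply: leq_trans le _; rewrite leq_sub2l ?rank_leq_col.
exists ((pid_mx r : 'M_(r, \rank (kermx M))) *m row_base (kermx M)); split.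
  by rewrite /row_free mxrankMfree ?row_base_free // rank_pid_mx.
rewrite -mulmxA; have /sub_kermxP -> : (row_base (kermx M) <= kermx M)%MS.
  by rewrite eq_row_base.
exact: mulmx0.
Qed.

Lemma solve_square (T U : finType) (Y : T -> U -> K) : #|T| = #|U| ->
    (forall c : T -> K, (forall u, \sum_t c t * Y t u = 0) -> forall t, c t = 0) ->
  forall b : U -> K, exists c : T -> K, forall u, \sum_t c t * Y t u = b u.
Proof.
move=> cTU inj b.
pose M : 'M[K]_(#|T|, #|U|) := \matrix_(i, j) Y (enum_val i) (enum_val j).
have sum_enum (F : T -> K) : \sum_t F t = \sum_(i < #|T|) F (enum_val i).
  by rewrite (reindex _ (onW_bij _ (enum_val_bij T))).
have free : row_free M.
  rewrite -kermx_eq0.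
  apply/eqP/row_matrixP => i; rewrite row0.
  have k0 : row i (kermx M) *m M = 0 by rewrite -row_mul mulmx_ker row0.
  apply/rowP => j; rewrite [RHS]mxE.
  have := inj (fun t => row i (kermx M) 0 (enum_rank t)) _ (enum_val j).
  rewrite enum_valK; apply => u; rewrite sum_enum.
  transitivity ((row i (kermx M) *m M) 0 (enum_rank u)); last by rewrite k0 mxE.
  by rewrite mxE; apply: eq_bigr => t _; rewrite enum_valK [M _ _]mxE enum_rankK.
have full : row_full M by apply/eqP; rewrite (eqP free) cTU.
have /submxP [c ec] : (\row_j b (enum_val j) <= M)%MS by apply: submx_full.
exists (fun t => c 0 (enum_rank t)) => u; rewrite sum_enum.
transitivity ((c *m M) 0 (enum_rank u)); last by rewrite -ec mxE enum_rankK.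
rewrite mxE; by apply: eq_bigr => t _; rewrite enum_valK [M _ _]mxE enum_rankK.
Qed.

End LinearAlgebra.

(** * Cardinalities of subsets and of the arrangement *)

Section Counting.
Variable n : nat.

Lemma card_quads_containing (A : {set 'I_n.+3}) a : (#|A| + a = 4)%N ->
  #|[pred J : quad n | A \subset val J]| = 'C(n.+3 - #|A|, a).
Proof.
move=> ca; have -> : (n.+3 - #|A|)%N = #|~: A|.
  by have := cardsC A; rewrite [X in _ = X -> _]card_ord => e; rewrite -[X in (X - _)%N]e addKn.
rewrite -(cards_draws (~: A) a).
have dA (B : {set 'I_n.+3}) : B \subset ~: A -> (A :|: B) :\: A = B.
  move=> /subsetP sB; apply/setP => x; rewrite !inE; case xA : (x \in A) => //=.
  by apply/esym/negbTE; apply: contraL xA => /sB; rewrite inE.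
have injU : {in [set B : {set 'I_n.+3} | B \subset ~: A & #|B| == a] &, injective (setU A)}.
  move=> B B'; rewrite !inE => /andP[sB _] /andP[sB' _] E.
  by rewrite -(dA B) // E dA.
rewrite -(card_in_imset injU) -(card_image (@val_inj _ _ _)).
apply: eq_card => S; apply/imageP/imsetP.
  case=> J AJ ->; exists (val J :\: A).
    have cJ : #|val J :\: A| = a.
      apply: (@addnI #|A|); rewrite ca -[RHS](card_quad J) -(cardsID A (val J)).
      by rewrite (setIidPr AJ).
    by rewrite inE cJ eqxx andbT setDE subsetIr.
  apply/setP => x; rewrite !inE; case xA : (x \in A) => //=.
  by rewrite (subsetP AJ).
case=> B; rewrite inE => /andP[sB /eqP cB] ->.
have c4 : #|A :|: B| == 4%N.
  have AB : A :&: B = set0.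
    apply/setP => x; rewrite !inE; case xB : (x \in B); last by rewrite andbF.
    by have := subsetP sB x xB; rewrite inE => /negbTE ->.
  by rewrite cardsU AB cards0 subn0 cB ca.
by exists (exist (fun J : {set 'I_n.+3} => #|J| == 4%N) _ c4) => //; rewrite inE subsetUl.
Qed.

Lemma card_ltn_pairs : #|{: {ij : 'I_n * 'I_n | (ij.1 < ij.2)%N}}| = 'C(n, 2).
Proof.
rewrite card_sig -sum1_card -[RHS]bin2_sum big_mkord.
rewrite (eq_bigl (fun ij : 'I_n * 'I_n => (ij.1 < ij.2)%N)); last by move=> ij; rewrite inE.
rewrite (reindex_inj (h := fun ij : 'I_n * 'I_n => (ij.2, ij.1))) /=; last first.
  by move=> [a b] [c d] [-> ->].
rewrite -(pair_big_dep xpredT (fun j i : 'I_n => (i < j)%N) (fun _ _ => 1%N)) /=.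
apply: eq_bigr => j _; rewrite (big_ord_narrow (ltnW (ltn_ord j))) /=.
by rewrite sum1_card card_ord.
Qed.

Lemma card_A0_index : #|{: A0_index n}| = (n + 'C(n.+1, 2)).+1.
Proof.
rewrite !card_sum !card_ord card_ltn_pairs binS bin1.
by move: 'C(n, 2) => c; lia.
Qed.

End Counting.

Section Rank.
Variables (K : numFieldType) (n : nat) (p : 'I_n -> K).
Hypothesis gen : in_compl (A0 K (n := n)) (chart_pt p).
Implicit Types (J : quad n).

Local Notation forms := (quad n -> 'I_n -> series K n).

Definition is_relation (eta : forms) : Prop :=
  [/\ forall J i, ps_convergent (eta J i),
      forall J i j, sderiv i (eta J j) = sderiv j (eta J i),
      forall J i j, eta J i * (omega p J j : series K n) =
                    eta J j * (omega p J i : series K n) &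
      forall i, \sum_J eta J i = 0].

Definition lincomb (T : finType) (c : T -> K) (e : T -> forms) : forms :=
  fun J i => \sum_t cst (c t) * e t J i.

Lemma relationB (T : finType) (c : T -> K) (e : T -> forms) eta :
  is_relation eta -> (forall t, is_relation (e t)) ->
  is_relation (fun J i => eta J i - lincomb c e J i).
Proof.
move=> [h1 h2 h3 h4] He; split.
- move=> J i; apply: convB => //; apply: conv_sum => t _.
  by apply: convM; [apply: conv_cst | have [] := He t].
- move=> J i j; rewrite !sderivB !sderiv_sum h2; congr (_ - _); apply: eq_bigr => t _.
  by rewrite !sderiv_cstM; have [_ -> _ _] := He t.
- move=> J i j; rewrite !mulrBl h3; congr (_ - _); rewrite !mulr_suml.
  by apply: eq_bigr => t _; rewrite -!mulrA; have [_ _ -> _] := He t.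
- move=> i; rewrite sumrB h4 sub0r exchange_big big1 ?oppr0 // => t _.
  by rewrite -mulr_sumr; have [_ _ _ ->] := He t; rewrite mulr0.
Qed.

Lemma relation0 : is_relation (fun _ _ => 0).
Proof.
split.
- by move=> *; apply: conv0.
- by move=> J i j; rewrite !sderiv0.
- by move=> J i j; rewrite !mul0r.
- by move=> i; rewrite big1.
Qed.

Lemma jetB (T : finType) (c : T -> K) (e : T -> forms) (eta : forms) m J :
  jet p m J (fun i => eta J i - lincomb c e J i) =
  jet p m J (eta J) - \sum_t c t * jet p m J (e t J).
Proof.
rewrite /jet; set v := mvec p _.
have -> : contract v (fun i => eta J i - lincomb c e J i) =
    contract v (eta J) - \sum_t cst (c t) * contract v (e t J).
  rewrite /contract; under eq_bigr => i _ do rewrite mulrBr.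
  rewrite sumrB; congr (_ - _); rewrite /lincomb.
  under eq_bigr => i _ do rewrite mulr_sumr.
  rewrite exchange_big; apply: eq_bigr => t _; rewrite mulr_sumr.
  by apply: eq_bigr => i _; rewrite mulrCA.
have lin1 u a (b : T -> series K n) : dirder u (a - \sum_t cst (c t) * b t) =
    dirder u a - \sum_t cst (c t) * dirder u (b t).
  rewrite /dirder (eq_bigr (fun i => cst (u i) * sderiv i a -
    \sum_t cst (c t) * (cst (u i) * sderiv i (b t)))) => [|i _].
    rewrite sumrB; congr (_ - _); rewrite exchange_big; apply: eq_bigr => t _.
    by rewrite mulr_sumr.
  rewrite sderivB sderiv_sum mulrBr mulr_sumr; congr (_ - _); apply: eq_bigr => t _.
  by rewrite sderiv_cstM mulrCA.
have lin vs a (b : T -> series K n) : dirders vs (a - \sum_t cst (c t) * b t) =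
    dirders vs a - \sum_t cst (c t) * dirders vs (b t).
  by elim: vs a b => //= u vs IH a b; rewrite -IH lin1.
rewrite lin serBE ser_sumE; congr (_ - _); apply: eq_bigr => t _.
exact: cstME.
Qed.

Definition jet_index : finType :=
  {mJ : 'I_3 * quad n | ~~ (anchor n mJ.1 \subset val mJ.2)}.

Definition jet_coord (eta : forms) (u : jet_index) : K :=
  jet p (val u).1 (val u).2 (eta (val u).2).

Lemma jet_coord_inj eta : is_relation eta -> (forall u, jet_coord eta u = 0) ->
  forall J i, eta J i = 0.
Proof.
move=> [_ h2 h3 h4] H J i; apply: serP => M; rewrite ser0E.
apply: (jets_determine gen h2 h3 h4) => m {}J m3 ns.
exact: (H (exist (fun mJ : 'I_3 * quad n => ~~ (anchor n mJ.1 \subset val mJ.2))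
  (Ordinal m3, J) ns)).
Qed.

(** Jets are injective on relations, so the jets of the independent family e form an invertible
    square matrix. A combination of the e t then has the same jets as eta, hence equals eta. *)
Lemma spanning (T : finType) (e : T -> forms) : #|T| = #|jet_index| ->
    (forall t, is_relation (e t)) ->
    (forall c : T -> K, (forall J i, lincomb c e J i = 0) -> forall t, c t = 0) ->
  forall eta, is_relation eta -> exists c, forall J i, eta J i = lincomb c e J i.
Proof.
move=> cT He inde eta Heta.
have coordB c eta' u : jet_coord (fun J i => eta' J i - lincomb c e J i) u =
  jet_coord eta' u - \sum_t c t * jet_coord (e t) u by exact: jetB.
have coord0 u : jet_coord (fun _ _ => 0) u = 0.
  rewrite /jet_coord /jet; move: (mvec _ _) => v; have -> : contract v (fun=> (0 : series K n)) = 0.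
    by rewrite /contract big1 // => i _; rewrite mulr0.
  elim: (nseq _ _) => //= w vs IH; have -> : dirder w (0 : series K n) = 0; last exact: IH.
  by rewrite /dirder big1 // => i _; rewrite sderiv0 mulr0.
have [|c Hc] := @solve_square K T jet_index (fun t => jet_coord (e t)) cT _ (jet_coord eta).
  move=> c Hc; apply: inde => J i; apply/eqP; rewrite -oppr_eq0 -sub0r; apply/eqP.
  apply: (jet_coord_inj (relationB c relation0 He)) => u.
  by rewrite coordB Hc coord0 subrr.
exists c => J i; apply/eqP; rewrite -subr_eq0; apply/eqP.
by apply: (jet_coord_inj (relationB c Heta He)) => u; rewrite coordB Hc subrr.
Qed.

End Rank.

Section Basis.
Variables (K : numFieldType) (n : nat).
Implicit Types (J : quad n).

(** Two unknown coefficients for each J, minus one equation for each hyperplane other than X_0 = 0: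
    a lower bound for the dimension of the logarithmic relations. *)
Definition log_count : nat :=
  #|{: quad n * bool}| - #|{: {k : A0_index n | k != unit_index n}}|.

Definition basis_index : finType :=
  ('I_log_count + {J : quad n | ptoo \notin val J})%type.

Lemma card_quads_off m : (m < 3)%N ->
  (#|[pred J : quad n | ~~ (anchor n m \subset val J)]| + 'C(n + m, m.+1))%N = 'C(n.+3, 4).
Proof.
move=> m3; have ca := card_anchor n m.
have e : (#|anchor n m| + m.+1 = 4)%N by rewrite ca; lia.
have := card_quads_containing e; rewrite ca (_ : n.+3 - (3 - m) = n + m)%N; last by lia.
move=> <-; rewrite -card_quads addnC -(cardC [pred J : quad n | anchor n m \subset val J]).
by congr addn; apply: eq_card => J; rewrite !inE.
Qed.

Lemma card_jet_index :
  #|jet_index n| = (3 * 'C(n + 3, 4) - 'C(n + 2, 3) - 'C(n + 1, 2) - n)%N.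
Proof.
have h0 := card_quads_off (isT : (0 < 3)%N).
have h1 := card_quads_off (isT : (1 < 3)%N).
have h2 := card_quads_off (isT : (2 < 3)%N).
rewrite card_sig -sum1_card.
rewrite (eq_bigl (fun mJ : 'I_3 * quad n => ~~ (anchor n mJ.1 \subset val mJ.2))); last first.
  by move=> mJ; rewrite inE.
rewrite -(pair_big_dep xpredT (fun (m : 'I_3) J => ~~ (anchor n m \subset val J))
  (fun _ _ => 1%N)) /=.
rewrite !big_ord_recl big_ord0 /= !sum1_card addn0.
move: h0 h1 h2; rewrite addn0 bin1 addn1 addn2 addn3.
move: #|_| #|_| #|_| 'C(_, _) 'C(_, _) 'C(_, _) => a b c d x y; clear; lia.
Qed.

(** The jets of orders 0 and 1 together are as many as the logarithmic relations. Those of order 2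
    match the five-term relations, since [anchor n 2] consists of infinity alone. *)
Lemma card_basis_index : #|basis_index| = #|jet_index n|.
Proof.
have h0 := card_quads_off (isT : (0 < 3)%N).
have h1 := card_quads_off (isT : (1 < 3)%N).
have h2 := card_quads_off (isT : (2 < 3)%N).
have e2 : #|{: {J : quad n | ptoo \notin val J}}| =
    #|[pred J : quad n | ~~ (anchor n 2 \subset val J)]|.
  rewrite card_sig; apply: eq_card => J; rewrite !inE; congr (~~ _).
  have -> : anchor n 2 = [set ptoo].
    apply/setP => i; rewrite !inE -val_eqE /= addn2.
    by have := ltn_ord i; case: ltngtP => //; lia.
  by rewrite sub1set.
rewrite card_jet_index card_sum card_ord e2 /log_count card_prod card_bool card_quads.
have eu : #|{: {k : A0_index n | k != unit_index n}}| = (n + 'C(n.+1, 2))%N.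
  rewrite card_sig; have := cardC1 (unit_index n); rewrite card_A0_index /= => <-.
  by apply: eq_card => k; rewrite !inE.
rewrite eu; move: h0 h1 h2; rewrite addn0 bin1 addn1 addn2 addn3.
move: #|_| #|_| #|_| 'C(_, _) 'C(_, _) 'C(_, _) => a b c d x y; clear; lia.
Qed.

Lemma log_rows : exists al be : 'I_log_count -> quad n -> K,
  (forall s k, k != unit_index n ->
     \sum_J (al s J * form1 K J k + be s J * form2 K J k) = 0) /\
  (forall c : 'I_log_count -> K,
     (forall J, \sum_s c s * al s J = 0 /\ \sum_s c s * be s J = 0) -> forall s, c s = 0).
Proof.
pose C := {k : A0_index n | k != unit_index n}.
pose F (x : quad n * bool) (k : A0_index n) : K :=
  if x.2 then form1 K x.1 k else form2 K x.1 k.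
pose M : 'M[K]_(#|{: quad n * bool}|, #|{: C}|) :=
  \matrix_(i, j) F (enum_val i) (val (enum_val j)).
have [B [Bfree BM]] := @ker_rows K _ _ log_count M (leqnn _).
exists (fun s J => B s (enum_rank (J, true))), (fun s J => B s (enum_rank (J, false))).
split=> [s k ku|c Hc s].
  pose k' : C := exist (fun k => k != unit_index n) k ku.
  transitivity ((B *m M) s (enum_rank k')); last by rewrite BM mxE.
  rewrite mxE (reindex _ (onW_bij _ (@enum_rank_bij _))) /=.
  rewrite (eq_bigr (fun x : quad n * bool => B s (enum_rank (x.1, x.2)) * F (x.1, x.2) k)).
    rewrite -(pair_bigA _ (fun J b => B s (enum_rank (J, b)) * F (J, b) k)) /=.
    by apply: eq_bigr => J _; rewrite big_bool.
  by case=> J b _; rewrite mxE !enum_rankK.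
have c0 : (\row_s c s) *m B = 0.
  apply/rowP => x; rewrite !mxE -(enum_valK x).
  case: (enum_val x) => J b; have [h1 h2] := Hc J.
  under eq_bigr => t _ do rewrite mxE.
  by case: b.
have := congr1 (fun A : 'rV_log_count => A 0 s)
  (row_free_inj Bfree (etrans c0 (esym (mul0mx _ _)))).
by rewrite !mxE.
Qed.

Variables (p : 'I_n -> K) (gen : in_compl (A0 K (n := n)) (chart_pt p)).

Lemma rel_form_relation (c : quad n -> K * K * K) :
  (forall i, \sum_J rel_form p (c J) J i = 0) -> is_relation p (fun J => rel_form p (c J) J).
Proof.
move=> s0; split=> //.
- by move=> J i; apply: rel_form_holo.
- by move=> J i j; apply: serP => m; apply: rel_form_closed.
- by move=> J i j; apply: serP => m; apply: rel_form_wedge.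
Qed.

(** By [rel_form_inj], a vanishing combination has vanishing coefficients on each J. The logarithmic
    ones are independent rows of a kernel; the five-term relation of J is the only one involving the
    dilogarithm of J among the subsets without infinity. *)
Lemma relation_basis : exists e : basis_index -> quad n -> 'I_n -> series K n,
  (forall t, is_relation p (e t)) /\
  (forall c : basis_index -> K, (forall J i, lincomb c e J i = 0) -> forall t, c t = 0).
Proof.
have [al [be [H1 H2]]] := log_rows.
have [f Hf] := fin_all_exists (fun J : {J : quad n | ptoo \notin val J} =>
  five_term p (valP J)).
pose c (t : basis_index) J : K * K * K :=
  match t with inl s => (al s J, be s J, 0) | inr u => (0, 0, f u J) end.
exists (fun t J => rel_form p (c t J) J); split=> [t|d Hd].
  apply: rel_form_relation => i; case: t => [s|u] /=.
    exact: sum_log_relation (H1 s) i.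
  by have [_ _ ->] := Hf u.
have distr (x a b g : K) (X Y Z : series K n) :
    cst (x * a) * X + cst (x * b) * Y + cst (x * g) * Z =
    cst x * (cst a * X + cst b * Y + cst g * Z).
  by rewrite !cstM; ring.
have z J : (\sum_t d t * (c t J).1.1, \sum_t d t * (c t J).1.2, \sum_t d t * (c t J).2) = (0, 0, 0).
  apply: (rel_form_inj gen) => i; rewrite -[RHS](Hd J i) /lincomb /rel_form /=.
  have cs (F : basis_index -> K) : cst (\sum_t F t) = \sum_t cst (F t) :> series K n.
    by apply: (big_morph (fun y => cst y : series K n)); [exact: cstD | exact: cst0].
  rewrite !cs !mulr_suml -!big_split /=; apply: eq_bigr => t _.
  exact: distr.
have zl s : d (inl s) = 0.
  apply: (H2 (fun s => d (inl s))) => J; have := z J; rewrite !big_sumType /= => -[e1 e2 _].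
  have r1 : \sum_(u : {J : quad n | ptoo \notin val J}) d (inr u) * (c (inr u) J).1.1 = 0.
    by apply: big1 => u _; rewrite /c /= mulr0.
  by move: e1 e2; rewrite r1 !addr0.
case=> [s|u]; first exact: zl.
have := z (val u); rewrite !big_sumType /= => -[_ _].
rewrite big1 ?add0r => [|s _]; last by rewrite /c /= mulr0.
rewrite (bigD1 u) //= big1 ?addr0 => [|u' ne].
  by rewrite /c /=; have [-> _ _] := Hf u; rewrite mulr1.
have [_ z' _] := Hf u'; rewrite /c /= z' ?mulr0 //; last exact: (valP u).
by rewrite (inj_eq val_inj) eq_sym.
Qed.

End Basis.

Section Main.
Variables (K : numFieldType) (n : nat).

Definition quad_of (a : 'I_#|{: quad n}|) : quad n := enum_val a.

Lemma sum_quad_of (V : nmodType) (F : quad n -> V) :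
  \sum_(a < #|{: quad n}|) F (quad_of a) = \sum_J F J.
Proof. by rewrite [RHS](reindex _ (onW_bij _ (@enum_val_bij _))). Qed.

Lemma cross_web_rank (p : 'I_n -> K) : in_compl (A0 K (n := n)) (chart_pt p) ->
  web_germ_rank (fun a => omega p (quad_of a)) #|basis_index n|.
Proof.
move=> gen; have [e [He inde]] := relation_basis gen.
exists (fun s a => e (enum_val s) (quad_of a)).
have sumE (c : basis_index n -> K) J i m :
    lincomb c e J i m = \sum_(s < #|basis_index n|) c (enum_val s) * e (enum_val s) J i m.
  rewrite /lincomb ser_sumE (reindex _ (onW_bij _ (@enum_val_bij _))) /=.
  by apply: eq_bigr => s _; rewrite cstME.
split.
- move=> s; have [h1 h2 h3 h4] := He (enum_val s); split.
  + by move=> a i; apply: h1.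
  + by move=> a i j m; apply: (congr1 (fun g : series K n => g m) (h2 _ i j)).
  + by move=> a i j m; apply: (congr1 (fun g : series K n => g m) (h3 _ i j)).
  + move=> i m; rewrite (sum_quad_of (fun J => e (enum_val s) J i m)).
    by have := congr1 (fun g : series K n => g m) (h4 i); rewrite /= ser_sumE.
- move=> c Hc s; rewrite -[s]enum_valK.
  apply: (inde (fun t => c (enum_rank t))) => J i; apply: serP => m.
  rewrite sumE ser0E -[RHS](Hc (enum_rank J) i m).
  by apply: eq_bigr => s' _; rewrite enum_valK /quad_of enum_rankK.
- move=> eta [h1 h2 h3 h4].
  have [|c Hc] := spanning gen (card_basis_index n) He inde
      (eta := fun J => eta (enum_rank J)).
    split.
    + by move=> J i; apply: h1.
    + by move=> J i j; apply: serP => m; apply: h2.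
    + move=> J i j; apply: serP => m; have := h3 (enum_rank J) i j m.
      by rewrite /quad_of enum_rankK.
    + move=> i; apply: serP => m; rewrite ser_sumE -[RHS](h4 i m).
      rewrite -sum_quad_of; apply: eq_bigr => a _.
      by rewrite /quad_of enum_valK.
  exists (fun s => c (enum_val s)) => a i m.
  by rewrite -sumE -Hc /quad_of enum_valK.
Qed.

Lemma resonance_web_cross :
  resonance_web (A0 K (n := n)) (fun a => cross_map K (quad_of a)).
Proof.
exists (fun a => res_comp K (quad_of a)); split.
- by move=> a b /comp_inj /enum_val_inj.
- move=> T; rewrite resonance_componentP; split=> [[J ->]|[a ->]].
    by exists (enum_rank J); rewrite /quad_of enum_rankK.
  by exists (quad_of a).
- by move=> a; apply: cross_resonance_map.
Qed.

Lemma generic_points : exists2 G : {mpoly K[n]}, G != 0 &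
  forall p : 'I_n -> K, G.@[p] != 0 -> in_compl (A0 K (n := n)) (chart_pt p).
Proof.
pose G := \prod_k localize (fun _ : 'I_n => 0) (A0 K (n := n) k).
have ev (p : 'I_n -> K) k : (localize (fun _ => 0) (A0 K k)).@[p] = (A0 K k).@[chart_pt p].
  rewrite /localize comp_mpoly_meval; apply: meval_eq => j.
  rewrite tnth_mktuple /chart_pt; case: unliftP => [i|] _ /=; last by rewrite meval1.
  by rewrite mevalD mevalXU mevalC addr0.
exists G; last first.
  move=> p; rewrite /G rmorph_prod => /prodf_neq0 H k.
  by rewrite -ev; apply: H.
(* G is nonzero because it does not vanish at (2, ..., n + 1), whose coordinates differ from each
   other and from 1 and 0. *)
pose X (i : 'I_n.+3) : K := (ptcase (fun i : 'I_n => (i.+2)%N) 1%N 0%N 0%N i)%:R.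
pose p (i : 'I_n) : K := (i.+2)%:R.
have cpl : in_compl (A0 K (n := n)) (chart_pt p).
  have -> : chart_pt p = cone_pt X.
    apply: funext => m; rewrite /chart_pt /cone_pt /X ptcase_0 subr0.
    by case: unliftP => [i|] _ /=; rewrite ptcaseE.
  apply: in_compl_cone => i j; rewrite !inE -!fin_oo /X => + + /eqP; rewrite eqr_nat => + + /eqP.
  case: (ptP i) => [i'|||]; case: (ptP j) => [j'|||]; rewrite !ptcaseE ?eqxx // => _ _ [].
  by move/val_inj ->.
suff : G.@[p] != 0 by apply: contraNneq => ->; rewrite meval0.
by rewrite /G rmorph_prod; apply/prodf_neq0 => k _; have := cpl k; rewrite -ev.
Qed.

End Main.

Theorem theorem4p1 (R : realType) (n : nat) (n_ge2 : (2 <= n)%N) :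
  resonance_web_rank (A0 (complex R) (n := n))
    (3 * 'C(n + 3, 4) - 'C(n + 2, 3) - 'C(n + 1, 2) - n)%N.
Proof.
rewrite -card_jet_index -card_basis_index.
exists #|{: quad n}|, (fun a => cross_map (complex R) (quad_of a)); split.
  exact: resonance_web_cross.
have [G G0 HG] := generic_points (complex R) n; exists G => // p /HG gen.
have -> : (fun a => level_form (cross_map (complex R) (quad_of a)) p) =
          (fun a => omega p (quad_of a)).
  by apply: funext => a; apply: level_form_cross.
split; first by apply: (cross_web_germ gen); apply: enum_val_inj.
exact: cross_web_rank.
Qed.
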